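(* Assume that $f$ is locally Lipschitz in the sense that, for every compact $K\subset\mathbb{R}^p$, there exists $\lambda\in L^1_{\rm loc}(\mathbb{R}_+,\mathbb{R}_+)$ such that $$\|f(t,\xi)-f(t,\zeta)\|\le\lambda(t)\|\xi-\zeta\|\quad\text{for all }\xi,\zeta\in K\text{ and all }t\ge0,$$ and that, for every compact set $T\subset\mathbb{R}_+$, there exist $\xi_0\in\mathbb{R}^p$, $b>0$ and $\delta>0$ such that $t\mapsto f(t,\xi_0)$ is bounded on $T$, $\|M\|\le b$ for all $M\in\bigcup_{(t,\xi)\in T\times\mathbb{R}^p}({\rm d}^{\rm c}f_t)(\xi)$ and $$|\det(I-DM)|\ge\delta\quad\text{for all }M\in\bigcup_{(t,\xi)\in T\times\mathbb{R}^p}({\rm d}^{\rm c}f_t)(\xi).$$ Then (L) has the uniqueness property, $\tilde{\mathcal B}(S^f,t_0)=\mathcal B(S^f,t_0)$ for all $t_0\ge0$, and, for all $v\in L^\infty_{\rm loc}(\mathbb{R}_+,\mathbb{R}^{m_{\rm e}})$, $t_0\ge0$ and $x^0\in\mathbb{R}^n$, there exists a unique $(v,x,y)\in\mathcal B(S^f,t_0)$ such that $x(t_0)=x^0$.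
   Context: Setting. $\mathbb{R}_+=[0,\infty)$; norms on $\mathbb{R}^k$ are Euclidean and matrix norms are the induced operator norms. Let $n,m,m_{\rm e},p$ be positive integers, $A\in\mathbb{R}^{n\times n}$, $B\in\mathbb{R}^{n\times m}$, $B_{\rm e}\in\mathbb{R}^{n\times m_{\rm e}}$, $C\in\mathbb{R}^{p\times n}$, $D\in\mathbb{R}^{p\times m}$, $D_{\rm e}\in\mathbb{R}^{p\times m_{\rm e}}$, and let $f:\mathbb{R}_+\times\mathbb{R}^p\to\mathbb{R}^m$ be a Caratheodory function, i.e. $f(t,\cdot)$ is continuous for every $t\ge0$ and $f(\cdot,\xi)$ is measurable for every $\xi\in\mathbb{R}^p$. The Lur'e system $S^f$, also called (L), is $$\dot x(t)=Ax(t)+Bf(t,y(t))+B_{\rm e}v(t),\qquad y(t)=Cx(t)+Df(t,y(t))+D_{\rm e}v(t).$$ Write $(f\circ y)(t):=f(t,y(t))$ and $f_t:=f(t,\cdot)$. Clarke derivative. For locally Lipschitz $g:\mathbb{R}^k\to\mathbb{R}^l$, let $N_g$ be the (null) set of points at which $g$ is not Fréchet differentiable, $({\rm d}g)(z)$ the Fréchet derivative at $z\notin N_g$, and $$({\rm d}^{\rm c}g)(z)={\rm co}\{M\in\mathbb{R}^{l\times k}:\exists\,z_j\in\mathbb{R}^k\setminus N_g\text{ with }z_j\to z\text{ and }({\rm d}g)(z_j)\to M\text{ as }j\to\infty\},$$ where ${\rm co}$ denotes the convex hull. Trajectories. For $0\le t_0<\tau\le\infty$, a pre-trajectory of (L)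 on $[t_0,\tau)$ is a triple $(v,x,y)\in L^\infty_{\rm loc}(\mathbb{R}_+,\mathbb{R}^{m_{\rm e}})\times W^{1,1}_{\rm loc}([t_0,\tau),\mathbb{R}^n)\times L^1_{\rm loc}([t_0,\tau),\mathbb{R}^p)$ such that $f\circ y\in L^1_{\rm loc}([t_0,\tau),\mathbb{R}^m)$ and both equations of (L) hold for a.e. $t\in[t_0,\tau)$ (''loc'' refers to compact subintervals of $[t_0,\tau)$; elements of $W^{1,1}_{\rm loc}$ are identified with locally absolutely continuous functions, and elements of $L^1_{\rm loc}$ are identified if equal a.e.). It is maximally defined if there is no pre-trajectory $(v,\tilde x,\tilde y)$ on some $[t_0,\tilde\tau)$ with $\tilde\tau>\tau$ and $(\tilde x,\tilde y)|_{[t_0,\tau)}=(x,y)$. $\tilde{\mathcal B}(S^f,t_0)$ denotes the set of all maximally defined pre-trajectories with initial time $t_0$; $\mathcal B(S^f,t_0)$ denotes the set of all trajectories on $[t_0,\infty)$, i.e. pre-trajectories on $[t_0,\tau)$ with $\tau=\infty$. Uniqueness property. (L) has the uniqueness property if, for every $v\in L^\infty_{\rm loc}(\mathbb{R}_+,\mathbb{R}^{m_{\rm e}})$ and every $t_0\ge0$, any two pre-trajectories $(v,x,y)$ and $(v,\tilde x,\tilde y)$ on $[t_0,\tau)$ and $[t_0,\tilde\tau)$, respectively, where $t_0<\tau\le\tilde\tau\le\infty$, coincide on $[t_0,\tau)$ if $x(t_0)=\tilde x(t_0)$. *)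

(* Defs.v *)
From HB Require Import structures.
From mathcomp Require Import all_boot all_order all_algebra.
From mathcomp Require Import all_classical all_reals all_analysis.

Set Implicit Arguments.
Unset Strict Implicit.
Unset Printing Implicit Defensive.

Import Order.TTheory GRing.Theory Num.Theory.
Import numFieldNormedType.Exports.

Local Open Scope classical_set_scope.
Local Open Scope ring_scope.

(* The norm of the library on matrices is the entrywise maximum; it is used here
   only for its topology and for Frechet differentiability, which are the same
   for all norms in finite dimension. All estimates use the norms below. *)
Definition enorm (R : realType) (k : nat) (x : 'cV[R]_k) : R :=
  Num.sqrt (\sum_i x i 0 ^+ 2).

Definition opnorm (R : realType) (l k : nat) (M : 'M[R]_(l, k)) : R :=
  sup [set enorm (M *m x) | x in [set x : 'cV[R]_k | enorm x <= 1]].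

(* The points of R with the Lebesgue-measurable (not only Borel) sets. *)
Definition lebR (R : realType) : measurableType _ :=
  caratheodory_type ((wlength (R := R) idfun)^*)%mu.

Definition leb (R : realType) : {measure set (lebR R) -> \bar R} :=
  @completed_lebesgue_measure R.

Definition Rplus (R : realType) : set R := [set t | 0 <= t].

Definition itv_co (R : realType) (t0 : R) (tau : \bar R) : set R :=
  [set t | t0 <= t /\ (t%:E < tau)%E].

Definition cmeasurable (R : realType) (k : nat) (I : set R)
    (g : R -> 'cV[R]_k) : Prop :=
  forall i, measurable_fun (I : set (lebR R)) (fun t : lebR R => g t i 0).

Definition cintegrable (R : realType) (k : nat) (I : set R)
    (g : R -> 'cV[R]_k) : Prop :=
  forall i, (leb R).-integrable I (fun t => (g t i 0)%:E).

Definition ess_bounded (R : realType) (k : nat) (I : set R)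
    (g : R -> 'cV[R]_k) : Prop :=
  exists c : R, {ae leb R, forall t, I t -> enorm (g t) <= c}.

Definition abs_continuous (R : realType) (k : nat) (a b : R)
    (x : R -> 'cV[R]_k) : Prop :=
  forall eps : R, 0 < eps -> exists2 delta : R, 0 < delta &
    forall (N : nat) (r s : 'I_N -> R),
      (forall i, [/\ a <= r i, r i <= s i & s i <= b]) ->
      (forall i j, i != j -> s i <= r j \/ s j <= r i) ->
      \sum_i (s i - r i) < delta ->
      \sum_i enorm (x (s i) - x (r i)) < eps.

(* Local function classes on an interval J; a function on J is represented by
   its values on J of a function on R, and an element of L^1_loc or L^oo_loc by
   any of its representatives. *)
Definition on_compacts (R : realType) (J : set R) (P : R -> R -> Prop) : Prop :=
  forall a b : R, [set` `[a, b]] `<=` J -> P a b.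

Definition L1_loc (R : realType) (k : nat) (J : set R)
    (g : R -> 'cV[R]_k) : Prop :=
  on_compacts J (fun a b => cintegrable [set` `[a, b]] g).

Definition Loo_loc (R : realType) (k : nat) (J : set R)
    (g : R -> 'cV[R]_k) : Prop :=
  on_compacts J (fun a b =>
    cmeasurable [set` `[a, b]] g /\ ess_bounded [set` `[a, b]] g).

Definition W11_loc (R : realType) (k : nat) (J : set R)
    (x : R -> 'cV[R]_k) : Prop :=
  on_compacts J (fun a b => abs_continuous a b x).

Definition caratheodory_fun (R : realType) (p m : nat)
    (f : R -> 'cV[R]_p -> 'cV[R]_m) : Prop :=
  (forall t, 0 <= t -> continuous (f t)) /\
  (forall xi, cmeasurable (@Rplus R) (f ^~ xi)).

(* The matrix of the Frechet derivative; meaningful where g is differentiable. *)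
Definition dmx (R : realType) (k l : nat) (g : 'cV[R]_k -> 'cV[R]_l)
    (z : 'cV[R]_k) : 'M[R]_(l, k) :=
  \matrix_(i, j) ('d g z (delta_mx j 0)) i 0.

Definition convex_hull (R : realType) (V : lmodType R) (A : set V) : set V :=
  \bigcap_(B in [set B : set V | A `<=` B /\ @convex_set R V B]) B.

Definition clarke (R : realType) (k l : nat) (g : 'cV[R]_k -> 'cV[R]_l)
    (z : 'cV[R]_k) : set 'M[R]_(l, k) :=
  convex_hull [set M : 'M[R]_(l, k) | exists u : nat -> 'cV[R]_k,
    [/\ forall j, differentiable g (u j),
        u j @[j --> \oo] --> z &
        dmx g (u j) @[j --> \oo] --> M]].

Record linsys (R : realType) (n m me p : nat) := LinSys {
  mxA : 'M[R]_n;
  mxB : 'M[R]_(n, m);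
  mxBe : 'M[R]_(n, me);
  mxC : 'M[R]_(p, n);
  mxD : 'M[R]_(p, m);
  mxDe : 'M[R]_(p, me)
}.

(* A triple (v, x, y) together with the right end point tau of the interval
   [t0, tau) on which x and y are considered. *)
Record triple (R : realType) (n me p : nat) := Triple {
  tend : \bar R;
  inp : R -> 'cV[R]_me;
  sta : R -> 'cV[R]_n;
  out : R -> 'cV[R]_p
}.

Section Lure.
Variables (R : realType) (n m me p : nat).
Variables (S : linsys R n m me p) (f : R -> 'cV[R]_p -> 'cV[R]_m).
Implicit Types (w : triple R n me p).

Definition pre_trajectory (t0 : R) w : Prop :=
  let: Triple tau v x y := w in
  let J := itv_co t0 tau in
  [/\ (t0%:E < tau)%E,
      [/\ Loo_loc (@Rplus R) v, W11_loc J x & L1_loc J y],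
      L1_loc J (fun t => f t (y t)),
      {ae leb R, forall t, J t -> is_derive t (1 : R) x
         (mxA S *m x t + mxB S *m f t (y t) + mxBe S *m v t)} &
      {ae leb R, forall t, J t ->
         y t = mxC S *m x t + mxD S *m f t (y t) + mxDe S *m v t}].

Definition coincide (t0 : R) (tau : \bar R) w w' : Prop :=
  (forall t, itv_co t0 tau t -> sta w t = sta w' t) /\
  {ae leb R, forall t, itv_co t0 tau t -> out w t = out w' t}.

Definition max_pre_trajectories (t0 : R) : set (triple R n me p) :=
  [set w | pre_trajectory t0 w /\
    ~ exists w', [/\ pre_trajectory t0 w', inp w' = inp w,
                     (tend w < tend w')%E & coincide t0 (tend w) w' w]].

Definition trajectories (t0 : R) : set (triple R n me p) :=
  [set w | pre_trajectory t0 w /\ tend w = +oo%E].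

Definition uniqueness_property : Prop :=
  forall v, Loo_loc (@Rplus R) v -> forall t0 : R, 0 <= t0 ->
  forall w w', pre_trajectory t0 w -> pre_trajectory t0 w' ->
    inp w = v -> inp w' = v -> (tend w <= tend w')%E ->
    sta w t0 = sta w' t0 -> coincide t0 (tend w) w w'.

End Lure.

Definition L1_loc_nonneg (R : realType) (lam : R -> R) : Prop :=
  (forall t, 0 <= t -> 0 <= lam t) /\
  on_compacts (@Rplus R) (fun a b =>
    (leb R).-integrable [set` `[a, b]] (fun t => (lam t)%:E)).

Definition loc_lipschitz (R : realType) (p m : nat)
    (f : R -> 'cV[R]_p -> 'cV[R]_m) : Prop :=
  forall K : set 'cV[R]_p, compact K -> exists2 lam : R -> R,
    L1_loc_nonneg lam &
    forall xi zeta, K xi -> K zeta -> forall t, 0 <= t ->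
      enorm (f t xi - f t zeta) <= lam t * enorm (xi - zeta).

Definition clarke_bigcup (R : realType) (p m : nat)
    (f : R -> 'cV[R]_p -> 'cV[R]_m) (T : set R) : set 'M[R]_(m, p) :=
  \bigcup_(q in T `*` [set: 'cV[R]_p]) clarke (f q.1) q.2.

(* Main.v *)
From HB Require Import structures.
Require Import Defs.
From mathcomp Require Import all_boot all_order all_algebra.
From mathcomp Require Import all_classical all_reals all_analysis.
From mathcomp Require Import perm measurable_realfun ring lra.
Import Order.TTheory GRing.Theory Num.Theory.
Import numFieldNormedType.Exports.
Set Implicit Arguments.
Unset Strict Implicit.
Unset Printing Implicit Defensive.
Local Open Scope classical_set_scope.
Local Open Scope ring_scope.

(** The output equation reads [F t (y t) = C x(t) + De v(t)], where
[F t y = y - D f(t, y)] is the closed loop map. Suppose that, locally uniformly in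
[t], the map [F t] is a bijection with [k |y - y'| <= |F t y - F t y'|]. Then [y(t)] is
a function of the state and the input which is Lipschitz in the state, and the
system is an ordinary differential equation whose right-hand side is globally
Lipschitz in [x], locally uniformly in [t]. Such an equation has exactly one solution
with a given initial value, and this solution exists for all times. All the
assertions follow, since a pre-trajectory that ends early can be extended by the
solution on the half-line.

That [F t] is such a bijection is a global inversion theorem for Lipschitz maps
([closed_loop_expansion], [closed_loop_surjective]). By assumption the matrices
[1 - D M], with [M] in the Clarke derivative of [f t] at a point, are bounded and have
determinants bounded away from zero, so that they expand all vectors by a common
constant. For a fixed vector [v] the vectors [(1 - D M) v] form a convex set, which a
hyperplane separates from the origin ([convex_separation]). Upper semicontinuity of the
Clarke derivative carries the separation over to the derivatives at nearby points of
differentiability, and the mean value inequality ([mean_value_differentiable])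
integrates it: near every point, [F t] is expanding with a constant that does not depend
on the point. The same argument with transposed matrices shows that the distance of
[F t] to a given value has no local minimum except zero. A map with these two properties
is open with a uniform radius on bounded sets, so that paths can be lifted; lifting segments gives
surjectivity, and lifting a contraction of the image of a segment to a point gives
injectivity ([global_injective]).

The mean value inequality uses the derivatives at the points of differentiability only.
It needs Rademacher's theorem in the form that there are segments, close to a given one,
almost all of whose points are points of differentiability. Let [k] be the first number
such that a Lipschitz function is differentiable at [z] along the span of the first [k]
axes but not along the span of the first [k + 1]. Unless the partial derivative along the
next axis fails to exist, [z] then belongs to one of countably many sets that are porous
along this axis, hence null along it: a Lipschitz function of one variable is
differentiable almost everywhere, whereas the distance to a porous set is not
differentiable at the points of this set ([bad_axis_null]). So the points of
nondifferentiability form a finite union of Borel sets, each null along all the lines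
parallel to some axis, and Fubini's theorem gives the segments ([exists_good_line]).

As for the differential equation, trajectories are absolutely continuous and satisfy it
almost everywhere. Existence is Picard iteration and uniqueness is Gronwall's lemma; both
rest on the inequality [ac_increment_le], according to which an absolutely continuous
function whose derivative is almost everywhere at most [c] has increments at most [c] times
the length of the interval. The right-hand side is measurable in time because solutions of
the output equation can be approximated by rational ones ([implicit_measurable]). *)

(** * Absolute continuity and the mean value inequality on the line *)

(** Completion only adds subsets of Borel null sets. *)
Lemma leb_negligibleE (R : realType) (A : set R) :
  (leb R).-negligible A <-> (@lebesgue_measure R).-negligible A.
Proof.
split=> -[B [mB B0 AB]].
  have : (completed_algebra_gen (@lebesgue_measure R)) B.
    by rewrite -g_sigma_completed_algebra_genE completed_caratheodory_measurable.
  move=> [X mX [N [M [mM M0 NM]] XNB]].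
  exists (X `|` M); split; first exact: measurableU.
  - have X0 : (@lebesgue_measure R) X = 0%E.
      apply/eqP; rewrite -measure_le0 -B0 -XNB.
      exact: (le_outer_measure ((wlength (R := R) idfun)^*)%mu).
    have := @measureU0 _ _ _ (@lebesgue_measure R) X M mX mM M0.
    by move=> /= ->; exact: X0.
  - by move=> x /AB; rewrite -XNB => -[Xx|/NM Mx]; [left|right].
exists B; split => //; exact: sub_caratheodory.
Qed.

(** Cousin's lemma on the existence of tagged partitions finer than a gauge [d],
stated as an induction principle so that no partition has to be handled: the
supremum [s] of the points of [P] belongs to [P] and cannot be less than [b],
since the interval tagged at [s] reaches beyond it. *)
Lemma gauge_induction (R : realType) (a b : R) (d : R -> R) (P : R -> Prop) :
  a <= b -> (forall t, 0 < d t) -> P a ->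
  (forall x t y, a <= x -> x <= t -> t <= y -> y <= b ->
     t - x < d t -> y - t < d t -> P x -> P y) ->
  P b.
Proof.
move=> ab d0 Pa Pstep.
pose E := [set x | a <= x /\ x <= b /\ P x].
have Ea : E a by [].
have supE : has_sup E by split; [exists a | exists b => x [_ []]].
set s := sup E.
have as_ : a <= s by apply: ub_le_sup => //; exact: supE.2.
have sb : s <= b by apply: ge_sup; [exists a | move=> x [_ []]].
have [x Ex xs] : exists2 x, E x & s - d s < x by exact: sup_adherent.
have xles : x <= s by apply: ub_le_sup => //; exact: supE.2.
have Py y : s <= y -> y <= b -> y - s < d s -> P y.
  move=> sy yb ysd; case: Ex => ax [_ Px].
  apply: (Pstep x s y) => //.
  by lra.
case: (ltP s b) => [ltsb|bs]; last first.
  by apply: Py => //; rewrite (le_lt_trans _ (d0 s))// subr_le0.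
pose y := Num.min b (s + d s / 2).
have sy : s < y by rewrite lt_min ltsb ltrDl divr_gt0.
have yb : y <= b by rewrite ge_min lexx.
have : E y.
  split; first exact: le_trans (ltW sy).
  split=> //; apply: Py => //; first exact: ltW.
  rewrite ltrBlDl (@le_lt_trans _ _ (s + d s / 2)) ?ge_min ?lexx ?orbT//.
  by rewrite ltrD2l ltr_pdivrMr// mulr_natr mulr2n ltrDl.
by move=> /(ub_le_sup supE.2); rewrite leNgt sy.
Qed.

Definition nonoverlapping (R : realType) (l : seq (R * R)) :=
  pairwise (fun p q : R * R => q.2 <= p.1) l.

(** The intervals are listed from right to left, so that an interval to the right
of all the others is added by a cons. *)
Definition ac (R : realType) (a b : R) (phi : R -> R) : Prop :=
  forall eps : R, 0 < eps -> exists2 delta : R, 0 < delta &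
    forall l : seq (R * R),
      (forall p, p \in l -> [/\ a <= p.1, p.1 <= p.2 & p.2 <= b]) ->
      nonoverlapping l ->
      \sum_(p <- l) (p.2 - p.1) < delta ->
      \sum_(p <- l) `|phi p.2 - phi p.1| < eps.

Lemma entry_le_enorm (R : realType) (k : nat) (x : 'cV[R]_k) i :
  `|x i 0| <= enorm x.
Proof.
rewrite -sqrtr_sqr ler_wsqrtr// (bigD1 i)//= lerDl.
by apply: sumr_ge0 => j _; exact: sqr_ge0.
Qed.

Lemma abs_continuous_ac (R : realType) (k : nat) (a b : R) (x : R -> 'cV[R]_k) i :
  abs_continuous a b x -> ac a b (fun t => x t i 0).
Proof.
move=> acx e e0; have [d d0 acd] := acx _ e0; exists d => // l lab nol ld.
pose r (j : 'I_(size l)) := (nth (0, 0) l j).1.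
pose s (j : 'I_(size l)) := (nth (0, 0) l j).2.
have sumE (F : R * R -> R) : \sum_(p <- l) F p = \sum_(j < size l) F (r j, s j).
  rewrite (big_nth (0, 0)) big_mkord; apply: eq_bigr => j _.
  by rewrite /r /s -surjective_pairing.
rewrite sumE /=; apply: le_lt_trans (acd _ r s _ _ _).
- apply: ler_sum => j _; apply: le_trans (entry_le_enorm _ i).
  by rewrite mxE mxE.
- by move=> j; apply: lab; exact: mem_nth.
- move=> i1 i2 i12; move/(pairwiseP (0, 0)) : nol => nol.
  have : (i1 != i2 :> nat) by [].
  rewrite neq_ltn => /orP[] lt12; [right|left]; apply: nol => //; exact: ltn_ord.
- by rewrite sumE in ld.
Qed.

Definition lip_on (R : realType) (a b L : R) (phi : R -> R) :=
  forall s t, a <= s -> s <= t -> t <= b -> `|phi t - phi s| <= L * (t - s).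

Lemma lip_on_ac (R : realType) (a b L : R) (phi : R -> R) :
  lip_on a b L phi -> ac a b phi.
Proof.
move=> lip e e0; exists (e / (1 + `|L|)).
  by rewrite divr_gt0// ltr_wpDr.
move=> l lab _; rewrite ltr_pdivlMr ?ltr_wpDr// => lt.
apply: le_lt_trans lt; rewrite mulr_suml big_seq [leRHS]big_seq.
apply: ler_sum => p pl; have [h1 h2 h3] := lab _ pl.
apply: le_trans (lip _ _ h1 h2 h3) _; rewrite mulrC ler_wpM2l ?subr_ge0//.
by rewrite (le_trans (ler_norm L))// lerDr.
Qed.

Lemma acB (R : realType) (a b : R) (phi psi : R -> R) :
  ac a b phi -> ac a b psi -> ac a b (fun t => phi t - psi t).
Proof.
move=> acf acg e e0; have e2 : 0 < e / 2 by rewrite divr_gt0.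
have [d1 d10 h1] := acf _ e2; have [d2 d20 h2] := acg _ e2.
exists (Num.min d1 d2); first by rewrite lt_min d10.
move=> l lab nol; rewrite lt_min => /andP[l1 l2].
have := ltrD (h1 l lab nol l1) (h2 l lab nol l2); rewrite -splitr -big_split/=.
apply: le_lt_trans; apply: ler_sum => p _.
rewrite (_ : _ - _ = (phi p.2 - phi p.1) - (psi p.2 - psi p.1)); last by ring.
exact: ler_normB.
Qed.

Lemma ac_sub (R : realType) (a b c d : R) (phi : R -> R) :
  a <= c -> d <= b -> ac a b phi -> ac c d phi.
Proof.
move=> ac_ db acf e e0; have [d1 d10 h1] := acf _ e0; exists d1 => // l lab.
apply: h1 => p /lab [h2 h3 h4]; split => //; first exact: le_trans h2.
exact: le_trans db.
Qed.

Lemma is_derive_epsP (R : realType) (phi : R -> R) (t D : R) :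
  is_derive t (1 : R) phi D <->
  forall e, 0 < e -> exists2 r, 0 < r &
    forall h, `|h| < r -> `|phi (t + h) - phi t - D * h| <= e * `|h|.
Proof.
have key E h : h != 0 -> `|phi (t + h) - phi t - E * h| =
    `|E - h^-1 *: ((phi \o shift t) (h *: (1 : R)) - phi t)| * `|h|.
  move=> h0; rewrite -normrM distrC; congr `|_|.
  by rewrite /= /GRing.scale/= mulr1 (addrC h t); field.
split=> [[dphi <-] e e0|H].
  have [/= r r0 Hr] : \forall h \near (0 : R)^', `|'D_1 phi t -
      h^-1 *: ((phi \o shift t) (h *: (1 : R)) - phi t)| < e.
    by move: e e0; apply/cvgrPdist_lt; exact: dphi.
  exists r => // h hr.
  have [->|h0] := eqVneq h 0.
    by rewrite addr0 subrr mulr0 subr0 normr0 mulr0.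
  have := Hr h; rewrite /ball/= sub0r normrN => /(_ hr h0) /ltW Hh.
  rewrite (_ : `|_| = `|'D_1 phi t - h^-1 *: ((phi \o shift t) (h *: (1 : R)) - phi t)| * `|h|).
    by rewrite ler_wpM2r.
  exact: key.
have cv : h^-1 *: ((phi \o shift t) (h *: (1 : R)) - phi t) @[h --> 0^'] --> D.
  apply/cvgrPdist_le => e e0; have [r r0 Hr] := H e e0.
  exists r => //= h; rewrite /ball/= sub0r normrN => hr h0.
  have := Hr h hr; rewrite (key _ h h0).
  by rewrite ler_pM2r// normr_gt0.
split; first by apply/cvg_ex; exists D.
by apply/cvg_lim => //; exact: Rhausdorff.
Qed.

Lemma negligible_set1 (R : realType) (a : R) :
  (@lebesgue_measure R).-negligible [set a].
Proof. by exists [set a]; split => //; rewrite lebesgue_measure_set1. Qed.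

Lemma open_cover_negligible (R : realType) (N : set R) (e : R) :
  (@lebesgue_measure R).-negligible N -> 0 < e ->
  exists U : set R, [/\ open U, N `<=` U & (@lebesgue_measure R U < e%:E)%E].
Proof.
move=> [B [mB B0 NB]] e0.
have Bfin : (@lebesgue_measure R B < +oo)%E by rewrite B0 ltry.
have [U [oO BO Oe]] := lebesgue_regularity_outer mB Bfin e0.
exists U; split => //; first exact: subset_trans BO.
apply: le_lt_trans Oe.
have mO : @measurable _ (measurableTypeR R) U := open_measurable oO.
have mOB : measurable (U `\` B) by exact: measurableD.
have := @measureU2 _ _ _ (@lebesgue_measure R) _ _ mOB mB.
by rewrite setUC setDUK//= => /le_trans; apply; rewrite -[leRHS]adde0 leeD2l// B0.
Qed.

(** In a tagged partition adapted to a suitable gauge, the intervals tagged at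
points where the bound of the derivative holds contribute at most
[(c + e) * (b - a)], and the other ones lie in an open set of small measure, so
that absolute continuity bounds their contribution. This single inequality
replaces the fundamental theorem of calculus for absolutely continuous functions
in all the later estimates. *)
Theorem ac_increment_le (R : realType) (a b c : R) (phi dphi : R -> R) :
  a <= b -> ac a b phi ->
  {ae @lebesgue_measure R, forall t, a < t -> t < b ->
     is_derive t (1 : R) phi (dphi t) /\ dphi t <= c} ->
  phi b - phi a <= c * (b - a).
Proof.
move=> ab acf aed.
suff H e : 0 < e -> phi b - phi a <= c * (b - a) + e * (b - a + 2).
  have ba2 : 0 < b - a + 2 by lra.
  apply/ler_addgt0Pr => e e0.
  have := H (e / (b - a + 2)); rewrite divr_gt0// => /(_ isT).
  by rewrite divfK// gt_eqF.
move=> e0; pose C := c + e.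
pose N0 := ~` [set t | a < t -> t < b ->
  is_derive t (1 : R) phi (dphi t) /\ dphi t <= c].
have {}aed : (@lebesgue_measure R).-negligible N0 by exact: aed.
have nN : (@lebesgue_measure R).-negligible (N0 `|` [set a] `|` [set b]).
  by apply: negligibleU; [apply: negligibleU|]; rewrite //; exact: negligible_set1.
set N := _ `|` _ in nN.
have [d1 d10 acd] := acf e e0.
pose eta := Num.min d1 (e / (1 + `|C|)).
have C1 : 0 < 1 + `|C| by rewrite ltr_wpDr.
have eta0 : 0 < eta by rewrite lt_min d10 divr_gt0.
have [U [oO NO Oeta]] := open_cover_negligible nN eta0.
have mO : @measurable _ (measurableTypeR R) U := open_measurable oO.
(* The gauge: at a good point it comes from the derivative, at a point of the null
   set [N] from the open set [U] that contains it. *)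
have gaugeP t : exists2 r, 0 < r & (t \in `[a, b] ->
    (~ N t /\ forall x y, x <= t -> t <= y -> t - x < r -> y - t < r ->
        phi y - phi x <= C * (y - x)) \/
    (forall z, `|t - z| < r -> U z)).
  have [Nt|Nt] := pselect (N t).
    have /nbhs_ballP[r r0 rO] := (open_nbhs_nbhs (conj oO (NO _ Nt))).
    by exists r => // _; right => z tz; exact: rO.
  have [atb|] := boolP (t \in `]a, b[); last first.
    move=> nab; exists 1 => // tab; exfalso; apply: Nt.
    move: nab tab; rewrite !in_itv/= => nab /andP[at_ tb].
    move: nab; rewrite negb_and -!leNgt => /orP[ta|bt].
      by left; right; apply: le_anti; rewrite ta at_.
    by right; apply: le_anti; rewrite bt tb.
  have /contrapT : ~ N0 t by move=> N0t; apply: Nt; left; left.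
  move: atb; rewrite in_itv/= => /andP[at_ tb] /(_ at_ tb)[/is_derive_epsP dt dc].
  have [r r0 Hr] := dt e e0.
  exists r => // _; left; split=> // x y xt ty txr tyr.
  have h1 : `|x - t| < r by rewrite distrC ger0_norm ?subr_ge0.
  have h2 : `|y - t| < r by rewrite ger0_norm ?subr_ge0.
  have := Hr _ h1; have := Hr _ h2.
  rewrite !subrKC (ger0_norm (_ : 0 <= y - t)) ?subr_ge0//.
  rewrite (ler0_norm (_ : x - t <= 0)) ?subr_le0// !ler_norml.
  move=> /andP[_ k1] /andP[k2 _].
  have k3 : dphi t * (y - x) <= c * (y - x) by rewrite ler_wpM2r// subr_ge0 (le_trans xt).
  by rewrite /C; lra.
pose d t := sval (cid2 (gaugeP t)).
have d0 t : 0 < d t by rewrite /d; case: cid2.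
(* The list [l] collects the intervals tagged in [N]; the first bound says that they
   are nonoverlapping parts of [U]. *)
pose P x := exists l : seq (R * R), [/\
  forall p, p \in l -> [/\ a <= p.1, p.1 <= p.2 & p.2 <= x],
  nonoverlapping l,
  ((\sum_(p <- l) (p.2 - p.1))%:E <= @lebesgue_measure R (U `&` `]a, x]))%E &
  phi x - phi a <= C * (x - a) +
    \sum_(p <- l) (`|phi p.2 - phi p.1| + `|C| * (p.2 - p.1))].
have mOI x : @measurable _ (measurableTypeR R) (U `&` `]a, x]) by exact: measurableI.
have [l [lab nol lO lphi]] : P b.
  apply: (gauge_induction ab d0).
    exists [::]; split => //; first by rewrite big_nil.
    by rewrite big_nil addr0 !subrr mulr0.
  move=> x t y ax xt ty yb txd ytd [l [lab nol lO lphi]].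
  have xy : x <= y by exact: le_trans ty.
  have tab : t \in `[a, b] by rewrite in_itv/= (le_trans ax)// (le_trans ty).
  have [[_ good]|bad] : (~ N t /\ forall x y, x <= t -> t <= y ->
        t - x < d t -> y - t < d t -> phi y - phi x <= C * (y - x)) \/
    (forall z, `|t - z| < d t -> U z).
    by move: tab; rewrite /d; case: cid2.
  - exists l; split => //.
    + by move=> p /lab[? ? p2]; split => //; exact: le_trans xy.
    + apply: (le_trans lO); apply: le_measure; [exact: (mem_set (mOI _))|exact: (mem_set (mOI _))|].
      move=> z [Uz /=]; rewrite in_itv/= => /andP[az zx].
      by split => //=; rewrite in_itv/= az (le_trans zx).
    + have := good x y xt ty txd ytd; lra.
  - exists ((x, y) :: l); split.
    + move=> p; rewrite in_cons => /predU1P[->//|/lab[? ? p2]]; split => //.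
      exact: le_trans xy.
    + rewrite /nonoverlapping/= -/(nonoverlapping _) nol andbT.
      by apply/allP => p /lab [].
    + rewrite big_cons/= addrC EFinD.
      apply: (@le_trans _ _ (@lebesgue_measure R ((U `&` `]a, x]) `|` `]x, y]))).
        have := @measureU _ _ _ (@lebesgue_measure R) (U `&` `]a, x]) `]x, y]%classic (mOI x) (measurable_itv _).
        move=> /= ->; last first.
          apply/seteqP; split => // z [[_ /=]]; rewrite !in_itv/=.
          by move=> /andP[_ zx] /andP[xz _]; move: (lt_le_trans xz zx); rewrite ltxx.
        apply: leeD => //; rewrite lebesgue_measure_itv/= lte_fin.
        by case: ltP => [_|yx]; rewrite ?EFinB// lee_fin subr_le0.
      apply: le_measure; [apply: mem_set; exact: measurableU|exact: (mem_set (mOI _))|].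
      move=> z [[Uz]|]; rewrite /= !in_itv/= => /andP[az zx]; split => //.
        by rewrite az (le_trans zx).
        by apply: bad; rewrite ltr_norml; lra.
      by rewrite zx (le_lt_trans ax).
    + rewrite big_cons/=.
      have h1 := ler_norm (phi y - phi x).
      have h2 : - `|C| * (y - x) <= C * (y - x).
        by rewrite ler_wpM2r ?subr_ge0// lerNl -normrN ler_norm.
      lra.
have suml : \sum_(p <- l) (p.2 - p.1) < eta.
  rewrite -lte_fin; apply: (le_lt_trans lO); apply: le_lt_trans Oeta.
  by apply: le_measure; [exact: (mem_set (mOI _))|exact: mem_set|].
move: (suml); rewrite lt_min => /andP[suml1 suml2].
have := acd l lab nol suml1.
move: lphi; rewrite big_split/= -mulr_sumr.
have : `|C| * (\sum_(p <- l) (p.2 - p.1)) <= e.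
  apply: (@le_trans _ _ (`|C| * (e / (1 + `|C|)))); first by rewrite ler_wpM2l// ltW.
  rewrite mulrCA -[leRHS]mulr1 ler_wpM2l ?(ltW e0)// ler_pdivrMr//.
  by rewrite mul1r lerDr.
rewrite /C => h1 h2 h3; clear -h1 h2 h3; lra.
Qed.

(** * Lipschitz functions of one variable *)

Lemma aeS d (T : measurableType d) (R : realType) (mu : {measure set T -> \bar R})
    (P Q : T -> Prop) :
  {ae mu, forall x, P x} -> (forall x, P x -> Q x) -> {ae mu, forall x, Q x}.
Proof.
move=> aeP PQ; apply: negligibleS aeP => x /= nQ Px; exact/nQ/PQ.
Qed.

Lemma aeI d (T : measurableType d) (R : realType) (mu : {measure set T -> \bar R})
    (P Q : T -> Prop) :
  {ae mu, forall x, P x} -> {ae mu, forall x, Q x} ->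
  {ae mu, forall x, P x /\ Q x}.
Proof.
move=> aeP aeQ; apply: negligibleS (negligibleU aeP aeQ) => x /= /not_andP.
by case; [left|right].
Qed.

Lemma near_shift_itv (R : realFieldType) (M t h : R) :
  `|h| < t + M -> `|h| < M - t -> - M < t + h /\ t + h < M.
Proof. by rewrite !ltr_norml => /andP[? ?] /andP[? ?]; split; lra. Qed.

Lemma lipschitz_continuous (R : realType) (V W : normedModType R) (f : V -> W) (L : R) :
  (forall x y, `|f x - f y| <= L * `|x - y|) -> continuous f.
Proof.
move=> fL x; apply/cvgrPdist_lt => e e0.
have K0 : 0 < 1 + `|L| by rewrite ltr_wpDr.
have eK : 0 < e / (1 + `|L|) by rewrite divr_gt0.
apply/nbhs_ballP; exists (e / (1 + `|L|)) => //= y; rewrite -ball_normE/= => xy.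
apply: le_lt_trans (fL x y) _.
apply: (@le_lt_trans _ _ ((1 + `|L|) * `|x - y|)).
  by rewrite ler_wpM2r// (le_trans (ler_norm L))// lerDr.
by rewrite mulrC -ltr_pdivlMr.
Qed.

(** If [phi] has Lipschitz constant 1/2, then [t / 2 + phi t] and [t / 2 - phi t]
are nondecreasing and add up to [t], so that their Stieltjes measures add up to
Lebesgue measure. The first measure therefore has a density, and the fundamental
theorem of calculus differentiates its distribution function. *)
Section lipschitz_lebesgue_stieltjes.
Variables (R : realType) (phi : R -> R) (M : R).
Hypothesis phi_lip : forall s t, `|phi t - phi s| <= 2^-1 * `|t - s|.

Let psi (sg t : R) : R := t / 2 + sg * phi t.

Let psi_lip sg : `|sg| = 1 -> forall s t, `|psi sg t - psi sg s| <= `|t - s|.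
Proof.
move=> sg1 s t; rewrite /psi.
rewrite (_ : _ - _ = (t - s) / 2 + sg * (phi t - phi s)); last by field.
rewrite (le_trans (ler_normD _ _))// !normrM sg1 mul1r normfV (gtr0_norm (_ : 0 < 2%:R))//.
have := phi_lip s t; lra.
Qed.

Let psi_nd sg : `|sg| = 1 -> {homo psi sg : x y / x <= y}.
Proof.
move=> sg1 s t st; rewrite -subr_ge0 /psi.
rewrite (_ : _ - _ = (t - s) / 2 + sg * (phi t - phi s)); last by field.
have := phi_lip s t; rewrite (ger0_norm (_ : 0 <= t - s)) ?subr_ge0//.
have : - (sg * (phi t - phi s)) <= `|phi t - phi s|.
  by rewrite (le_trans (ler_norm _))// normrN normrM sg1 mul1r.
lra.
Qed.

Let psi_rc sg : `|sg| = 1 -> right_continuous (psi sg).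
Proof.
move=> sg1; apply: right_continuousW; apply: (@lipschitz_continuous _ _ _ _ 1) => s t.
by rewrite mul1r; exact: psi_lip.
Qed.

Let sg1 : `|1 : R| = 1. Proof. by rewrite normr1. Qed.
Let sgN1 : `|-1 : R| = 1. Proof. by rewrite normrN1. Qed.

Let psi1 : cumulative R R := HB.pack (psi 1)
  (isCumulative.Build R _ R (psi 1) (psi_nd sg1) (psi_rc sg1)).
Let psi2 : cumulative R R := HB.pack (psi (-1))
  (isCumulative.Build R _ R (psi (-1)) (psi_nd sgN1) (psi_rc sgN1)).

Let mu1 : {measure set (measurableTypeR R) -> \bar R} :=
  lebesgue_stieltjes_measure psi1.
Let mu2 : {measure set (measurableTypeR R) -> \bar R} :=
  lebesgue_stieltjes_measure psi2.

Let mu1_itv a b : a <= b -> mu1 `]a, b]%classic = (psi 1 b - psi 1 a)%:E.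
Proof.
move=> ab; transitivity ((wlength psi1)^*%mu `]a, b]%classic); first by [].
rewrite measurable_mu_extE/=; last exact: is_ocitv.
by rewrite wlength_itv_bnd.
Qed.

Let mu2_itv a b : a <= b -> mu2 `]a, b]%classic = (psi (-1) b - psi (-1) a)%:E.
Proof.
move=> ab; transitivity ((wlength psi2)^*%mu `]a, b]%classic); first by [].
rewrite measurable_mu_extE/=; last exact: is_ocitv.
by rewrite wlength_itv_bnd.
Qed.

Let mu12 A : measurable A -> lebesgue_measure A = (mu1 A + mu2 A)%E.
Proof.
move=> mA; rewrite -(measure_addE mu1 mu2).
apply: lebesgue_measure_unique => // X [[a b] _ <-]/=.
have [ba|ab] := leP b a.
  by rewrite set_itv_ge ?bnd_simp -?leNgt// !measure0.
have ab' := ltW ab.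
transitivity (mu1 `]a, b]%classic + mu2 `]a, b]%classic)%E; last first.
  exact: (esym (measure_addE mu1 mu2 _)).
rewrite mu1_itv// mu2_itv//.
rewrite lebesgue_measure_itv/= lte_fin ab -EFinB -EFinD; congr (_%:E).
by rewrite /psi; field.
Qed.

Let D := (`]-M, M]%classic : set (measurableTypeR R)).
Let mD : measurable D. Proof. exact: measurable_itv. Qed.

Let mu1D : (mu1 D < +oo)%E.
Proof.
rewrite /D; have [MM|MM] := leP M (- M).
  by rewrite set_itv_ge ?bnd_simp -?leNgt// measure0.
by rewrite mu1_itv ?ltry// ltW.
Qed.

Let nu := mfrestr mD mu1D.

Lemma half_lipschitz_ae_derivable :
  {ae @lebesgue_measure R, forall t, - M < t -> t < M -> derivable phi t 1}.
Proof.
(* The derivative of [phi] is the density of the first measure minus 1/2. *)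
have dom : nu `<< @lebesgue_measure R.
  apply/null_content_dominatesP => A mA A0.
  have := mu12 mA; rewrite A0 => /esym/eqP.
  rewrite padde_eq0 ?measure_ge0// => /andP[/eqP mu1A _].
  apply/eqP; rewrite -measure_le0 -mu1A.
  by apply: le_measure; rewrite ?inE//; exact: measurableI.
have [f [f0 ffin intf nuE]] := radon_nikodym_sigma_finite dom.
pose g := fine \o f.
have fE : f = EFin \o g by apply/funext => x; rewrite /g/= fineK.
have intg (A : set R) : measurable A -> (@lebesgue_measure R).-integrable A (EFin \o g).
  by move=> mA; rewrite -fE; apply: integrableS intf.
have locg : locally_integrable setT g.
  by apply: open_integrable_locally; [exact: openT|exact: intg].
have := FTC1 (a := BRight (- M)) (fun y => intg _ (measurable_itv _)) locg.
move/aeS; apply => t dF tM1 tM2; have [{}dF _] := dF tM1.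
set F := fun x => _ in dF.
have FE x : - M < x -> x < M -> F x = psi 1 x - psi 1 (- M).
  move=> Mx xM; rewrite /F /Rintegral -[RHS]/(fine (_%:E)); congr fine.
  rewrite -mu1_itv ?(ltW Mx)//.
  transitivity (nu `]-M, x]%classic).
    by apply: etrans (esym (nuE _ (measurable_itv _))); apply: eq_integral => y _; rewrite fE.
  rewrite /nu /mfrestr/= /mrestr; congr (mu1 _); apply/seteqP; split => [z []//|z zx].
  by split => //; move: zx; rewrite /D /= !in_itv/= => /andP[-> /le_trans->]//; exact: ltW.
have : is_derive t (1 : R) F ('D_1 F t) by exact: derivableP.
move=> /is_derive_epsP dFe.
suff : is_derive t (1 : R) phi ('D_1 F t - 2^-1) by case.
apply/is_derive_epsP => e e0; have [r r0 Hr] := dFe e e0.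
exists (Num.min r (Num.min (t + M) (M - t))).
  by rewrite !lt_min r0; rewrite subr_gt0 tM2 -[t]opprK addrC subr_gt0 ltrNl tM1.
move=> h; rewrite !lt_min => /andP[hr /andP[h1 h2]].
have [h3 h4] := near_shift_itv h1 h2.
have := Hr h hr; rewrite !FE//.
rewrite (_ : psi 1 (t + h) - _ - _ - _ =
  phi (t + h) - phi t - ('D_1 F t - 2^-1) * h)//.
by rewrite /psi; field.
Qed.

End lipschitz_lebesgue_stieltjes.

Theorem lipschitz_ae_derivable (R : realType) (phi : R -> R) (L : R) :
  (forall s t, `|phi t - phi s| <= L * `|t - s|) ->
  {ae @lebesgue_measure R, forall t, derivable phi t 1}.
Proof.
move=> phiL; pose K := 2 * (1 + `|L|).
have K0 : 0 < K by rewrite mulr_gt0// ltr_wpDr.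
pose f t := phi t / K.
have fl s t : `|f t - f s| <= 2^-1 * `|t - s|.
  rewrite /f -mulrBl normrM normfV (gtr0_norm K0) ler_pdivrMr// mulrAC.
  rewrite /K mulrA mulVf// mul1r (le_trans (phiL s t))// ler_wpM2r//.
  by rewrite (le_trans (ler_norm L))// lerDr.
have := fun M => half_lipschitz_ae_derivable M fl => H.
suff : (@lebesgue_measure R).-negligible (~` [set t | derivable phi t 1]) by [].
have nU : (@lebesgue_measure R).-negligible
    (\bigcup_k ~` [set t | - (k%:R : R) < t -> t < k%:R -> derivable f t 1]).
  by apply: negligible_bigcup => k; exact: H.
apply: negligibleS nU.
move=> t /= nd; exists (Num.truncn `|t|).+1 => //= H1; apply: nd.
have /andP[t1 t2] : - ((Num.truncn `|t|).+1%:R : R) < t < (Num.truncn `|t|).+1%:R.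
  by rewrite -ltr_norml; exact: truncnS_gt.
have := H1 t1 t2 => df.
have -> : phi = K \*: f.
  by apply/funext => x; rewrite /f/= /GRing.scale/= mulrC divfK// gt_eqF.
exact: derivableZ.
Qed.

(** * Norms, scalar products and porous sets *)

Section matrix_norm.
Variables (R : realType) (m n : nat).
Implicit Types M : 'M[R]_(m, n).

Lemma mx_normP M (c : R) : 0 <= c ->
  reflect (forall i j, `|M i j| <= c) (`|M| <= c).
Proof.
move=> c0; rewrite /Num.norm/= mx_normrE.
apply: (iffP idP) => [/bigmax_leP[_ H] i j|H]; first exact: (H (i, j)).
by apply/bigmax_leP; split => // -[i j] _; exact: H.
Qed.

Lemma entry_le_norm M i j : `|M i j| <= `|M|.
Proof. by have /mx_normP := lexx `|M|; apply; exact: normr_ge0. Qed.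

End matrix_norm.

Definition dotp (R : realType) (k : nat) (a h : 'cV[R]_k) : R :=
  \sum_i a i 0 * h i 0.

Section dotp_theory.
Variables (R : realType) (k : nat).
Implicit Types a b h : 'cV[R]_k.

Lemma dotpC a h : dotp a h = dotp h a.
Proof. by apply: eq_bigr => i _; rewrite mulrC. Qed.

Lemma dotpDr a h1 h2 : dotp a (h1 + h2) = dotp a h1 + dotp a h2.
Proof. by rewrite /dotp -big_split/=; apply: eq_bigr => i _; rewrite mxE mulrDr. Qed.

Lemma dotpZr a c h : dotp a (c *: h) = c * dotp a h.
Proof. by rewrite /dotp mulr_sumr; apply: eq_bigr => i _; rewrite mxE mulrCA. Qed.

Lemma dotp0r a : dotp a 0 = 0.
Proof. by rewrite -(scale0r 0) dotpZr mul0r. Qed.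

Lemma dotpNr a h : dotp a (- h) = - dotp a h.
Proof. by rewrite -scaleN1r dotpZr mulN1r. Qed.

Lemma dotpBr a h1 h2 : dotp a (h1 - h2) = dotp a h1 - dotp a h2.
Proof. by rewrite dotpDr dotpNr. Qed.

Lemma dotpDl a b h : dotp (a + b) h = dotp a h + dotp b h.
Proof. by rewrite dotpC dotpDr !(dotpC h). Qed.

Lemma dotpZl c a h : dotp (c *: a) h = c * dotp a h.
Proof. by rewrite dotpC dotpZr dotpC. Qed.

Lemma dotpNl a h : dotp (- a) h = - dotp a h.
Proof. by rewrite dotpC dotpNr dotpC. Qed.

Lemma dotpBl a b h : dotp (a - b) h = dotp a h - dotp b h.
Proof. by rewrite dotpDl dotpNl. Qed.

Lemma dotp_delta a i : dotp a (delta_mx i 0) = a i 0.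
Proof.
rewrite /dotp (bigD1 i)//= mxE !eqxx mulr1 big1 ?addr0// => j ji.
by rewrite mxE (negPf ji) mulr0.
Qed.

Lemma dotp_norm_le a h : `|dotp a h| <= k%:R * `|a| * `|h|.
Proof.
apply: le_trans (ler_norm_sum _ _ _) _.
apply: (@le_trans _ _ (\sum_(i < k) (`|a| * `|h|))).
  by apply: ler_sum => i _; rewrite normrM ler_pM// entry_le_norm.
by rewrite sumr_const card_ord -mulrA mulr_natl.
Qed.

Lemma dotp_ge0 a : 0 <= dotp a a.
Proof. by apply: sumr_ge0 => i _; rewrite -expr2 sqr_ge0. Qed.

Lemma sqr_norm_le_dotp a : `|a| ^+ 2 <= dotp a a.
Proof.
have s0 : 0 <= Num.sqrt (dotp a a) := sqrtr_ge0 _.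
rewrite -(sqr_sqrtr (dotp_ge0 a)) ler_sqr ?nnegrE//.
apply/mx_normP => // i j; rewrite (ord1 j) -sqrtr_sqr ler_wsqrtr//.
rewrite /dotp (bigD1 i)//= -expr2 lerDl.
by apply: sumr_ge0 => l _; rewrite -expr2 sqr_ge0.
Qed.

Lemma dotp_le_sqr_norm a : dotp a a <= k%:R * `|a| ^+ 2.
Proof.
by rewrite (le_trans (ler_norm _))// (le_trans (dotp_norm_le _ _))// expr2 mulrA.
Qed.

End dotp_theory.

Definition ratv (R : realType) (k : nat) (h : 'cV[rat]_k) : 'cV[R]_k := map_mx ratr h.
Arguments ratv R {k} h.

Section porous.
Variables (R : realType) (p : nat) (G : 'cV[R]_p -> R) (L : R).
Hypothesis L0 : 0 < L.
Hypothesis G_lip : forall x y, `|G x - G y| <= L * `|x - y|.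

Definition incr_err (z a h : 'cV[R]_p) := `|G (z + h) - G z - dotp a h|.

Definition below (k : nat) (h : 'cV[rat]_p) := forall i : 'I_p, (k <= i)%N -> h i 0 = 0.

Definition axis (k : 'I_p) : 'cV[R]_p := delta_mx k 0.

(** The three conditions make the trace of this set on a line parallel to axis [k]
porous. Let [z] be one of its points and [h] an increment for which [a] is not an
approximate derivative at [z]. If the line had another point of the set close to
[z + t], where [t] is the component of [h] along axis [k], the first condition at
that point and the second one at [z] would bound the error for [h]. *)
Definition porous_set (k : 'I_p) (e d : R) (a : 'cV[R]_p) : set 'cV[R]_p :=
  [set z | [/\
    forall h, below k h -> `|ratv R h| < d ->
      incr_err z a (ratv R h) <= e / 4 * `|ratv R h|,
    forall s : R, `|s| < d -> incr_err z a (s *: axis k) <= e / 4 * `|s| &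
    forall r : R, 0 < r -> exists h, [/\ below k.+1 h, `|ratv R h| < r &
      e * `|ratv R h| < incr_err z a (ratv R h)]]].

Lemma norm_axis k (s : R) : `|s *: axis k| = `|s|.
Proof.
apply/eqP; rewrite eq_le; apply/andP; split.
  apply/mx_normP => // i j; rewrite !mxE.
  by case: (_ && _); rewrite ?mulr1 ?mulr0 ?normr0.
by have := entry_le_norm (s *: axis k) k 0; rewrite !mxE !eqxx mulr1.
Qed.

Lemma below_split (k : 'I_p) h : below k.+1 h -> exists h',
  [/\ below k h', ratv R h = ratv R h' + ratr (h k 0) *: axis k,
      `|ratv R h'| <= `|ratv R h| & `|ratr (h k 0) : R| <= `|ratv R h|].
Proof.
move=> bh; exists (\col_i (if i == k then 0 else h i 0)); split.
- move=> i ki; rewrite mxE; case: eqP => // /eqP ik; apply: bh.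
  by rewrite ltn_neqAle ki andbT eq_sym.
- apply/colP => i; rewrite !mxE eqxx andbT; case: eqP => [->|_].
    by rewrite rmorph0 add0r mulr1.
  by rewrite mulr0 addr0.
- apply/mx_normP => // i j; rewrite (ord1 j) !mxE; case: eqP => _.
    by rewrite rmorph0 normr0.
  by have := entry_le_norm (ratv R h) i 0; rewrite mxE.
- by have := entry_le_norm (ratv R h) k 0; rewrite mxE.
Qed.

(** [psi] is the distance to [A]. *)
Lemma dist_lipschitz (A : set R) : A !=set0 ->
  exists psi : R -> R, [/\ forall s t, `|psi t - psi s| <= `|t - s|,
    forall s y, A y -> psi s <= `|s - y|, forall s, 0 <= psi s &
    forall s c, (forall y, A y -> c <= `|s - y|) -> c <= psi s].
Proof.
move=> [a0 Aa0].
pose D s := [set `|s - y| | y in A].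
have D0 s : D s !=set0 by exists `|s - a0|; exists a0.
have lbD s : has_lbound (D s) by exists 0 => _ [y _ <-].
exists (fun s => inf (D s)).
have psile s y : A y -> inf (D s) <= `|s - y|.
  by move=> Ay; apply: ge_inf => //; exists y.
have psige s c : (forall y, A y -> c <= `|s - y|) -> c <= inf (D s).
  by move=> H; apply: lb_le_inf => // _ [y Ay <-]; exact: H.
have half s t : inf (D t) - inf (D s) <= `|t - s|.
  rewrite lerBlDr -lerBlDl; apply: psige => y Ay; rewrite lerBlDl.
  rewrite (le_trans (psile t y Ay))// (le_trans _ (ler_normD _ _))//.
  by rewrite addrA subrK.
split => // [s t|s]; last by apply: psige.
by rewrite ler_norml half andbT lerNl opprB distrC half.
Qed.

(** The distance function to the trace vanishes on it, and the holes prevent it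
from being differentiable there; but a Lipschitz function of one variable is
differentiable almost everywhere. *)
Lemma porous_set_negligible k e d a z : 0 < e -> 0 < d ->
  (@lebesgue_measure R).-negligible
    [set s : R | porous_set k e d a (z + s *: axis k)].
Proof.
move=> e0 d0; set A := [set s : R | _].
have [A0|nA] := pselect (A !=set0); last first.
  have -> : A = set0 by apply/eqP; apply/negP => /negP/set0P.
  exact: negligible_set0.
have [psi [psil psile psi0 psige]] := dist_lipschitz A0.
have psil1 s t : `|psi t - psi s| <= 1 * `|t - s| by rewrite mul1r.
apply: negligibleS (lipschitz_ae_derivable psil1) => s As /= dpsi.
have psis0 : psi s = 0.
  by apply/eqP; rewrite eq_le psi0 andbT (le_trans (psile s s As))// subrr normr0.
pose eta := e / (8 * L).
have eta0 : 0 < eta by rewrite divr_gt0// mulr_gt0.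
have etaL : L * eta = e / 8.
  by rewrite /eta; field; rewrite gt_eqF.
have /is_derive_epsP dps : is_derive s (1 : R) psi ('D_1 psi s) by exact: derivableP.
have [r r0 Hr] := dps (eta / 4) (divr_gt0 eta0 (ltr0n _ 4)).
have D0 : `|'D_1 psi s| <= eta / 4.
  have := Hr (r / 2); have := Hr (- (r / 2)).
  have r2 : 0 < r / 2 by rewrite divr_gt0.
  have rr : r / 2 < r by rewrite ltr_pdivrMr// mulr_natr mulr2n ltrDl.
  rewrite normrN gtr0_norm// psis0 !subr0 => /(_ rr) + /(_ rr).
  rewrite !ler_norml => /andP[_ k1] /andP[k2 k3].
  have := psi0 (s + r / 2); have := psi0 (s - r / 2) => k4 k5.
  apply/andP; split; rewrite -(ler_pM2r r2); lra.
have psi_small t : `|t| < r -> psi (s + t) <= eta / 2 * `|t|.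
  move=> tr; have := Hr t tr; rewrite psis0 subr0 => H.
  have : `|'D_1 psi s * t| <= eta / 4 * `|t| by rewrite normrM ler_wpM2r.
  move: H; rewrite !ler_norml => /andP[_ k1] /andP[_ k2]; lra.
have [S1 S2 S3] := As.
have rd0 : 0 < Num.min r d by rewrite lt_min r0.
have [h [bh hrd herr]] := S3 _ rd0.
move: hrd; rewrite lt_min => /andP[hr hd].
have [h' [bh' hE h'h th]] := below_split bh.
set t := ratr (h k 0) in hE th.
have h0 : 0 < `|ratv R h|.
  rewrite normr_gt0; apply/eqP => h0; move: herr.
  rewrite h0 normr0 mulr0 /incr_err addr0 subrr sub0r normrN.
  by rewrite dotp0r normr0 ltxx.
(* The hole around [s + t]; its relative size [eta] is what the Lipschitz constant
   of [G] allows. *)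
have hole y : A y -> eta * `|ratv R h| <= `|s + t - y|.
  move=> [Y1 _ _]; rewrite leNgt; apply/negP => close.
  have := Y1 h' bh' (le_lt_trans h'h hd).
  have := S2 t (le_lt_trans th hd).
  have := G_lip (z + s *: axis k + ratv R h) (z + y *: axis k + ratv R h').
  have := G_lip (z + s *: axis k + t *: axis k) (z + y *: axis k).
  rewrite (_ : _ - (z + y *: _) = (s + t - y) *: axis k); last first.
    by rewrite !scalerDl scaleNr !opprD; apply/colP => i; rewrite !mxE; ring.
  rewrite (_ : _ - (z + y *: _ + _) = (s + t - y) *: axis k); last first.
    by rewrite hE; apply/colP => i; rewrite !mxE; ring.
  rewrite !norm_axis.
  have dE : dotp a (ratv R h) = dotp a (ratv R h') + dotp a (t *: axis k).
    by rewrite {1}hE dotpDr.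
  move: herr; rewrite /incr_err dE.
  set g1 := G (z + s *: axis k + ratv R h); set g2 := G (z + s *: axis k).
  set g3 := G (z + s *: axis k + t *: axis k); set g4 := G (z + y *: axis k).
  set g5 := G (z + y *: axis k + ratv R h').
  set u := dotp a (ratv R h'); set v := dotp a (t *: axis k).
  move=> k1 k2 k3 k4 k5.
  have : `|g1 - g2 - (u + v)| <=
     `|g1 - g5| + `|g5 - g4 - u| + `|g3 - g4| + `|g3 - g2 - v|.
    rewrite (_ : g1 - g2 - (u + v) = (g1 - g5) + (g5 - g4 - u) - (g3 - g4) + (g3 - g2 - v)); last by ring.
    rewrite (le_trans (ler_normD _ _))// lerD2r (le_trans (ler_normB _ _))// lerD2r.
    exact: ler_normD.
  have k6 : L * `|s + t - y| <= L * (eta * `|ratv R h|) by rewrite ler_pM2l// ltW.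
  have k7 : L * (eta * `|ratv R h|) = e / 8 * `|ratv R h| by rewrite mulrA etaL.
  have k8 : e / 4 * `|ratv R h'| <= e / 4 * `|ratv R h| by rewrite ler_wpM2l// divr_ge0// ltW.
  have k9 : e / 4 * `|t| <= e / 4 * `|ratv R h| by rewrite ler_wpM2l// divr_ge0// ltW.
  have k10 : 0 < e * `|ratv R h| by rewrite mulr_gt0.
  lra.
have := psige _ _ hole.
have := psi_small t (le_lt_trans th hr).
have : eta / 2 * `|t| <= eta / 2 * `|ratv R h| by rewrite ler_wpM2l// divr_ge0// ltW.
have : 0 < eta * `|ratv R h| by rewrite mulr_gt0.
lra.
Qed.

End porous.

(** * Failure of differentiability along the axes *)

Lemma natSinv_small (R : realType) (e : R) : 0 < e -> exists n : nat, n.+1%:R^-1 < e.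
Proof.
move=> e0; have := near_infty_natSinv_lt (PosNum e0) => -[n _ Hn].
by exists n; exact: (Hn n (leqnn n)).
Qed.

Lemma natSinv_gt0 (R : realType) (n : nat) : 0 < n.+1%:R^-1 :> R.
Proof. by rewrite invr_gt0. Qed.

Lemma negligible_bigcup_countType (R : realType) (T : countType) (F : T -> set R) :
  (forall t, (@lebesgue_measure R).-negligible (F t)) ->
  (@lebesgue_measure R).-negligible [set s | exists t, F t s].
Proof.
move=> nF.
have H : (@lebesgue_measure R).-negligible
    (\bigcup_n (if unpickle n is Some t then F t else set0)).
  apply: negligible_bigcup => n; case: unpickle => //.
  exact: negligible_set0.
apply: negligibleS H => s [t Fts]; exists (pickle t) => //.
by rewrite pickleK.
Qed.

Section borel_preimage.
Variables (R : realType) (p : nat).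

Definition coord_measurable d (T : measurableType d) (X : T -> 'cV[R]_p) :=
  forall i, measurable_fun setT (fun w => X w i 0).

(** Borel sets of the space of columns, described by their preimages under
arbitrary random vectors: the sets below are built by countable operations from
open sets, and they are only used through such preimages. *)
Definition borel_preimage (N : set 'cV[R]_p) :=
  forall d (T : measurableType d) (X : T -> 'cV[R]_p),
    coord_measurable X -> measurable (X @^-1` N).

Lemma borel_preimageC N : borel_preimage N -> borel_preimage (~` N).
Proof.
move=> bN d T X mX; rewrite preimage_setC; apply: measurableC; exact: bN.
Qed.

Lemma borel_preimage_ex (I : countType) (F : I -> set 'cV[R]_p) :
  (forall i, borel_preimage (F i)) -> borel_preimage [set z | exists i, F i z].
Proof.
move=> bF d T X mX.
rewrite (_ : _ @^-1` _ = \bigcup_i (X @^-1` F i)); last first.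
  by apply/seteqP; split => w /= [i]; [exists i|exists i].
by apply: countable_bigcupT_measurable => // i; exact: bF.
Qed.

Lemma borel_preimage_all (I : countType) (F : I -> set 'cV[R]_p) :
  (forall i, borel_preimage (F i)) -> borel_preimage [set z | forall i, F i z].
Proof.
move=> bF; rewrite (_ : mkset _ = ~` [set z | exists i, (~` F i) z]).
  by apply: borel_preimageC; apply: borel_preimage_ex => i; exact: borel_preimageC.
apply/seteqP; split => [z /= H [i] /(_ (H i))//|z /= H i].
by apply: contrapT => nF; apply: H; exists i.
Qed.

Lemma borel_preimage_imp (P : Prop) N :
  borel_preimage N -> borel_preimage [set z | P -> N z].
Proof.
move=> bN; have [Pt|Pf] := pselect P.
  rewrite (_ : mkset _ = N)//.
  by apply/seteqP; split => z /=; [apply|move=> ? _].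
rewrite (_ : mkset _ = setT); first by move=> d T X mX; rewrite preimage_setT.
by apply/seteqP; split => z //= _ /Pf.
Qed.

Lemma borel_preimageI N M :
  borel_preimage N -> borel_preimage M -> borel_preimage (N `&` M).
Proof.
move=> bN bM d T X mX; rewrite preimage_setI.
by apply: measurableI; [exact: bN|exact: bM].
Qed.

Lemma ratv_dense (z : 'cV[R]_p) (e : R) : 0 < e ->
  exists q : 'cV[rat]_p, `|z - ratv R q| < e.
Proof.
move=> e0; have e2 : 0 < e / 2 by rewrite divr_gt0.
have H i : exists q : rat, `|z i 0 - ratr q| < e / 2.
  have [q] := @rat_in_itvoo R (z i 0 - e / 2) (z i 0 + e / 2) ltac:(lra).
  rewrite in_itv/= => qz; exists q.
  by rewrite ltr_distlC.
exists (\col_i sval (cid (H i))).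
apply: (@le_lt_trans _ _ (e / 2)); last by lra.
apply/mx_normP; first exact: ltW.
move=> i j; rewrite (ord1 j) !mxE; case: cid => q /= ?; exact: ltW.
Qed.

Lemma borel_preimage_open (U : set 'cV[R]_p) : open U -> borel_preimage U.
Proof.
move=> oU.
pose F (qn : 'cV[rat]_p * nat) : set 'cV[R]_p :=
  [set z | ball (ratv R qn.1) qn.2.+1%:R^-1 `<=` U /\
     forall i : 'I_p, `|z i 0 - ratv R qn.1 i 0| <= qn.2.+2%:R^-1].
rewrite (_ : U = [set z | exists qn, F qn z]); last first.
  apply/seteqP; split => [z Uz|z [[q n] [/= qU zq]]].
    have /nbhs_ballP[r r0 rU] : nbhs z U by exact: open_nbhs_nbhs.
    have [n n0] := natSinv_small (divr_gt0 r0 (ltr0n R 2)).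
    have n2 : (0 : R) < n.+2%:R^-1 by rewrite invr_gt0.
    have [q qz] := ratv_dense z n2.
    exists (q, n); split => /=; last first.
      move=> i; have := entry_le_norm (z - ratv R q) i 0.
      by rewrite !mxE => /le_trans; apply; exact: ltW.
    move=> y; rewrite -ball_normE/= => yq; apply: rU.
    rewrite -ball_normE/=.
    have -> : z - y = (z - ratv R q) + (ratv R q - y) by rewrite addrA subrK.
    rewrite (le_lt_trans (ler_normD _ _))// (splitr r) ltrD//.
      rewrite (lt_trans qz)// (lt_trans _ n0)// ltf_pV2 ?posrE//.
      by rewrite ltr_nat.
    exact: lt_trans n0.
  apply: qU; rewrite -ball_normE/= distrC.
  apply: (@le_lt_trans _ _ n.+2%:R^-1); last by rewrite ltf_pV2 ?posrE ?ltr_nat.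
  by apply/mx_normP => // i j; rewrite (ord1 j) !mxE; have := zq i; rewrite mxE.
apply: borel_preimage_ex => -[q n].
have : borel_preimage [set z : 'cV[R]_p | forall i : 'I_p, `|z i 0 - ratv R q i 0| <= n.+2%:R^-1].
  apply: borel_preimage_all => i d T X mX.
  rewrite (_ : _ @^-1` _ = (fun w => X w i 0) @^-1`
    `[ratv R q i 0 - n.+2%:R^-1, ratv R q i 0 + n.+2%:R^-1]%classic); last first.
    by apply/seteqP; split => w; rewrite /= in_itv/= ler_distl.
  by rewrite -[X in measurable X]setTI; apply: mX => //; exact: measurable_itv.
move=> H; have [Pt|Pf] := pselect (ball (ratv R q) n.+1%:R^-1 `<=` U).
  rewrite (_ : F (q, n) = [set z : 'cV[R]_p | forall i : 'I_p, `|z i 0 - ratv R q i 0| <= n.+2%:R^-1])//.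
  by apply/seteqP; split => z //= [].
rewrite (_ : F (q, n) = set0); first by move=> d T X mX; rewrite preimage_set0.
by apply/seteqP; split => z // [] /Pf.
Qed.

Lemma borel_preimage_closed (U : set 'cV[R]_p) : closed U -> borel_preimage U.
Proof.
by move=> cU; rewrite -(setCK U); apply/borel_preimageC/borel_preimage_open/closed_openC.
Qed.

Lemma borel_preimage_shift (N : set 'cV[R]_p) a :
  borel_preimage N -> borel_preimage [set z | N (z + a)].
Proof.
move=> bN d T X mX; apply: (bN d T (fun w => X w + a)) => i.
rewrite (_ : (fun w => _) = (fun w => X w i 0 + a i 0)); last first.
  by apply/funext => w; rewrite mxE.
exact: measurable_funD.
Qed.

Definition axis_null (i : 'I_p) (N : set 'cV[R]_p) :=
  forall z, (@lebesgue_measure R).-negligible [set s | N (z + s *: axis R i)].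

End borel_preimage.

Section partial_frechet.
Variables (R : realType) (p : nat) (G : 'cV[R]_p -> R) (L : R).
Hypothesis L0 : 0 < L.
Hypothesis G_lip : forall x y, `|G x - G y| <= L * `|x - y|.

(** Differentiability along the span of the first [k] axes, written with
countably many quantifiers so that it defines a Borel set. *)
Definition partial_diff (k : nat) (z : 'cV[R]_p) : Prop :=
  forall n : nat, exists a : 'cV[rat]_p, exists j : nat, forall h : 'cV[rat]_p,
    below k h -> `|ratv R h| < j.+1%:R^-1 ->
    incr_err G z (ratv R a) (ratv R h) <= n.+1%:R^-1 * `|ratv R h|.

Lemma partial_diff0 z : partial_diff 0 z.
Proof.
move=> n; exists 0, 0 => h h0 _.
have -> : ratv R h = 0.
  by apply/colP => i; rewrite !mxE h0// rmorph0.
by rewrite /incr_err addr0 subrr dotp0r subrr !normr0 mulr0.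
Qed.

Lemma closed_incr_err a h c : closed [set z | incr_err G z a h <= c].
Proof.
rewrite (_ : mkset _ = (incr_err G ^~ a ^~ h) @^-1` [set x | x <= c])//.
suff cont : continuous (fun z => incr_err G z a h).
  by apply: closed_comp => [z _|]; [exact: cont|exact: closed_le].
apply: (@lipschitz_continuous _ _ _ _ (2 * L)) => z y.
apply: le_trans (ler_dist_dist _ _) _.
rewrite (_ : _ - _ - _ - _ = (G (z + h) - G (y + h)) - (G z - G y)); last by ring.
apply: le_trans (ler_normB _ _) _.
have := G_lip (z + h) (y + h); have := G_lip z y.
rewrite (_ : z + h - (y + h) = z - y); last by rewrite opprD addrACA subrr addr0.
lra.
Qed.

Lemma borel_partial_diff k : borel_preimage (partial_diff k).
Proof.
apply: borel_preimage_all => n; apply: borel_preimage_ex => a.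
apply: borel_preimage_ex => j; apply: borel_preimage_all => h.
do 2 apply: borel_preimage_imp; apply: borel_preimage_closed.
exact: closed_incr_err.
Qed.

Definition bad_axis (k : 'I_p) : set 'cV[R]_p :=
  [set z | partial_diff k z /\ ~ partial_diff k.+1 z].

Lemma borel_bad_axis k : borel_preimage (bad_axis k).
Proof.
apply: borel_preimageI; first exact: borel_partial_diff.
by apply: borel_preimageC; exact: borel_partial_diff.
Qed.

Lemma not_partial_diff z : ~ partial_diff p z -> exists k, bad_axis k z.
Proof.
move=> npd; apply: contrapT => H; apply: npd.
suff : forall k, (k <= p)%N -> partial_diff k z by apply.
elim => [_|k IH kp]; first exact: partial_diff0.
apply: contrapT => npd; apply: H; exists (Ordinal kp); split => //.
exact/IH/ltnW.
Qed.

(** Where the partial derivative along axis [k] exists, round it and the approximate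
derivative along the first [k] axes to rational numbers: every point of [bad_axis k]
is then in one of countably many porous sets. *)
Lemma bad_axis_null k : axis_null k (bad_axis k).
Proof.
move=> z.
pose phi s := G (z + s *: axis R k).
have phil s t : `|phi t - phi s| <= L * `|t - s|.
  rewrite (le_trans (G_lip _ _))// (_ : _ - _ = (t - s) *: axis R k) ?norm_axis//.
  by apply/colP => i; rewrite !mxE; ring.
have nphi := lipschitz_ae_derivable phil.
have nE : (@lebesgue_measure R).-negligible [set s | exists naj : nat * 'cV[rat]_p * nat,
    porous_set G k (naj.1.1.+1%:R^-1) (naj.2.+1%:R^-1) (ratv R naj.1.2) (z + s *: axis R k)].
  apply: negligible_bigcup_countType => -[[n a] j].
  by apply: (porous_set_negligible L0) => //; rewrite invr_gt0.
apply: negligibleS (negligibleU nphi nE) => s [] pds npds.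
have [dphi|] := pselect (derivable phi s 1); last by left.
right; move/existsNP : npds => [n Hn].
have n0 : (0 : R) < n.+1%:R^-1 by rewrite invr_gt0.
have [a [j Haj]] := pds (4 * n.+1)%N.
set x := z + s *: axis R k in Haj Hn *.
have /is_derive_epsP : is_derive s (1 : R) phi ('D_1 phi s) by exact: derivableP.
move=> /(_ (n.+1%:R^-1 / 8)) [|r r0 Hr]; first by rewrite divr_gt0.
have [b Db] : exists b : rat, `|'D_1 phi s - ratr b| < n.+1%:R^-1 / 8.
  have c0 : 0 < n.+1%:R^-1 / 8 :> R by rewrite divr_gt0.
  have cc : 'D_1 phi s - n.+1%:R^-1 / 8 < 'D_1 phi s + n.+1%:R^-1 / 8.
    by rewrite ltrD2l (lt_trans _ c0)// oppr_lt0.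
  have [b] := rat_in_itvoo cc.
  by rewrite in_itv/= => bD; exists b; rewrite ltr_distlC.
pose a' : 'cV[rat]_p := \col_i (if i == k then b else a i 0).
have [l lr] := natSinv_small r0.
have jl1 : ((maxn j l).+1%:R^-1 : R) <= j.+1%:R^-1.
  by rewrite lef_pV2 ?posrE// ler_nat ltnS leq_maxl.
have jl2 : ((maxn j l).+1%:R^-1 : R) <= l.+1%:R^-1.
  by rewrite lef_pV2 ?posrE// ler_nat ltnS leq_maxr.
exists (n, a', maxn j l); split => /=.
- move=> h bh hd.
  have := Haj h bh (lt_le_trans hd jl1).
  rewrite /incr_err (_ : dotp (ratv R a) _ = dotp (ratv R a') (ratv R h)); last first.
    apply: eq_bigr => i _; rewrite !mxE; case: eqP => // ->.
    by rewrite (bh k)// rmorph0 !mulr0.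
  move=> /le_trans; apply; apply: ler_wpM2r => //.
  rewrite -invfM lef_pV2 ?posrE ?mulr_gt0// -natrM ler_nat mulnC.
  by rewrite leqW.
- move=> t td.
  have := Hr t (lt_trans (lt_le_trans td jl2) lr).
  rewrite /incr_err /phi scalerDl addrA -/x dotpZr dotp_delta !mxE eqxx.
  move=> H.
  rewrite (_ : _ - _ - _ = (G (x + t *: axis R k) - G x - 'D_1 phi s * t) + ('D_1 phi s - ratr b) * t); last by ring.
  rewrite (le_trans (ler_normD _ _))// (le_trans (lerD H (_ : _ <= n.+1%:R^-1 / 8 * `|t|)))//.
    by rewrite normrM ler_wpM2r// ltW.
  by rewrite -mulrDl ler_wpM2r//; move: (n.+1%:R^-1 : R) => ?; lra.
- move=> d d0; apply: contrapT => nH; apply: Hn.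
  have [q qd] := natSinv_small d0.
  exists a', q => h bh hq; rewrite leNgt; apply/negP => lt; apply: nH.
  by exists h; split => //; exact: lt_trans qd.
Qed.

End partial_frechet.

(** * Lines that meet null sets in null sets *)

Section product_measure.
Context d1 d2 (T1 : measurableType d1) (T2 : measurableType d2) (R : realType).
Variable m1 : {sigma_finite_measure set T1 -> \bar R}.
Variable m2 : {sigma_finite_measure set T2 -> \bar R}.

Lemma sigma_finite_product : sigma_finite setT (m1 \x m2)%E.
Proof.
have /sigma_finiteP[F [TF ndF Foo]] := sigma_finiteT m1.
have /sigma_finiteP[G [TG ndG Goo]] := sigma_finiteT m2.
exists (fun n => F n `*` G n).
  apply/seteqP; split => // -[x y] _.
  have [n _ Fnx] : (\bigcup_n F n) x by rewrite -TF.
  have [k _ Gky] : (\bigcup_n G n) y by rewrite -TG.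
  exists (maxn n k) => //; split => /=.
    by move: x Fnx; exact/subsetPset/ndF/leq_maxl.
  by move: y Gky; exact/subsetPset/ndG/leq_maxr.
move=> n; have [mF Fn] := Foo n; have [mG Gn] := Goo n.
split; first exact: measurableX.
by rewrite product_measure1E// lte_mul_pinfty// ge0_fin_numE.
Qed.

Definition sigma_finite_prod : {sigma_finite_measure set (T1 * T2)%type -> \bar R} :=
  HB.pack (m1 \x m2)%E (Measure_isSigmaFinite.Build _ _ _ (m1 \x m2)%E sigma_finite_product).

End product_measure.

Section fubini_null.
Context d1 d2 (T1 : measurableType d1) (T2 : measurableType d2) (R : realType).
Variable m1 : {sigma_finite_measure set T1 -> \bar R}.
Variable m2 : {sigma_finite_measure set T2 -> \bar R}.
Variable A : set (T1 * T2).
Hypothesis mA : measurable A.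
Local Open Scope ereal_scope.

Lemma product_measure1_eq0 :
  (forall x, m2 (xsection A x) = 0) -> (m1 \x m2) A = 0.
Proof. by move=> A0; rewrite /product_measure1; apply: integral0_eq => x _; exact: A0. Qed.

Lemma integral_sections : \int[m1]_x m2 (xsection A x) = \int[m2]_y m1 (ysection A y).
Proof.
have := indic_fubini_tonelli m1 m2 mA.
by rewrite indic_fubini_tonelli_FE// indic_fubini_tonelli_GE.
Qed.

Lemma product_measure1_eq0_ysection :
  (forall y, m1 (ysection A y) = 0) -> (m1 \x m2) A = 0.
Proof.
move=> A0; rewrite /product_measure1 [LHS]integral_sections.
by apply: integral0_eq => y _; exact: A0.
Qed.

(** The integrals of the measures of both families of sections agree, and a
nonnegative function with zero integral is zero almost everywhere. *)
Lemma ae_xsection_null :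
  (forall y, m1 (ysection A y) = 0) -> {ae m1, forall x, m2 (xsection A x) = 0}.
Proof.
move=> A0.
have : \int[m1]_x `|m2 (xsection A x)| = 0.
  under eq_integral do rewrite gee0_abs//.
  by rewrite integral_sections; apply: integral0_eq => y _; exact: A0.
move=> H.
have mf : measurable_fun setT (fun x => m2 (xsection A x)) by exact: measurable_fun_xsection.
have [+ _] := ae_eq_integral_abs m1 measurableT mf.
by move=> /(_ H) hae; apply: (aeS hae) => x; apply.
Qed.

End fubini_null.

Section random_point.
Variables (R : realType) (p : nat).

Definition corner_box (e : R) : set 'cV[R]_p :=
  [set z | forall i : 'I_p, 0 <= z i 0 <= e].

(** A random vector with independent coordinates along the first [k] axes,
standing for Lebesgue measure on their span: being null on all the lines
parallel to one of these axes makes a Borel set null. The coordinates are added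
one at a time, and Fubini's theorem applies to the last one. *)
Lemma random_point (k : nat) : (k <= p)%N ->
  exists d (T : measurableType d) (P : {sigma_finite_measure set T -> \bar R})
     (X : T -> 'cV[R]_p),
  [/\ coord_measurable X,
      forall w (i : 'I_p), (k <= i)%N -> X w i 0 = 0,
      forall e : R, 0 < e -> (0 < P (X @^-1` corner_box e))%E &
      forall N (i : 'I_p), (i < k)%N -> borel_preimage N -> axis_null i N ->
        P (X @^-1` N) = 0%E].
Proof.
elim: k => [_|k IH kp].
  exists _, unit, (dirac tt), (fun=> 0); split.
  - move=> i; rewrite (_ : (fun _ => _) = cst 0); first exact: measurable_cst.
    by apply/funext => w; rewrite mxE.
  - by move=> w i _; rewrite mxE.
  - move=> e e0.
    suff : (0 < @dirac _ unit tt R ((fun=> 0%R) @^-1` corner_box e))%E by [].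
    rewrite diracE mem_set ?lte_fin//=.
    by move=> i; rewrite mxE lexx ltW.
  - by [].
have [d [T [P [X [mX X0 Xbox Xnull]]]]] := IH (ltnW kp).
pose i0 := Ordinal kp.
pose Y (w : T * measurableTypeR R) : 'cV[R]_p := X w.1 + w.2 *: axis R i0.
have mY : coord_measurable Y.
  move=> i; rewrite (_ : (fun w => _) = fun w : T * measurableTypeR R =>
      X w.1 i 0 + w.2 * axis R i0 i 0); last first.
    by apply/funext => w; rewrite !mxE.
  apply: measurable_funD; first exact: (measurableT_comp (mX i) measurable_fst).
  by apply: measurable_funM => //; exact: measurable_snd.
exists _, (T * measurableTypeR R)%type, (sigma_finite_prod P (@lebesgue_measure R)), Y.
have PE A : sigma_finite_prod P (@lebesgue_measure R) A = (P \x @lebesgue_measure R)%E A by [].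
split => //.
- move=> w i ki; rewrite /Y !mxE X0 ?(ltnW ki)// add0r.
  rewrite (_ : (i == i0) = false) ?mulr0//.
  by apply/eqP => ii0; move: ki; rewrite ii0 /= ltnn.
- move=> e e0.
  have mB : measurable (X @^-1` corner_box e).
    apply: (@borel_preimage_all R p 'I_p (fun i => [set z | 0 <= z i 0 <= e])) => // i.
    move=> d' T' X' mX'.
    rewrite -[X in measurable X]setTI.
    exact: (mX' i measurableT `[0, e]%classic (measurable_itv _)).
  rewrite (_ : _ @^-1` _ = (X @^-1` corner_box e) `*` `[0, e]%classic); last first.
    apply/seteqP; split => -[w t] /=.
      move=> H; split => [i|].
        have := H i; rewrite /Y/= !mxE; case: eqP => [->|]; last by rewrite mulr0 addr0.
        by move=> _; rewrite X0//= lexx ltW.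
      by have := H i0; rewrite /Y/= !mxE !eqxx X0// add0r mulr1 in_itv.
    move=> [H te] i; rewrite /Y/= !mxE; case: eqP => [->|_]; last first.
      by rewrite mulr0 addr0; exact: H.
    by rewrite X0// add0r mulr1; move: te; rewrite in_itv.
  rewrite PE product_measure1E//; apply: mule_gt0; first exact: Xbox.
  suff : (0 < @lebesgue_measure R `[0%R, e]%classic)%E by [].
  by rewrite lebesgue_measure_itv/= lte_fin e0 EFinN sube0 lte_fin.
- move=> N i; rewrite ltnS leq_eqVlt => /predU1P[ik|ik] bN nN.
    have mN := bN _ _ _ mY.
    apply: product_measure1_eq0 => // w.
    have : measurable (xsection (Y @^-1` N) w) by exact: measurable_xsection.
    move=> /(@negligibleP _ _ _ (@lebesgue_measure R)) [+ _]; apply.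
    apply: negligibleS (nN (X w)) => t; rewrite /xsection/= inE.
    by rewrite (_ : i = i0)//; apply: val_inj.
  have mN := bN _ _ _ mY.
  apply: product_measure1_eq0_ysection => // t.
  have := Xnull [set z | N (z + t *: axis R i0)] i ik _ _.
  rewrite (_ : ysection _ _ = X @^-1` [set z | N (z + t *: axis R i0)]); last first.
    by apply/seteqP; split => w; rewrite /ysection/= inE.
  apply; first exact: borel_preimage_shift.
  move=> z; apply: negligibleS (nN (z + t *: axis R i0)) => s /=.
  by rewrite addrAC.
Qed.

(** Take a random line: its base point is given by [random_point], and its
direction is axis [k]. At each parameter the point of the line avoids each [N i]
almost surely, whatever the axis [j] along which [N i] is null. By Fubini's theorem
almost every line then meets [N i] in a null set, and base points in the box have
positive probability. *)
Lemma exists_good_line (I : countType) (N : I -> set 'cV[R]_p) (z0 : 'cV[R]_p)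
    (k : 'I_p) (e : R) : 0 < e ->
  (forall i, borel_preimage (N i)) -> (forall i, exists j, axis_null j (N i)) ->
  exists2 x : 'cV[R]_p, `|x| <= e &
    (@lebesgue_measure R).-negligible
      [set s | exists i, N i (z0 + x + s *: axis R k)].
Proof.
move=> e0 bN nN.
have [d [T [P [X [mX _ Xbox Xnull]]]]] := random_point (leqnn p).
pose Y (w : T * measurableTypeR R) : 'cV[R]_p := z0 + X w.1 + w.2 *: axis R k.
have mY : coord_measurable Y.
  move=> i; rewrite (_ : (fun w => _) = fun w : T * measurableTypeR R =>
      z0 i 0 + X w.1 i 0 + w.2 * axis R k i 0); last first.
    by apply/funext => w; rewrite !mxE.
  apply: measurable_funD.
    apply: measurable_funD => //.
    exact: (measurableT_comp (mX i) measurable_fst).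
  by apply: measurable_funM => //; exact: measurable_snd.
have mN i : measurable (Y @^-1` N i) by exact: bN.
have H i : {ae P, forall w, @lebesgue_measure R (xsection (Y @^-1` N i) w) = 0%E}.
  apply: ae_xsection_null => // t.
  have [j nj] := nN i.
  have := Xnull [set z | N i (z + (z0 + t *: axis R k))] j (ltn_ord j) _ _.
  rewrite (_ : ysection _ _ = X @^-1` [set z | N i (z + (z0 + t *: axis R k))]); last first.
    apply/seteqP; split => w; rewrite /ysection/= inE /Y/=.
      by rewrite (addrC z0) -addrA.
    by rewrite addrA (addrC _ z0).
  apply; first exact: borel_preimage_shift.
  move=> z; apply: negligibleS (nj (z + (z0 + t *: axis R k))) => s /=.
  by rewrite addrAC.
pose bad := \bigcup_n (if unpickle n is Some i then
  [set w | @lebesgue_measure R (xsection (Y @^-1` N i) w) <> 0%E] else set0).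
have nbad : P.-negligible bad.
  apply: negligible_bigcup => n; case: unpickle => [i|]; last exact: negligible_set0.
  exact: H.
have [w wbox wgood] : exists2 w, (X @^-1` corner_box e) w & ~ bad w.
  apply: contrapT => nw; have := Xbox e e0.
  suff -> : P (X @^-1` corner_box e) = 0%E by rewrite ltxx.
  case: nbad => B [mB B0 badB].
  apply/eqP; rewrite -measure_le0 -B0; apply: le_measure; rewrite ?inE//.
    apply: (@borel_preimage_all R p 'I_p (fun i => [set z | 0 <= z i 0 <= e])) => // i.
    move=> d' T' X' mX'.
    rewrite -[X in measurable X]setTI.
    exact: (mX' i measurableT `[0, e]%classic (measurable_itv _)).
  by move=> w wb; apply: badB; apply: contrapT => nb; apply: nw; exists w.
exists (X w).
  apply/mx_normP => [|i j]; first exact: ltW.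
  by have /andP[? ?] := wbox i; rewrite (ord1 j) ger0_norm.
apply: negligible_bigcup_countType => i.
have : measurable (xsection (Y @^-1` N i) w) by exact: measurable_xsection.
move=> /(@negligibleP _ _ _ (@lebesgue_measure R)) [_ +].
move=> HH; apply: (negligibleS _ (HH _)).
  by move=> s /=; rewrite /xsection/= inE.
apply: contrapT => nz; apply: wgood; exists (pickle i) => //.
by rewrite pickleK.
Qed.

End random_point.

(** * Differentiability from rational increments *)

Lemma mulmx_norm_le (R : realType) (m p q : nat) (A : 'M[R]_(m, p)) (B : 'M[R]_(p, q)) :
  `|A *m B| <= p%:R * `|A| * `|B|.
Proof.
apply/mx_normP => [|i j]; first by rewrite !mulr_ge0.
rewrite mxE; apply: le_trans (ler_norm_sum _ _ _) _.
apply: (@le_trans _ _ (\sum_(k < p) (`|A| * `|B|))).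
  by apply: ler_sum => k _; rewrite normrM ler_pM// entry_le_norm.
by rewrite sumr_const card_ord -mulrA mulr_natl.
Qed.

Lemma approx_limit (R : realType) (u d : nat -> R) :
  (forall m n, `|u m - u n| <= d m + d n) -> exists l, forall n, `|u n - l| <= d n.
Proof.
move=> H; pose E := [set u n - d n | n in setT].
have ubE m : ubound E (u m + d m).
  by move=> _ [n _ <-]; have := H m n; rewrite ler_norml; lra.
have supE : has_sup E by split; [exists (u 0%N - d 0%N); exists 0%N|exists (u 0%N + d 0%N)].
exists (sup E) => n; rewrite ler_norml.
have : u n - d n <= sup E by apply: ub_le_sup; [exact: supE.2|exists n].
have : sup E <= u n + d n by apply: ge_sup; [exact: supE.1|exact: ubE].
by move=> ? ?; apply/andP; split; lra.
Qed.

Definition frechet (R : realType) (m p : nat) (g : 'cV[R]_p -> 'cV[R]_m)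
    (z : 'cV[R]_p) (A : 'M[R]_(m, p)) :=
  forall e, 0 < e -> exists2 r, 0 < r &
    forall h, `|h| < r -> `|g (z + h) - g z - A *m h| <= e * `|h|.

Lemma frechet_differentiable (R : realType) (m p : nat)
    (g : 'cV[R]_p -> 'cV[R]_m) z A :
  frechet g z A -> differentiable g z /\ dmx g z = A.
Proof.
move=> gA.
have cA : continuous (mulmx A : 'cV[R]_p -> 'cV[R]_m).
  apply: (@lipschitz_continuous _ _ _ _ (p%:R * `|A|)) => x y.
  by rewrite -mulmxBr; exact: mulmx_norm_le.
have gE : g \o shift z = cst (g z) + mulmx A +o_ (0 : 'cV[R]_p) id.
  apply/eqaddoP => e e0; have [r r0 Hr] := gA e e0.
  apply/nbhs_ballP; exists r => //= h; rewrite -ball_normE/= sub0r normrN => hr.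
  have := Hr h hr; rewrite (addrC z).
  by rewrite (_ : (g \o _ - _) h = g (h + z) - g z - A *m h)// !fctE /= opprD addrA.
have dE := diff_unique cA gE.
split.
  by apply/diff_locallyP; rewrite dE; split.
apply/matrixP => i j; rewrite mxE dE.
transitivity ((A *m delta_mx j (0 : 'I_1)) i 0); first by [].
by rewrite -colE mxE.
Qed.

Section scalar_frechet.
Variables (R : realType) (p : nat) (G : 'cV[R]_p -> R) (L : R).
Hypothesis L0 : 0 < L.
Hypothesis G_lip : forall x y, `|G x - G y| <= L * `|x - y|.

Lemma incr_err_real z a e d : 0 <= e ->
  (forall h, `|ratv R h| < d -> incr_err G z a (ratv R h) <= e * `|ratv R h|) ->
  forall h, `|h| < d -> incr_err G z a h <= e * `|h|.
Proof.
move=> e0 H h hd; apply/ler_addgt0Pr => c c0.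
pose K := L + p%:R * `|a| + e.
have K0 : 0 < K by rewrite /K -addrA ltr_wpDr// addr_ge0// mulr_ge0.
have m0 : 0 < Num.min (c / K) (d - `|h|) by rewrite lt_min divr_gt0//= subr_gt0.
have [q] := ratv_dense h m0; rewrite lt_min => /andP[q1 q2].
have qh : `|ratv R q| <= `|h| + `|h - ratv R q|.
  have := ler_normB h (h - ratv R q).
  by rewrite (_ : h - (h - ratv R q) = ratv R q)// opprB addrC subrK.
have := H q (le_lt_trans qh _); rewrite -ltrBrDl => /(_ q2).
rewrite /incr_err => k1.
have k2 := G_lip (z + h) (z + ratv R q).
rewrite (_ : z + h - _ = h - ratv R q) in k2; last first.
  by rewrite opprD addrACA subrr add0r.
have k3 := dotp_norm_le a (h - ratv R q); rewrite dotpBr in k3.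
have k4 : K * `|h - ratv R q| < c.
  by rewrite mulrC -ltr_pdivlMr.
have k5 : e * `|ratv R q| <= e * (`|h| + `|h - ratv R q|) by rewrite ler_wpM2l.
rewrite (_ : _ - _ - _ = (G (z + ratv R q) - G z - dotp a (ratv R q)) +
   (G (z + h) - G (z + ratv R q)) - (dotp a h - dotp a (ratv R q))); last by ring.
apply: le_trans (ler_normB _ _) _; apply: le_trans (lerD (ler_normD _ _) (lexx _)) _.
move: k4; rewrite /K; lra.
Qed.

(** The approximate derivatives at precision [n.+1%:R^-1] form a Cauchy sequence, as
increments along the axes show; their limit is the derivative. *)
Lemma partial_diff_frechet z : partial_diff G p z ->
  exists a : 'cV[R]_p, forall e, 0 < e -> exists2 r, 0 < r &
    forall h, `|h| < r -> incr_err G z a h <= e * `|h|.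
Proof.
move=> pdz.
have H n : exists aj : 'cV[R]_p * R, 0 < aj.2 /\
    forall h, `|h| < aj.2 -> incr_err G z aj.1 h <= n.+1%:R^-1 * `|h|.
  have [a [j Haj]] := pdz n; exists (ratv R a, j.+1%:R^-1) => /=.
  split; first exact: natSinv_gt0.
  apply: incr_err_real => // h; apply: Haj => i.
  by rewrite leqNgt ltn_ord.
have [aj Haj] := choice H.
pose b n := (aj n).1.
have close i : exists l, forall n, `|b n i 0 - l| <= n.+1%:R^-1.
  apply: approx_limit => m n.
  have [dm0 Hm] := Haj m; have [dn0 Hn] := Haj n.
  pose s := Num.min (aj m).2 (aj n).2 / 2.
  have min0 : 0 < Num.min (aj m).2 (aj n).2 by rewrite lt_min dm0.
  have s0 : 0 < s by rewrite divr_gt0.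
  have : s < Num.min (aj m).2 (aj n).2 by rewrite ltr_pdivrMr// mulr_natr mulr2n ltrDl.
  rewrite lt_min => /andP[sm sn].
  have := Hm (s *: axis R i); rewrite norm_axis gtr0_norm// => /(_ sm).
  have := Hn (s *: axis R i); rewrite norm_axis gtr0_norm// => /(_ sn).
  rewrite /incr_err !dotpZr !dotp_delta -/(b m) -/(b n).
  rewrite !ler_norml => /andP[h1 h2] /andP[h3 h4].
  move: h1 h2 h3 h4.
  move: (m.+1%:R^-1 : R) (n.+1%:R^-1 : R) => cm cn h1 h2 h3 h4.
  by apply/andP; split; rewrite -(ler_pM2l s0); lra.
have [a Ha] := choice close.
exists (\col_i a i) => e e0.
have ep : 0 < e / (1 + p%:R) by rewrite divr_gt0// ltr_wpDr.
have [n nep] := natSinv_small ep.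
have [d0 Hd] := Haj n; exists (aj n).2 => // h hd.
have := Hd h hd; rewrite /incr_err -/(b n) => k1.
have k2 : `|b n - \col_i a i| <= n.+1%:R^-1.
  apply/mx_normP => [|i j]; first exact/ltW/natSinv_gt0.
  by rewrite (ord1 j) !mxE.
have := dotp_norm_le (b n - \col_i a i) h; rewrite dotpBl => k3.
have k4 : p%:R * `|b n - \col_i a i| * `|h| <= p%:R * n.+1%:R^-1 * `|h|.
  by rewrite ler_wpM2r// ler_wpM2l.
have k5 : n.+1%:R^-1 * (1 + p%:R) * `|h| <= e * `|h|.
  by rewrite ler_wpM2r// -ler_pdivlMr ?ltW// ltr_wpDr.
rewrite (_ : _ - _ - _ = (G (z + h) - G z - dotp (b n) h) + (dotp (b n) h - dotp (\col_i a i) h)); last by ring.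
apply: le_trans (ler_normD _ _) _.
move: k1 k4 k5; move: (n.+1%:R^-1 : R) => c; lra.
Qed.

End scalar_frechet.

Lemma exists_common_radius (R : realType) (m : nat) (P : 'I_m -> R -> Prop) :
  (forall i r r', P i r -> 0 < r' -> r' <= r -> P i r') ->
  (forall i, exists2 r, 0 < r & P i r) ->
  exists2 r, 0 < r & forall i, P i r.
Proof.
move=> mono H.
have H' i : exists r, 0 < r /\ P i r by have [r r0 Pr] := H i; exists r.
have [r Hr] := choice H'.
have b0 : 0 < \big[Num.min/1]_i r i.
  by apply: lt_bigmin => // i _; have [] := Hr i.
exists (\big[Num.min/1]_i r i) => // i.
by apply: (mono i (r i)) => //; [have [] := Hr i | exact: bigmin_le_cond].
Qed.

Lemma frechet_coord (R : realType) (m p : nat) (g : 'cV[R]_p -> 'cV[R]_m) z :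
  (forall i, exists a : 'cV[R]_p, forall e, 0 < e -> exists2 r, 0 < r &
    forall h, `|h| < r -> incr_err (fun x => g x i 0) z a h <= e * `|h|) ->
  exists A, frechet g z A.
Proof.
move=> H; have [a Ha] := choice H.
exists (\matrix_(i, j) a i j 0) => e e0.
have [|i|r r0 Hr] := @exists_common_radius R m (fun i r => forall h, `|h| < r ->
    incr_err (fun x => g x i 0) z (a i) h <= e * `|h|).
- by move=> i r r' Hr r'0 r'r h hr'; apply: Hr; exact: lt_le_trans r'r.
- exact: Ha.
exists r => // h hr; apply/mx_normP => [|i j]; first by rewrite mulr_ge0// ltW.
have := Hr i h hr; rewrite /incr_err (ord1 j) !mxE.
by rewrite (_ : dotp _ _ = \sum_k (\matrix_(i0, j0) a i0 j0 0) i k * h k 0)//; apply: eq_bigr => k _; rewrite mxE.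
Qed.

(** * The mean value inequality in several variables *)

Section mean_value_axis.
Variables (R : realType) (p m : nat) (g : 'cV[R]_p -> 'cV[R]_m) (L : R).
Hypothesis L0 : 0 < L.
Hypothesis g_lip : forall x y, `|g x - g y| <= L * `|x - y|.

Lemma dotp_lip (e : 'cV[R]_m) x y :
  `|dotp e (g x) - dotp e (g y)| <= m%:R * `|e| * L * `|x - y|.
Proof.
rewrite -dotpBr (le_trans (dotp_norm_le _ _))// -[leRHS]mulrA ler_wpM2l// mulr_ge0.
Qed.

(** The segment is replaced by a parallel one, at distance [eta'], almost all of
whose points are points of differentiability; there [ac_increment_le] applies to
the composition of [dotp e] with [g]. The shift costs at most [2 * K * eta'], and
[eta'] is arbitrary. *)
Lemma mean_value_axis (k : 'I_p) (e : 'cV[R]_m) (al l eta : R) z0 :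
  0 <= l -> 0 < eta ->
  (forall s x A, 0 < s -> s < l -> `|x| <= eta ->
     frechet g (z0 + x + s *: axis R k) A -> dotp e (A *m axis R k) <= al) ->
  dotp e (g (z0 + l *: axis R k) - g z0) <= al * l.
Proof.
move=> l0 eta0 H.
have gi_lip i x y : `|g x i 0 - g y i 0| <= L * `|x - y|.
  rewrite (le_trans _ (g_lip x y))//.
  by have := entry_le_norm (g x - g y) i 0; rewrite !mxE.
pose K := m%:R * `|e| * L.
have K0 : 0 <= K by rewrite !mulr_ge0// ltW.
suff main eta' : 0 < eta' -> eta' <= eta ->
    dotp e (g (z0 + l *: axis R k) - g z0) <= al * l + 2 * K * eta'.
  apply/ler_addgt0Pr => d d0.
  have K1 : 0 < 1 + 2 * K by rewrite ltr_wpDr// mulr_ge0.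
  have m0 : 0 < Num.min eta (d / (1 + 2 * K)) by rewrite lt_min eta0 divr_gt0.
  have := main _ m0; rewrite ge_min lexx => /(_ isT) /le_trans; apply.
  rewrite lerD2l.
  apply: (@le_trans _ _ ((1 + 2 * K) * Num.min eta (d / (1 + 2 * K)))).
    by rewrite ler_wpM2r ?(ltW m0)// lerDr.
  by rewrite mulrC -ler_pdivlMr// ge_min lexx orbT.
move=> eta'0 eta'le.
pose N (ij : 'I_m * 'I_p) := bad_axis (fun x => g x ij.1 0) ij.2.
have bN ij : borel_preimage (N ij) := borel_bad_axis (gi_lip ij.1) ij.2.
have nN ij : exists j, axis_null j (N ij).
  by exists ij.2; exact: (bad_axis_null L0 (gi_lip ij.1)).
have [x xeta nx] := exists_good_line z0 k eta'0 bN nN.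
pose phi s := dotp e (g (z0 + x + s *: axis R k)).
have phi_lip : lip_on 0 l K phi.
  move=> s t _ st _; rewrite /phi (le_trans (dotp_lip _ _ _))//.
  rewrite (_ : _ - _ = (t - s) *: axis R k) ?norm_axis ?ger0_norm ?subr_ge0//.
  by apply/colP => i; rewrite !mxE; ring.
have incr : phi l - phi 0 <= al * (l - 0).
  apply: (@ac_increment_le _ _ _ _ _ (fun s => 'D_1 phi s)) => //.
    exact: lip_on_ac phi_lip.
  apply: negligibleS nx => s /= /not_implyP[s0] /not_implyP[sl nd].
  apply: contrapT => nbad; apply: nd.
  have [A gA] : exists A, frechet g (z0 + x + s *: axis R k) A.
    apply: frechet_coord => i.
    apply: (partial_diff_frechet L0 (gi_lip i)).
    apply: contrapT => npd; apply: nbad.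
    by have [j Hj] := not_partial_diff npd; exists (i, j).
  have dphi : is_derive s (1 : R) phi (dotp e (A *m axis R k)).
    apply/is_derive_epsP => d d0.
    have me0 : 0 < 1 + m%:R * `|e| by rewrite ltr_wpDr// mulr_ge0.
    have [r r0 Hr] := gA _ (divr_gt0 d0 me0).
    exists r => // h hr.
    have := Hr (h *: axis R k); rewrite norm_axis => /(_ hr).
    rewrite -[_ + s *: _ + h *: _]addrA -scalerDl => H1.
    rewrite /phi -dotpBr mulrC -dotpZr scalemxAr -dotpBr.
    apply: le_trans (dotp_norm_le _ _) _.
    apply: (@le_trans _ _ (m%:R * `|e| * (d / (1 + m%:R * `|e|) * `|h|))).
      by rewrite ler_wpM2l// mulr_ge0.
    rewrite mulrA ler_wpM2r// mulrCA -[leRHS]mulr1 ler_wpM2l ?(ltW d0)//.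
    by rewrite ler_pdivrMr// mul1r lerDr.
  have -> : 'D_1 phi s = dotp e (A *m axis R k) by exact: derive_val.
  split => //; apply: (H s x) => //; exact: le_trans eta'le.
have := dotp_lip e (z0 + l *: axis R k) (z0 + x + l *: axis R k).
have := dotp_lip e (z0 + x) z0.
move: incr; rewrite /phi scale0r addr0 subr0 dotpBr -/K.
rewrite (_ : z0 + x - z0 = x); last by rewrite addrC addKr.
rewrite (_ : z0 + l *: axis R k - _ = - x); last first.
  by rewrite opprD addrACA subrr addr0 opprD addrA subrr add0r.
rewrite normrN.
have : K * `|x| <= K * eta' by rewrite ler_wpM2l.
rewrite !ler_norml => k1 k2 /andP[k3 k4] /andP[k5 k6].
lra.
Qed.

End mean_value_axis.

(** The retraction onto a ball of the maximum norm has Lipschitz constant 1, so that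
composing with it turns a locally Lipschitz function into a globally Lipschitz one
without changing it on the ball. *)
Section clamp.
Variables (R : realType) (p : nat) (rho : R).
Hypothesis rho0 : 0 <= rho.

Definition clamp (y : 'cV[R]_p) : 'cV[R]_p :=
  \col_i Num.max (- rho) (Num.min rho (y i 0)).

Lemma clamp_norm y : `|clamp y| <= rho.
Proof.
apply/mx_normP => // i j; rewrite mxE ler_norml le_max lexx/= ge_max ge_min lexx andbT.
by rewrite (le_trans _ rho0)// oppr_le0.
Qed.

Lemma clampE y : `|y| <= rho -> clamp y = y.
Proof.
move=> yr; apply/colP => i; rewrite mxE.
have := le_trans (entry_le_norm y i 0) yr; rewrite ler_norml => /andP[h1 h2].
by rewrite (min_r h2) (max_r h1).
Qed.

Lemma clamp_lip x y : `|clamp x - clamp y| <= `|x - y|.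
Proof.
apply/mx_normP => // i j; have := entry_le_norm (x - y) i j.
rewrite (ord1 j) !mxE; apply: le_trans.
move: (x i 0) (y i 0) => s t; move: (rho0) => r0.
have h1 := ler_norm (s - t); have h2 := ler_norm (t - s); rewrite distrC in h2.
rewrite ler_norml.
case: (leP rho s) => h3; case: (leP rho t) => h4;
  [case: (leP (- rho) rho) => h5; case: (leP (- rho) rho) => h6
  |case: (leP (- rho) rho) => h5; case: (leP (- rho) t) => h6
  |case: (leP (- rho) s) => h5; case: (leP (- rho) rho) => h6
  |case: (leP (- rho) s) => h5; case: (leP (- rho) t) => h6];
  apply/andP; split; lra.
Qed.

End clamp.

(** [M] is the rank one perturbation [1 + (v - e) e^T] of the identity, where [e] is
an axis along which [v] has a nonzero coordinate; its inverse is given by the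
Sherman-Morrison formula. *)
Lemma axis_to_vector (R : realType) (p : nat) (v : 'cV[R]_p) : v != 0 ->
  exists (k : 'I_p) (M M' : 'M[R]_p),
    [/\ M *m axis R k = v, M' *m v = axis R k & M *m M' = 1%:M].
Proof.
move=> v0.
have [k vk0] : exists k, v k 0 != 0.
  apply: contrapT => H; case/eqP: v0; apply/colP => i; rewrite mxE.
  by apply/eqP; apply: contrapT => vi; apply: H; exists i; apply/negP.
pose e := axis R k; pose w := v - e; pose c := (v k 0)^-1.
have ee : e^T *m e = 1%:M.
  by rewrite /e /axis trmx_delta mul_delta_mx; apply/matrixP => i j; rewrite !mxE !ord1 eqxx.
have ew : e^T *m w = (v k 0 - 1)%:M.
  rewrite mulmxBr ee; apply/matrixP => i j; rewrite !ord1 {i j} !mxE eqxx (bigD1 k)//=.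
  rewrite !mxE !eqxx mul1r big1 ?addr0// => i ik.
  by rewrite !mxE (negPf ik) mul0r.
have MM' : (1%:M + w *m e^T) *m (1%:M - c *: (w *m e^T)) = 1%:M.
  rewrite mulmxDl mul1mx mulmxBr mulmx1 -scalemxAr -mulmxA (mulmxA e^T) ew.
  rewrite mul_scalar_mx -scalemxAr scalerA.
  rewrite (_ : c * (v k 0 - 1) = 1 - c); last by rewrite mulrBr mulVf// mulr1.
  by move: (w *m e^T) => X; apply/matrixP => i j; rewrite !mxE; ring.
have Me : (1%:M + w *m e^T) *m e = v.
  by rewrite mulmxDl mul1mx -mulmxA ee mulmx1 /w subrKC.
exists k, (1%:M + w *m e^T), (1%:M - c *: (w *m e^T)); split => //.
by rewrite -/e -{1}Me mulmxA (mulmx1C MM') mul1mx.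
Qed.

Definition lipschitz_on_balls (R : realType) (p m : nat) (g : 'cV[R]_p -> 'cV[R]_m) :=
  forall rho : R, exists L : R, forall x y,
    `|x| <= rho -> `|y| <= rho -> `|g x - g y| <= L * `|x - y|.

(** A linear change of variables makes the direction [v] an axis, and
[mean_value_axis] applies to [G]. The clamp at radius 3 acts trivially on the
segment, on the segments within distance 1 of it, and on a neighborhood of these. *)
Theorem mean_value_differentiable (R : realType) (p m : nat)
    (g : 'cV[R]_p -> 'cV[R]_m) (c x v : 'cV[R]_p) (r : R) (e : 'cV[R]_m) (al : R) :
  lipschitz_on_balls g ->
  (forall z, `|z - c| < r -> differentiable g z -> dotp e (dmx g z *m v) <= al) ->
  `|x - c| < r -> `|x + v - c| < r -> v != 0 ->
  dotp e (g (x + v) - g x) <= al.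
Proof.
move=> glip H xr xvr v0.
have [k [M [M' [Mk M'v MM']]]] := axis_to_vector v0.
pose KM := 1 + p%:R * `|M|; have KM0 : 0 < KM by rewrite ltr_wpDr// mulr_ge0.
have KMle (h : 'cV[R]_p) : `|M *m h| <= KM * `|h|.
  by rewrite (le_trans (mulmx_norm_le _ _))// ler_wpM2r// lerDr.
pose KM' := 1 + p%:R * `|M'|; have KM'0 : 0 < KM' by rewrite ltr_wpDr// mulr_ge0.
have KM'le (h : 'cV[R]_p) : `|M' *m h| <= KM' * `|h|.
  by rewrite (le_trans (mulmx_norm_le _ _))// ler_wpM2r// lerDr.
have r3 : (0 : R) <= 3 by [].
pose G y := g (x + M *m clamp 3 y).
have [L0 HL0] := glip (`|x| + KM * 3).
pose L := 1 + `|L0|; have Lpos : 0 < L by rewrite ltr_wpDr.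
have HL y y' : `|G y - G y'| <= L * KM * `|y - y'|.
  have bound z : `|x + M *m clamp 3 z| <= `|x| + KM * 3.
    rewrite (le_trans (ler_normD _ _))// lerD2l (le_trans (KMle _))//.
    by rewrite ler_wpM2l ?(ltW KM0)// clamp_norm.
  apply: le_trans (HL0 _ _ (bound _) (bound _)) _.
  apply: (@le_trans _ _ (L * (KM * `|y - y'|))); last by rewrite mulrA.
  rewrite (_ : _ - _ = M *m (clamp 3 y - clamp 3 y')); last first.
    by rewrite mulmxBr opprD addrACA subrr add0r.
  apply: (@le_trans _ _ (L * `|M *m (clamp 3 y - clamp 3 y')|)).
    by rewrite ler_wpM2r// (le_trans (ler_norm _))// lerDr.
  rewrite ler_wpM2l ?(ltW Lpos)// (le_trans (KMle _))// ler_wpM2l ?(ltW KM0)//.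
  exact: clamp_lip.
pose mx := Num.max `|x - c| `|x + v - c|.
have mxr : mx < r by rewrite gt_max xr.
(* Segments at distance [eta] from the given one still stay in the ball around [c]. *)
pose eta := Num.min 1 ((r - mx) / (2 * KM)).
have eta0 : 0 < eta by rewrite lt_min ltr01 divr_gt0 ?subr_gt0// mulr_gt0.
have := @mean_value_axis R p m G (L * KM) (mulr_gt0 Lpos KM0) HL k e al 1 eta 0 ler01 eta0.
rewrite mulr1 scale1r add0r /G.
have n1 : `|axis R k| = 1 by rewrite -(scale1r (axis R k)) norm_axis normr1.
rewrite !clampE ?normr0 ?n1 ?ler1n// Mk mulmx0 addr0; apply.
move=> s y A s0 s1 yeta.
rewrite add0r; set z := y + s *: axis R k => GA.
have y1 : `|y| <= 1 by rewrite (le_trans yeta)// ge_min lexx.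
have z2 : `|z| <= 2.
  rewrite (le_trans (ler_normD _ _))// norm_axis gtr0_norm//.
  by rewrite (_ : (2 : R) = 1 + 1)// lerD// ltW.
have gA : frechet g (x + M *m z) (A *m M').
  move=> d d0.
  have [r1 r10 Hr1] := GA _ (divr_gt0 d0 KM'0).
  exists (Num.min r1 1 / KM'); first by rewrite divr_gt0// lt_min r10 ltr01.
  move=> h; rewrite ltr_pdivlMr// mulrC lt_min => /andP[h1 h2].
  have k1 := le_lt_trans (KM'le h) h1; have k2 := le_lt_trans (KM'le h) h2.
  have := Hr1 (M' *m h) k1; rewrite /G !clampE; last 2 first.
  - by rewrite (le_trans z2)// ler_nat.
  - rewrite (le_trans (ler_normD _ _))// (_ : (3 : R) = 2 + 1); last by lra.
    by rewrite lerD// ltW.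
  rewrite mulmxDr (mulmxA M M' h) MM' mul1mx addrA mulmxA => /le_trans; apply.
  by rewrite -mulrA ler_wpM2l ?(ltW d0)// mulrC ler_pdivrMr// mulrC.
have [dg dgE] := frechet_differentiable gA.
have := H (x + M *m z); rewrite dgE -mulmxA M'v; apply => //.
rewrite (_ : _ - _ = (1 - s) *: (x - c) + s *: (x + v - c) + M *m y); last first.
  rewrite /z mulmxDr -scalemxAr Mk; move: (M *m y) => My.
  by apply/colP => i; rewrite !mxE; ring.
apply: le_lt_trans (ler_normD _ _) _.
have j1 : `|(1 - s) *: (x - c) + s *: (x + v - c)| <= mx.
  rewrite (le_trans (ler_normD _ _))// !normrZ gtr0_norm ?subr_gt0// gtr0_norm//.
  rewrite (_ : mx = (1 - s) * mx + s * mx); last by ring.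
  by rewrite lerD// ler_wpM2l ?subr_ge0 ?(ltW s0) ?(ltW s1)// le_max lexx ?orbT.
have j2 : `|M *m y| <= (r - mx) / 2.
  apply: le_trans (KMle _) _; apply: (@le_trans _ _ (KM * eta)).
    by rewrite ler_wpM2l// ltW.
  apply: (@le_trans _ _ (KM * ((r - mx) / (2 * KM)))).
    by rewrite ler_wpM2l ?(ltW KM0)// ge_min lexx orbT.
  by rewrite (_ : KM * _ = (r - mx) / 2)//; field; rewrite gt_eqF.
move: j1 j2 mxr; move: (mx) => q; lra.
Qed.

(** * Clarke derivatives, separation and nonsingular matrices *)

Definition convex_comb_closed (R : realType) (V : lmodType R) (A : set V) :=
  forall x y (s : R), A x -> A y -> 0 <= s -> s <= 1 -> A (s *: x + (1 - s) *: y).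

Lemma convex_set_combP (R : realType) (V : lmodType R) (A : set V) :
  @convex_set R V A <-> convex_comb_closed A.
Proof.
split=> [cA x y s Ax Ay s0 s1|cA x y l].
  by have := cA x y (Itv01 s0 s1) (mem_set Ax) (mem_set Ay); rewrite inE.
by rewrite !inE => Ax Ay; apply: cA.
Qed.

Lemma convex_hull_comb (R : realType) (V : lmodType R) (A : set V) :
  convex_comb_closed (convex_hull A).
Proof.
move=> x y s Hx Hy s0 s1 B [AB cB].
have /convex_set_combP := cB; apply => //; [exact: Hx|exact: Hy].
Qed.

Lemma sub_convex_hull (R : realType) (V : lmodType R) (A : set V) :
  A `<=` convex_hull A.
Proof. by move=> x Ax B [AB _]; exact: AB. Qed.

Lemma clarke_dmx (R : realType) (p m : nat) (g : 'cV[R]_p -> 'cV[R]_m) z :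
  differentiable g z -> clarke g z (dmx g z).
Proof.
move=> dg; apply: sub_convex_hull; exists (fun=> z); split => //.
  exact: cvg_cst.
exact: cvg_cst.
Qed.

Section operator_norm.
Variables (R : realType).

Lemma enorm_le_norm (k : nat) (x : 'cV[R]_k) : enorm x <= k%:R * `|x|.
Proof.
have kx : 0 <= k%:R * `|x| by rewrite mulr_ge0.
rewrite -(ger0_norm kx) -sqrtr_sqr ler_wsqrtr//.
apply: (@le_trans _ _ (\sum_(i < k) `|x| ^+ 2)).
  apply: ler_sum => i _; rewrite -real_normK ?num_real// lerXn2r ?nnegrE//.
  exact: entry_le_norm.
rewrite sumr_const card_ord exprMn -[leLHS]mulr_natl ler_wpM2r ?sqr_ge0//.
case: k {x kx} => [|k]; first by rewrite expr2 mul0r.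
by rewrite expr2 ler_peMr// ler1n.
Qed.

Lemma norm_le_enorm (k : nat) (x : 'cV[R]_k) : `|x| <= enorm x.
Proof.
apply/mx_normP => [|i j]; first exact: sqrtr_ge0.
by rewrite (ord1 j); exact: entry_le_enorm.
Qed.

Lemma norm_le_opnorm (m p : nat) (M : 'M[R]_(m, p)) (b : R) :
  opnorm M <= b -> 0 <= b -> `|M| <= b.
Proof.
move=> Mb b0; apply/mx_normP => // i j.
apply: le_trans Mb; apply: (@le_trans _ _ (enorm (M *m delta_mx j (0 : 'I_1)))).
  by rewrite -colE; have := entry_le_enorm (col j M) i; rewrite mxE.
apply: ub_le_sup.
  exists (m%:R * (p%:R * `|M|)) => _ [x /= x1 <-].
  rewrite (le_trans (enorm_le_norm _))// ler_wpM2l// (le_trans (mulmx_norm_le _ _))//.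
  rewrite -[leRHS]mulr1 ler_wpM2l// ?mulr_ge0//.
  exact: le_trans (norm_le_enorm x) x1.
exists (delta_mx j (0 : 'I_1)) => //=.
rewrite /enorm (bigD1 j)//= big1 ?addr0 => [|l lj].
  by rewrite mxE !eqxx expr1n sqrtr1.
by rewrite mxE (negPf lj) expr2 mul0r.
Qed.

Lemma compact_matrix_ball (m p : nat) (b : R) : compact [set M : 'M[R]_(m, p) | `|M| <= b].
Proof.
have [b0|b0] := leP 0 b; last first.
  rewrite (_ : mkset _ = set0); first exact: compact0.
  by apply/seteqP; split => // M /= /(le_trans (normr_ge0 M)); rewrite leNgt b0.
have cv : continuous (vec_mx : 'rV[R]_(m * p) -> 'M[R]_(m, p)).
  apply: (@lipschitz_continuous _ _ _ _ 1) => x y; rewrite mul1r -raddfB/=.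
  apply/mx_normP => // i j; rewrite mxE; exact: entry_le_norm.
have K : compact [set v : 'rV[R]_(m * p) | forall i, v ord0 i \in `[(- b), b]].
  apply: (@rV_compact _ _ (fun=> `[(- b), b]%classic)) => _.
  exact: segment_compact.
have := @continuous_compact _ _ (vec_mx : 'rV[R]_(m * p) -> 'M[R]_(m, p)) _ (continuous_subspaceT cv) K.
congr compact; apply/seteqP; split => [_ [v /= vb <-]|M /= Mb].
  apply/mx_normP => // i j; rewrite mxE ler_norml.
  by have := vb (mxvec_index i j); rewrite in_itv.
exists (mxvec M); last by rewrite mxvecK.
move=> i /=; case/mxvec_indexP: i => i j; rewrite mxvecE in_itv/= -ler_norml.
exact: le_trans (entry_le_norm M i j) Mb.
Qed.

End operator_norm.

(** Otherwise derivatives at points tending to [z0] would stay far from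
[clarke g z0], although by compactness they accumulate at one of its elements. *)
Lemma clarke_usc (R : realType) (p m : nat) (g : 'cV[R]_p -> 'cV[R]_m) (b : R) z0 :
  (forall z, differentiable g z -> `|dmx g z| <= b) ->
  forall e, 0 < e -> exists2 r, 0 < r & forall z, `|z - z0| < r ->
    differentiable g z -> exists2 M, clarke g z0 M & `|dmx g z - M| < e.
Proof.
move=> gb e e0; apply: contrapT => nr.
have far r : 0 < r -> exists z, [/\ `|z - z0| < r, differentiable g z &
    forall M, clarke g z0 M -> e <= `|dmx g z - M|].
  move=> r0; apply: contrapT => nz; apply: nr; exists r => // z zr dz.
  apply: contrapT => nM; apply: nz; exists z; split => // M cM.
  by rewrite leNgt; apply/negP => lt; apply: nM; exists M.
pose E r := [set M | exists z, [/\ `|z - z0| < r, differentiable g z,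
    M = dmx g z & forall M, clarke g z0 M -> e <= `|dmx g z - M|]].
pose F := filter_from [set r : R | 0 < r] E.
have FF : ProperFilter F.
  apply: filter_from_proper.
    apply: filter_from_filter; first by exists 1 => /=.
    move=> r s /= r0 s0; exists (Num.min r s); first by rewrite /= lt_min r0.
    move=> M [z [+ dz Mz Hz]]; rewrite lt_min => /andP[zr zs].
    by split; exists z.
  move=> r /= r0; have [z [zr dz Hz]] := far r r0.
  by exists (dmx g z), z.
have FK : F [set M : 'M[R]_(m, p) | `|M| <= b].
  by exists 1 => //= M [z [_ dz -> _]]; exact: gb.
have [M0 [_ clM0]] := @compact_matrix_ball R m p b F FF FK.
have seqz n : exists z, [/\ `|z - z0| < n.+1%:R^-1, differentiable g z,
    `|dmx g z - M0| < n.+1%:R^-1 & forall M, clarke g z0 M -> e <= `|dmx g z - M|].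
  have n0 := natSinv_gt0 R n.
  have En : F (E n.+1%:R^-1) by exists n.+1%:R^-1.
  have Bn : nbhs M0 (ball M0 n.+1%:R^-1) by exact: nbhsx_ballx.
  have [M [[z [zn dz -> Hz]]]] := clM0 _ _ En Bn.
  by rewrite -ball_normE/= distrC => zM; exists z.
have [u Hu] := choice seqz.
have cvgu (V : normedModType R) (w : nat -> V) (w0 : V) :
    (forall n, `|w n - w0| < n.+1%:R^-1) -> w j @[j --> \oo] --> w0.
  move=> Hw; apply/cvgrPdist_lt => d d0; have [N Nd] := natSinv_small d0.
  exists N => //= n Nn; rewrite distrC (lt_trans (Hw n))// (le_lt_trans _ Nd)//.
  by rewrite lef_pV2 ?posrE// ler_nat ltnS.
have M0c : clarke g z0 M0.
  apply: sub_convex_hull; exists u; split.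
  - by move=> j; have [] := Hu j.
  - by apply: cvgu => j; have [] := Hu j.
  - by apply: cvgu => j; have [] := Hu j.
have [n ne] := natSinv_small e0.
have [_ _ k1 k2] := Hu n.
by have := lt_trans k1 ne; rewrite ltNge (k2 _ M0c).
Qed.

(** The normal vector [w] is an element of almost minimal norm: a short step from [w]
towards [u] stays in [K] and hence decreases the squared norm by very little, which
bounds [dotp w u] from below. An exact minimizer would require [K] to be closed. *)
Lemma convex_separation (R : realType) (k : nat) (K : set 'cV[R]_k) (c B : R) :
  K !=set0 -> convex_comb_closed K -> 0 < c -> (forall u, K u -> c <= `|u|) ->
  (forall u, K u -> `|u| <= B) ->
  exists2 w, K w & forall u, K u -> dotp w w / 2 <= dotp w u.
Proof.
move=> [u0 Ku0] cK c0 Kc KB.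
pose E := [set dotp u u | u in K].
have infE : has_inf E.
  split; first by exists (dotp u0 u0); exists u0.
  by exists 0 => _ [u _ <-]; exact: dotp_ge0.
have B0 : 0 <= B := le_trans (normr_ge0 _) (KB u0 Ku0).
pose Q := 1 + k%:R * (B + B) ^+ 2.
have Q0 : 0 < Q by rewrite ltr_wpDr// mulr_ge0// sqr_ge0.
have c2 : 0 < c ^+ 2 / 2 by rewrite divr_gt0// exprn_gt0.
pose s := Num.min 1 (c ^+ 2 / 2 / Q).
have s0 : 0 < s by rewrite lt_min ltr01 divr_gt0.
have s1 : s <= 1 by rewrite ge_min lexx.
have sQ : s * Q <= c ^+ 2 / 2 by rewrite -ler_pdivlMr// ge_min lexx orbT.
have eta0 : 0 < s * (c ^+ 2 / 2) by rewrite mulr_gt0.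
have [_ [w Kw <-] wlt] := inf_adherent eta0 infE.
exists w => // u Ku.
have wc : c ^+ 2 <= dotp w w.
  apply: le_trans (sqr_norm_le_dotp w).
  by rewrite lerXn2r ?nnegrE ?(ltW c0)//; exact: Kc.
have : inf E <= dotp (s *: u + (1 - s) *: w) (s *: u + (1 - s) *: w).
  apply: (ge_inf infE.2); exists (s *: u + (1 - s) *: w) => //.
  by apply: cK => //; exact: ltW.
rewrite (_ : s *: u + (1 - s) *: w = w + s *: (u - w)); last first.
  by apply/colP => i; rewrite !mxE; ring.
rewrite dotpDl !dotpDr !dotpZl !dotpZr (dotpC (u - w) w) dotpBr.
have uwQ : dotp (u - w) (u - w) <= Q.
  rewrite (le_trans (dotp_le_sqr_norm _))// /Q -[leLHS]add0r lerD// ler_wpM2l//.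
  rewrite lerXn2r ?nnegrE ?addr_ge0//.
  by rewrite (le_trans (ler_normB _ _))// lerD// KB.
have k1 : s * (s * dotp (u - w) (u - w)) <= s * (c ^+ 2 / 2).
  rewrite ler_wpM2l ?(ltW s0)// (le_trans _ sQ)// ler_wpM2l// ltW//.
move=> k2.
suff : s * (dotp w w / 2) <= s * dotp w u by rewrite ler_pM2l.
have k3 : s * c ^+ 2 <= s * dotp w w by rewrite ler_wpM2l// ltW.
move: k1 k2 k3 wlt; lra.
Qed.

Section nonsingular.
Variables (R : realType) (p : nat).

Lemma det_bound (q : nat) (N : 'M[R]_q) (be : R) :
  (forall i j, `|N i j| <= be) -> `|\det N| <= q`!%:R * be ^+ q.
Proof.
move=> Nb; apply: le_trans (ler_norm_sum _ _ _) _.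
apply: (@le_trans _ _ (\sum_(s : 'S_q) be ^+ q)).
  apply: ler_sum => s _; rewrite normrM normrX normrN1 expr1n mul1r normr_prod.
  rewrite -[leRHS](_ : \prod_(i < q) be = _); last by rewrite prodr_const card_ord.
  by apply: ler_prod => i _; rewrite normr_ge0 Nb.
by rewrite sumr_const card_Sn [leRHS]mulr_natl.
Qed.

(** By Cramer's rule, the inverse of this number bounds the inverse of a matrix whose
entries are at most [be] and whose determinant is at least [de]. *)
Definition expansion_const (be de : R) : R :=
  de / (1 + p%:R * ((p.-1)`!%:R * be ^+ p.-1)).

Lemma expansion_const_gt0 be de : 0 <= be -> 0 < de -> 0 < expansion_const be de.
Proof. by move=> be0 de0; rewrite divr_gt0// ltr_wpDr// !mulr_ge0// exprn_ge0. Qed.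

Lemma nonsingular_expansion (N : 'M[R]_p) (be de : R) : 0 <= be -> 0 < de ->
  `|N| <= be -> de <= `|\det N| ->
  forall v : 'cV[R]_p, expansion_const be de * `|v| <= `|N *m v|.
Proof.
move=> be0 de0 Nb Nd v.
pose ka : R := (p.-1)`!%:R * be ^+ p.-1.
have ka0 : 0 <= ka by rewrite mulr_ge0// exprn_ge0.
have adjb : `|\adj N| <= ka.
  apply/mx_normP => // i j; rewrite mxE /cofactor normrM normrX normrN1 expr1n mul1r.
  by apply: det_bound => i' j'; rewrite !mxE (le_trans (entry_le_norm _ _ _)).
have dv : `|\det N| * `|v| <= p%:R * ka * `|N *m v|.
  rewrite -normrZ -mul_scalar_mx -mul_adj_mx -mulmxA.
  apply: le_trans (mulmx_norm_le _ _) _.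
  by rewrite ler_wpM2r// ler_wpM2l.
rewrite /expansion_const -/ka mulrAC ler_pdivrMr; last first.
  by rewrite ltr_wpDr// mulr_ge0.
apply: (@le_trans _ _ (`|\det N| * `|v|)); first by rewrite ler_wpM2r.
by rewrite (le_trans dv)// mulrC ler_wpM2l// lerDr.
Qed.

End nonsingular.

(** * Global inversion of locally expanding maps *)

Lemma continuous_dotp (R : realType) (T : topologicalType) (p : nat) (f : T -> 'cV[R]_p) :
  continuous f -> continuous (fun x => dotp (f x) (f x)).
Proof.
move=> cf x; rewrite /dotp.
have ci i : f y i 0 @[y --> x] --> f x i 0.
  by apply: (@continuous_comp _ _ _ f (fun M : 'cV[R]_p => M i 0)); [exact: cf|exact: coord_continuous].
elim: (index_enum _) => [|i s IH].
  under eq_fun do rewrite big_nil.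
  by rewrite ?big_nil; exact: cvg_cst.
under eq_fun do rewrite big_cons.
by rewrite ?big_cons; apply: cvgD => //; exact: cvgM.
Qed.

Section global_homeomorphism.
Variables (R : realType) (p : nat) (F : 'cV[R]_p -> 'cV[R]_p) (La c : R).
Hypothesis c0 : 0 < c.
Hypothesis F_lip : forall x y, `|F x - F y| <= La * `|x - y|.

Definition expanding_near (z : 'cV[R]_p) (r : R) :=
  forall x y, `|x - z| < r -> `|y - z| < r -> c * `|x - y| <= `|F x - F y|.

Hypothesis F_exp : forall z, exists2 r, 0 < r & expanding_near z r.

Definition sqdist (w z : 'cV[R]_p) := dotp (F z - w) (F z - w).

Hypothesis F_desc : forall z w, F z <> w -> forall rho, 0 < rho ->
  exists2 z', `|z' - z| < rho & sqdist w z' < sqdist w z.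

(** By compactness, the radius of expansion can be chosen uniform on balls. *)
Lemma expanding_uniform (rho : R) :
  exists2 r, 0 < r & forall z, `|z| <= rho -> expanding_near z r.
Proof.
have /compact_near_coveringP H := @compact_matrix_ball R p 1 rho.
have := H R ((0 : R)^'+) (fun r z => expanding_near z r) _.
move=> /(_ _) K.
have {}K : \forall r \near (0 : R)^'+, [set M : 'cV[R]_p | `|M| <= rho] `<=` (fun z => expanding_near z r).
  apply: K => z _; have [r r0 Hr] := F_exp z.
  have r2 : 0 < r / 2 by rewrite divr_gt0.
  exists (ball z (r / 2), [set s | 0 < s < r / 2]) => /=.
    split; first exact: nbhsx_ballx.
    by near=> s; apply/andP; split; near: s; [exact: nbhs_right_gt|exact: nbhs_right_lt].
  move=> [z' s] /= [] + /andP[s0 sr]; rewrite -ball_normE/= => zz'.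
  have sub x : `|x - z'| < s -> `|x - z| < r.
    move=> xz'; rewrite (_ : x - z = (x - z') - (z - z')); last by rewrite opprB subrKA.
    rewrite (le_lt_trans (ler_normB _ _))// (splitr r) ltrD//.
    exact: lt_trans sr.
  by move=> x y xz yz; apply: Hr; exact: sub.
have [r [r0 Hr]] : exists r, 0 < r /\ [set M : 'cV[R]_p | `|M| <= rho] `<=` (fun z => expanding_near z r).
  apply: (@filter_ex _ ((0 : R)^'+)); near=> r; split; first by near: r; exact: nbhs_right_gt.
  by near: r.
by exists r => // z zr; apply: Hr.
Unshelve. all: by end_near. Qed.

Definition step_size (r : R) := c * r / (4 * (1 + p%:R)).

(** A minimizer of the distance to the prescribed
value over a small ball is interior by expansion, and [F_desc] rules out a
positive minimum. *)
Lemma solve_near z r w : 0 < r -> expanding_near z r -> `|w - F z| < step_size r ->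
  exists2 x, F x = w & c * `|x - z| <= `|w - F z|.
Proof.
move=> r0 Hr ws.
have r2 : 0 < r / 2 by rewrite divr_gt0.
pose phi h := sqdist w (z + h).
have cphi : continuous phi.
  have cF : continuous (fun h => F (z + h) - w).
    apply: (@lipschitz_continuous _ _ _ _ La) => x y.
    rewrite opprB addrA subrK (le_trans (F_lip _ _))//.
    by rewrite opprD addrACA subrr add0r.
  exact: continuous_dotp.
have [h0 + Hmin] : exists2 h, h \in [set h : 'cV[R]_p | `|h| <= r / 2] &
    forall t, t \in [set h : 'cV[R]_p | `|h| <= r / 2] -> phi h <= phi t.
  apply: compact_EVT_min.
  - by exists 0 => /=; rewrite normr0 ltW.
  - exact: compact_matrix_ball.
  - exact: continuous_subspaceT.
rewrite inE/= => h0r.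
have rr : r / 2 < r by rewrite ltr_pdivrMr// mulr_natr mulr2n ltrDl.
have exp h : `|h| <= r / 2 -> c * `|h| <= `|F (z + h) - F z|.
  move=> hr; have := Hr (z + h) z.
  rewrite addrC addKr subrr normr0; apply => //.
  exact: le_lt_trans rr.
have [Fw|Fw] := pselect (F (z + h0) = w).
  exists (z + h0) => //; rewrite -Fw (addrC z) addrK (addrC h0).
  exact: exp.
exfalso; have [h0lt|] := ltP `|h0| (r / 2).
  have d0 : 0 < r / 2 - `|h0| by rewrite subr_gt0.
  have [z' z'd z's] := F_desc Fw d0.
  have zr : `|z' - z| <= r / 2.
    rewrite (_ : z' - z = (z' - (z + h0)) + h0); last by rewrite opprD addrA subrK.
    by rewrite (le_trans (ler_normD _ _))// -lerBrDr ltW.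
  have := Hmin (z' - z); rewrite inE => /(_ zr).
  by rewrite /phi subrKC leNgt z's.
move=> h0ge.
have := Hmin 0; rewrite inE/= normr0 => /(_ (ltW r2)); rewrite leNgt => /negP; apply.
rewrite /phi /sqdist addr0.
set a := `|w - F z| in ws.
have a0 : 0 <= a := normr_ge0 _.
have aE : `|F z - w| = a by rewrite distrC.
have p1 : 0 < 4 * (1 + p%:R) :> R by rewrite mulr_gt0// ltr_wpDr.
apply: le_lt_trans (dotp_le_sqr_norm _) _; rewrite aE.
apply: lt_le_trans (sqr_norm_le_dotp _).
apply: (@le_lt_trans _ _ (((1 + p%:R) * a) ^+ 2)).
  rewrite exprMn ler_wpM2r ?sqr_ge0// expr2 mulrDl mul1r -[leLHS]add0r.
  by rewrite -addrA lerD// lerDl mulr_ge0// addr_ge0.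
rewrite ltrXn2r ?nnegrE ?mulr_ge0 ?addr_ge0//.
have k1 := exp h0 h0r.
have k2 : c * (r / 2) <= c * `|h0| by rewrite ler_wpM2l// ltW.
have k3 : `|F (z + h0) - F z| <= `|F (z + h0) - w| + a.
  by rewrite -aE (distrC (F z)) (le_trans _ (ler_normD _ _))// addrA subrK.
move: ws; rewrite /step_size ltr_pdivlMr// => k4.
have : 0 <= p%:R * a by rewrite mulr_ge0.
lra.
Qed.

(** [solve_near] lifts the chain [W] step by step. The lift cannot run away: by
expansion its steps have length at most [eta / c], so that it stays in the ball of
radius [rho], where the radius of expansion [r] is uniform. *)
Lemma lift_steps (rho r eta : R) (N : nat) (W : nat -> 'cV[R]_p) z0 :
  0 < r -> (forall z, `|z| <= rho -> expanding_near z r) ->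
  F z0 = W 0 -> (forall k, (k < N)%N -> `|W k.+1 - W k| <= eta) ->
  eta < step_size r -> `|z0| + N%:R * (eta / c) <= rho ->
  exists Z : nat -> 'cV[R]_p, [/\ Z 0 = z0,
    forall k, (k <= N)%N -> F (Z k) = W k /\ `|Z k| <= rho &
    forall k, (k < N)%N -> c * `|Z k.+1 - Z k| <= `|W k.+1 - W k|].
Proof.
move=> r0 Hr Fz0 Weta etas total.
have next (z w : 'cV[R]_p) : exists x, (exists2 x', F x' = w & c * `|x' - z| <= `|w - F z|) ->
    F x = w /\ c * `|x - z| <= `|w - F z|.
  have [[x' h1 h2]|nx] := pselect (exists2 x', F x' = w & c * `|x' - z| <= `|w - F z|).
    by exists x'.
  by exists z.
have [nx Hnx] := choice (fun zw : 'cV[R]_p * 'cV[R]_p => next zw.1 zw.2).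
pose Z := fix Z k := if k is k'.+1 then nx (Z k', W k) else z0.
have main k : (k <= N)%N -> F (Z k) = W k /\ `|Z k| <= `|z0| + k%:R * (eta / c).
  elim: k => [_|k IH kN]; first by rewrite mul0r addr0.
  have [Fk Zk] := IH (ltnW kN).
  have eta0 : 0 <= eta := le_trans (normr_ge0 _) (Weta k kN).
  have Zrho : `|Z k| <= rho.
    rewrite (le_trans Zk)// (le_trans _ total)// lerD2l ler_wpM2r ?divr_ge0 ?(ltW c0)//.
    by rewrite ler_nat ltnW.
  have [|h1 h2] := Hnx (Z k, W k.+1).
    apply: (solve_near r0 (Hr _ Zrho)); rewrite Fk.
    exact: le_lt_trans (Weta k kN) etas.
  split => //=; rewrite -natr1 mulrDl mul1r addrA.
  rewrite (_ : nx _ = Z k + (nx (Z k, W k.+1) - Z k)); last by rewrite subrKC.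
  rewrite (le_trans (ler_normD _ _))// lerD// ler_pdivlMr// mulrC (le_trans h2)//= Fk.
  exact: Weta.
exists Z; split => // k kN.
  have [h1 h2] := main k kN; split => //; rewrite (le_trans h2)// (le_trans _ total)//.
  case: N Weta total kN {main} => [|N] Weta total kN; first by move: kN; rewrite leqn0 => /eqP->.
  have eta0 : 0 <= eta := le_trans (normr_ge0 _) (Weta 0%N isT).
  by rewrite lerD2l ler_wpM2r ?divr_ge0 ?(ltW c0)// ler_nat.
have [Fk Zk] := main k (ltnW kN).
have eta0 : 0 <= eta := le_trans (normr_ge0 _) (Weta k kN).
have Zrho : `|Z k| <= rho.
  rewrite (le_trans Zk)// (le_trans _ total)// lerD2l ler_wpM2r ?divr_ge0 ?(ltW c0)//.
  by rewrite ler_nat ltnW.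
have [|h1 h2] := Hnx (Z k, W k.+1).
  apply: (solve_near r0 (Hr _ Zrho)); rewrite Fk.
  exact: le_lt_trans (Weta k kN) etas.
by rewrite /= -Fk.
Qed.

Definition line (N : nat) (w0 w1 : 'cV[R]_p) (k : nat) := w0 + (k%:R / N%:R) *: (w1 - w0).

Lemma line_step N w0 w1 k : `|line N w0 w1 k.+1 - line N w0 w1 k| = `|w1 - w0| / N%:R.
Proof.
rewrite /line (_ : _ - _ = (N%:R)^-1 *: (w1 - w0)).
  by rewrite normrZ ger0_norm ?invr_ge0// mulrC.
rewrite -natr1; move: (N%:R^-1 : R) => n; apply/colP => i; rewrite !mxE; ring.
Qed.

Lemma line_start N w0 w1 : line N w0 w1 0 = w0.
Proof. by rewrite /line mul0r scale0r addr0. Qed.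

Lemma line_end N w0 w1 : (0 < N)%N -> line N w0 w1 N = w1.
Proof.
by move=> N0; rewrite /line divff ?pnatr_eq0 -?lt0n// scale1r subrKC.
Qed.

Lemma lift_line (rho r : R) (N : nat) w1 z0 :
  0 < r -> (forall z, `|z| <= rho -> expanding_near z r) -> (0 < N)%N ->
  `|w1 - F z0| / N%:R < step_size r -> `|z0| + `|w1 - F z0| / c <= rho ->
  exists Z : nat -> 'cV[R]_p, [/\ Z 0 = z0,
    forall k, (k <= N)%N -> F (Z k) = line N (F z0) w1 k /\ `|Z k| <= rho &
    forall k, (k < N)%N -> c * `|Z k.+1 - Z k| <= `|w1 - F z0| / N%:R].
Proof.
move=> r0 Hr N0 small total.
have [||||Z [Z0 Z1 Z2]] := @lift_steps rho r (`|w1 - F z0| / N%:R) N (line N (F z0) w1) z0 r0 Hr.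
- by rewrite line_start.
- by move=> k _; rewrite line_step.
- by [].
- rewrite (le_trans _ total)// lerD2l mulrA mulrCA divff ?pnatr_eq0 -?lt0n//.
  by rewrite mulr1.
exists Z; split => // k kN; rewrite -(line_step N (F z0) w1 k).
exact: Z2.
Qed.

Lemma exists_large_nat (a e : R) : 0 <= a -> 0 < e -> exists N : nat, (0 < N)%N /\ a / N%:R < e.
Proof.
move=> a0 e0; exists (Num.truncn (a / e)).+1; split => //.
rewrite ltr_pdivrMr// mulrC -ltr_pdivrMr//.
exact: truncnS_gt.
Qed.

(** Lifting the segment from [F z0] to [w1] gives a preimage of [w1] at the distance
that expansion prescribes. Once [F] is known to be injective, this is the global
expansion inequality. *)
Lemma lift_end w1 z0 : exists2 z, F z = w1 & c * `|z - z0| <= `|w1 - F z0|.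
Proof.
pose rho := `|z0| + `|w1 - F z0| / c.
have [r r0 Hr] := expanding_uniform rho.
have s0 : 0 < step_size r by rewrite divr_gt0// mulr_gt0// ltr_wpDr.
have [N [N0 Ns]] := exists_large_nat (normr_ge0 (w1 - F z0)) s0.
have [Z [Z0 Z1 Z2]] := lift_line r0 Hr N0 Ns (lexx _).
exists (Z N); first by have [-> _] := Z1 N (leqnn N); rewrite line_end.
have H k : (k <= N)%N -> c * `|Z k - z0| <= k%:R * (`|w1 - F z0| / N%:R).
  elim: k => [_|k IH kN]; first by rewrite Z0 subrr normr0 mulr0 mul0r.
  rewrite -natr1 mulrDl mul1r (_ : Z k.+1 - z0 = (Z k - z0) + (Z k.+1 - Z k)); last first.
    by rewrite [RHS]addrC subrKA.
  apply: (@le_trans _ _ (c * (`|Z k - z0| + `|Z k.+1 - Z k|))).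
    by rewrite ler_wpM2l ?ler_normD// ltW.
  by rewrite mulrDr lerD// ?IH ?Z2// ltnW.
by have := H N (leqnn N); rewrite mulrCA divff ?pnatr_eq0 -?lt0n// mulr1.
Qed.

(** Two preimages of [w] are joined by a segment, whose image is a loop at [w];
contracting the loop to [w] along straight lines and lifting the contraction
turns the segment into a path in the fibre, which is discrete. All paths are
sampled at finitely many points, finely enough for the uniform radius of
expansion. *)
Theorem global_injective x0 x1 : F x0 = F x1 -> x0 = x1.
Proof.
move=> F01; pose w := F x0.
pose mu := `|La| * `|x1 - x0|.
have mu0 : 0 <= mu by rewrite mulr_ge0.
pose rho := `|x0| + `|x1 - x0| + mu / c.
have [r r0 Hr] := expanding_uniform rho.
have s0 : 0 < step_size r by rewrite divr_gt0// mulr_gt0// ltr_wpDr.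
have r4 : 0 < r / 4 by rewrite divr_gt0.
have e1 : 0 < Num.min (step_size r) (c * (r / 4)) by rewrite lt_min s0 mulr_gt0.
have [N [N0]] := exists_large_nat mu0 e1; rewrite lt_min => /andP[Ns Nr].
have e2 : 0 < Num.min (r / 4) (c * (r / 4)) by rewrite lt_min r4 mulr_gt0.
have M1 : 0 <= (1 + `|La|) * `|x1 - x0| by rewrite mulr_ge0// addr_ge0.
have [M [M0]] := exists_large_nat M1 e2; rewrite lt_min => /andP[Mr Mc].
pose ga i := line M x0 x1 i.
have ga_step i : `|ga i.+1 - ga i| = `|x1 - x0| / M%:R by exact: line_step.
have ga0 : ga 0%N = x0 by exact: line_start.
have gaM : ga M = x1 by exact: line_end.
have ga_x0 i : (i <= M)%N -> `|ga i - x0| <= `|x1 - x0|.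
  move=> iM; rewrite /ga /line addrC addKr normrZ ger0_norm ?divr_ge0//.
  by rewrite ler_piMl// ler_pdivrMr ?ltr0n// mul1r ler_nat.
have Fga i : (i <= M)%N -> `|w - F (ga i)| <= mu.
  move=> iM; rewrite distrC (le_trans (F_lip _ _))//.
  apply: (@le_trans _ _ (`|La| * `|ga i - x0|)); first by rewrite ler_wpM2r// ler_norm.
  by rewrite ler_wpM2l// ga_x0.
(* [Z i] lifts the straight line from [F (ga i)] to [w], starting at [ga i]. *)
have lifts i : exists Z : nat -> 'cV[R]_p, (i <= M)%N -> [/\ Z 0 = ga i,
    forall k, (k <= N)%N -> F (Z k) = line N (F (ga i)) w k /\ `|Z k| <= rho &
    forall k, (k < N)%N -> c * `|Z k.+1 - Z k| <= `|w - F (ga i)| / N%:R].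
  have [iM|iM] := leqP i M; last by exists (fun=> 0).
  have [||Z HZ] := @lift_line rho r N w (ga i) r0 Hr N0.
  - by apply: le_lt_trans Ns; rewrite ler_wpM2r ?invr_ge0// Fga.
  - rewrite /rho lerD ?ler_wpM2r ?invr_ge0 ?(ltW c0) ?Fga//.
    rewrite -[in leLHS](subrKC x0 (ga i)) (le_trans (ler_normD _ _))//.
    by rewrite lerD2l ga_x0.
  by exists Z.
have [Z HZ] := choice lifts.
have steps i k : (i <= M)%N -> (k < N)%N -> `|Z i k.+1 - Z i k| < r / 4.
  move=> iM kN; have [_ _ /(_ k kN) Hs] := HZ i iM.
  rewrite -(ltr_pM2l c0) (le_lt_trans Hs)// (le_lt_trans _ Nr)//.
  by rewrite ler_wpM2r ?invr_ge0// Fga.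
(* Neighboring lifts stay close: their distance is controlled by expansion as long
   as it is less than [r], and in one step it cannot grow from [r / 4] to [r]. *)
have close i k : (i < M)%N -> (k <= N)%N -> `|Z i.+1 k - Z i k| < r / 4.
  move=> iM; elim: k => [_|k IH kN].
    have [-> _ _] := HZ i (ltnW iM); have [-> _ _] := HZ i.+1 iM.
    rewrite ga_step; apply: le_lt_trans Mr.
    by rewrite ler_wpM2r ?invr_ge0// ler_peMl// lerDl.
  have d1 := steps i.+1 k iM kN; have d2 := steps i k (ltnW iM) kN.
  have d3 := IH (ltnW kN).
  have [_ /(_ k.+1 kN)[Fi Zi] _] := HZ i (ltnW iM).
  have [_ /(_ k.+1 kN)[Fi1 _] _] := HZ i.+1 iM.
  have := Hr _ Zi (Z i.+1 k.+1) (Z i k.+1).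
  rewrite subrr normr0 Fi Fi1 => /(_ _ r0) Hexp.
  have {}Hexp := Hexp _.
  rewrite -(ltr_pM2l c0).
  apply: le_lt_trans (Hexp _) _.
    rewrite (_ : _ - _ = (Z i.+1 k.+1 - Z i.+1 k) + (Z i.+1 k - Z i k) - (Z i k.+1 - Z i k)); last first.
      by apply/colP => l; rewrite !mxE; ring.
    apply: le_lt_trans (ler_normB _ _) _.
    apply: le_lt_trans (lerD (ler_normD _ _) (lexx _)) _.
    by move: d1 d2 d3; lra.
  apply: le_lt_trans Mc.
  rewrite (_ : line N _ w k.+1 - _ = (1 - k.+1%:R / N%:R) *: (F (ga i.+1) - F (ga i))); last first.
    by rewrite /line; move: (k.+1%:R / N%:R) => s; apply/colP => l; rewrite !mxE; ring.
  rewrite normrZ.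
  have kN1 : k.+1%:R / N%:R <= 1 :> R by rewrite ler_pdivrMr ?ltr0n// mul1r ler_nat.
  apply: (@le_trans _ _ (`|F (ga i.+1) - F (ga i)|)).
    rewrite ler_piMl// ger0_norm ?subr_ge0// gerBl divr_ge0//.
  rewrite (le_trans (F_lip _ _))// ga_step mulrA ler_wpM2r ?invr_ge0// ler_wpM2r//.
  by rewrite (le_trans (ler_norm La))// lerDr.
(* Two close points of the fibre of [w] coincide. *)
have fibre i : (i < M)%N -> Z i.+1 N = Z i N.
  move=> iM; have d := close i N iM (leqnn N).
  have [_ /(_ N (leqnn N))[Fi Zi] _] := HZ i (ltnW iM).
  have [_ /(_ N (leqnn N))[Fi1 _] _] := HZ i.+1 iM.
  have := Hr _ Zi (Z i.+1 N) (Z i N).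
  rewrite subrr normr0 Fi Fi1 !line_end// subrr normr0 => /(_ _ r0) Hexp.
  have {}Hexp : c * `|Z i.+1 N - Z i N| <= 0.
    by apply: Hexp; rewrite (lt_trans d)// ltr_pdivrMr// ltr_pMr// ltr1n.
  apply/eqP; rewrite -subr_eq0 -normr_eq0 eq_le normr_ge0 andbT.
  by rewrite -(pmulr_rle0 _ c0).
(* The lines from [F x0] and [F x1] to [w] are constant, and so are their lifts. *)
have ends i : (i <= M)%N -> F (ga i) = w -> Z i N = ga i.
  move=> iM Fw; have [Zi0 _ Zs] := HZ i iM; rewrite -Zi0.
  suff H k : (k <= N)%N -> Z i k = Z i 0%N by exact: H.
  elim: k => [//|k IH kN]; rewrite -IH ?(ltnW kN)//.
  have := Zs k kN; rewrite Fw subrr normr0 mul0r pmulr_rle0// => H0.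
  by apply/eqP; rewrite -subr_eq0 -normr_eq0 eq_le normr_ge0 andbT.
have all_eq i : (i <= M)%N -> Z i N = Z 0%N N.
  by elim: i => [//|i IH iM]; rewrite fibre// IH// ltnW.
have e0 : Z 0%N N = x0.
  by rewrite -ga0; apply: ends => //; rewrite ga0.
have eM : Z M N = x1.
  by rewrite -gaM; apply: ends => //; rewrite gaM.
by have := all_eq M (leqnn M); rewrite e0 eM => ->.
Qed.

Theorem global_expansion x y : c * `|x - y| <= `|F x - F y|.
Proof.
have [z Fz zy] := lift_end (F x) y.
by rewrite (global_injective Fz) in zy.
Qed.

Theorem global_surjective w : exists z, F z = w.
Proof. by have [z Fz _] := lift_end w 0; exists z. Qed.

End global_homeomorphism.

(** * The closed loop map *)

Lemma dotp_sqrD (R : realType) (k : nat) (a b : 'cV[R]_k) :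
  dotp (a + b) (a + b) = dotp a a + 2 * dotp a b + dotp b b.
Proof. by rewrite dotpDl !dotpDr (dotpC b a); ring. Qed.

Lemma dotp_trmx (R : realType) (p q : nat) (A : 'M[R]_(p, q)) (w : 'cV[R]_p) (h : 'cV[R]_q) :
  dotp (A^T *m w) h = dotp w (A *m h).
Proof.
rewrite /dotp; under eq_bigr do rewrite mxE mulr_suml.
rewrite exchange_big/=; apply: eq_bigr => i _.
rewrite mxE mulr_sumr; apply: eq_bigr => j _; rewrite mxE; ring.
Qed.

Definition closed_loop (R : realType) (p m : nat) (g : 'cV[R]_p -> 'cV[R]_m)
  (D : 'M[R]_(p, m)) (y : 'cV[R]_p) : 'cV[R]_p := y - D *m g y.

Lemma closed_loop_lip (R : realType) (p m : nat) (g : 'cV[R]_p -> 'cV[R]_m)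
    (D : 'M[R]_(p, m)) (L : R) : (forall x y, `|g x - g y| <= L * `|x - y|) ->
  forall x y, `|closed_loop g D x - closed_loop g D y| <= (1 + m%:R * `|D| * L) * `|x - y|.
Proof.
move=> gL x y; rewrite /closed_loop (_ : _ - _ = (x - y) - D *m (g x - g y)); last first.
  by rewrite mulmxBr; apply/colP => i; rewrite !mxE; ring.
rewrite (le_trans (ler_normB _ _))// mulrDl mul1r lerD2l.
by rewrite (le_trans (mulmx_norm_le _ _))// -[leRHS]mulrA ler_wpM2l ?mulr_ge0.
Qed.

Section feedback.
Variables (R : realType) (p m : nat) (g : 'cV[R]_p -> 'cV[R]_m) (D : 'M[R]_(p, m)).
Variables (b de : R).
Hypothesis p_gt0 : (0 < p)%N.
Hypothesis b0 : 0 <= b.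
Hypothesis de0 : 0 < de.
Hypothesis g_lip : lipschitz_on_balls g.
Hypothesis clarke_le : forall z M, clarke g z M -> `|M| <= b.
Hypothesis clarke_det : forall z M, clarke g z M -> de <= `|\det (1%:M - D *m M)|.

Local Notation F := (closed_loop g D).

Let dmx_le z : differentiable g z -> `|dmx g z| <= b.
Proof. by move=> /clarke_dmx; exact: clarke_le. Qed.

Lemma global_lipschitz x y : `|g x - g y| <= p%:R * b * `|x - y|.
Proof.
have [->|xy] := eqVneq x y; first by rewrite !subrr !normr0 mulr0.
have v0 : x - y != 0 by rewrite subr_eq0.
have key (e : 'cV[R]_m) : (forall v : 'cV[R]_m, dotp e v <= `|v|) ->
    dotp e (g x - g y) <= p%:R * b * `|x - y|.
  move=> He; rewrite -{1}(subrKC y x).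
  apply: (@mean_value_differentiable R p m g y y (x - y) (`|x - y| + 1)) => //.
  - move=> z _ dz; apply: le_trans (He _) _; apply: le_trans (mulmx_norm_le _ _) _.
    by rewrite ler_wpM2r// ler_wpM2l// dmx_le.
  - by rewrite subrr normr0 ltr_wpDl.
  - by rewrite addrC addKr ltrDl.
apply/mx_normP => [|i j]; first by rewrite !mulr_ge0.
rewrite (ord1 j) ler_norml lerNl; apply/andP; split.
  have := key (- delta_mx i 0).
  rewrite dotpNl dotpC dotp_delta; apply => v; rewrite dotpNl dotpC dotp_delta.
  by rewrite (le_trans (ler_norm _))// normrN entry_le_norm.
have := key (delta_mx i 0); rewrite dotpC dotp_delta; apply => v.
by rewrite dotpC dotp_delta (le_trans (ler_norm _))// entry_le_norm.
Qed.

(** If it were empty, there would be no point of differentiability near [z], and the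
mean value inequality would hold with any constant, even a negative one. *)
Lemma clarke_nonempty z : clarke g z !=set0.
Proof.
apply: contrapT => nM.
have [r r0 Hr] := clarke_usc z dmx_le ltr01.
pose v : 'cV[R]_p := const_mx (r / 2).
have r2 : 0 < r / 2 by rewrite divr_gt0.
have vn : `|v| <= r / 2.
  by apply/mx_normP => [|i j]; rewrite ?mxE ?gtr0_norm// ltW.
have rr : r / 2 < r by rewrite ltr_pdivrMr// mulr_natr mulr2n ltrDl.
have v0 : v != 0.
  apply/eqP => /matrixP/(_ (Ordinal p_gt0) 0); rewrite !mxE => /eqP.
  by rewrite gt_eqF.
have := @mean_value_differentiable R p m g z z v r 0 (-1) g_lip _ _ _ v0.
rewrite -(scale0r (0 : 'cV[R]_m)) dotpZl mul0r lerNr oppr0 ler10 => H.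
suff: false by []; apply: H.
- move=> y yr dy; exfalso; apply: nM.
  by have [M cM _] := Hr y yr dy; exists M.
- by rewrite subrr normr0.
- by rewrite addrC addKr (le_lt_trans vn).
Qed.

Let be : R := 1 + m%:R * `|D| * b.
Let be0 : 0 <= be. Proof. by rewrite addr_ge0// !mulr_ge0. Qed.
Let c : R := expansion_const p be de.
Let c0 : 0 < c. Proof. exact: expansion_const_gt0. Qed.

Let loop_mx_le z M : clarke g z M -> `|1%:M - D *m M| <= be.
Proof.
move=> cM; rewrite (le_trans (ler_normB _ _))// lerD//.
  apply/mx_normP => // i j; rewrite mxE; case: (_ == _) => /=; by rewrite ?normr1 ?normr0.
by rewrite (le_trans (mulmx_norm_le _ _))// ler_wpM2l ?mulr_ge0//; exact: clarke_le cM.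
Qed.

Let p1 : 0 < 1 + p%:R :> R. Proof. by rewrite ltr_wpDr. Qed.

(* [Ga * e * `|w| * `|v|] bounds the error [dotp w (D *m E *m v)] for [`|E| <= e]; [Gac] is
   the distance to the Clarke derivative at which it uses up half of the margin. *)
Let Ga : R := 1 + p%:R * (p%:R * (m%:R * `|D|)).
Let Ga0 : 0 < Ga. Proof. by rewrite ltr_wpDr// !mulr_ge0. Qed.

Let bilinear_error (w v : 'cV[R]_p) (E : 'M[R]_(m, p)) e : `|E| <= e ->
  `|dotp w (D *m E *m v)| <= Ga * e * `|w| * `|v|.
Proof.
move=> Ee; have e0 : 0 <= e := le_trans (normr_ge0 _) Ee.
apply: le_trans (dotp_norm_le _ _) _.
apply: (@le_trans _ _ (p%:R * `|w| * (p%:R * (m%:R * `|D| * e) * `|v|))).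
  rewrite ler_wpM2l ?mulr_ge0// (le_trans (mulmx_norm_le _ _))// ler_wpM2r//.
  rewrite ler_wpM2l// (le_trans (mulmx_norm_le _ _))// ler_wpM2l// mulr_ge0//.
rewrite /Ga mulrDl mul1r !mulrDl.
rewrite (_ : p%:R * `|w| * _ = p%:R * (p%:R * (m%:R * `|D|)) * e * `|w| * `|v|); last by ring.
by rewrite lerDr !mulr_ge0.
Qed.

Let Gac : R := c / (4 * Ga).
Let Gac0 : 0 < Gac. Proof. by rewrite divr_gt0// mulr_gt0. Qed.

Let error_small (w v : 'cV[R]_p) : c * `|v| <= `|w| ->
  Ga * Gac * `|w| * `|v| <= dotp w w / 4.
Proof.
move=> wv; rewrite (_ : Ga * Gac = c / 4); last first.
  by rewrite /Gac; field; rewrite gt_eqF.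
rewrite (_ : _ * _ = `|w| * (c * `|v|) / 4); last by ring.
rewrite ler_pM2r ?invr_gt0// (le_trans _ (sqr_norm_le_dotp w))// expr2.
by rewrite ler_wpM2l.
Qed.

(** For [v = y - x], the vectors [(1 - D *m M) *m v] with [M] in the Clarke derivative
at [z] form a convex set at distance at least [c * |v|] from the origin, which a
vector [w] separates from it. By upper semicontinuity the derivatives at nearby
points are separated by the same [w] with half the margin, and the mean value
inequality integrates this to a lower bound of [dotp w (F y - F x)]. *)
Lemma closed_loop_expanding z : exists2 r, 0 < r &
  expanding_near F (c / (4 * (1 + p%:R))) z r.
Proof.
have [r r0 Hr] := clarke_usc z dmx_le Gac0.
exists r => // y x yr xr.
have [->|yx] := eqVneq y x; first by rewrite !subrr normr0 mulr0.
pose v := y - x; have v0 : v != 0 by rewrite subr_eq0.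
have v_gt0 : 0 < `|v| by rewrite normr_gt0.
pose K := [set (1%:M - D *m M) *m v | M in clarke g z].
have [w [Mw cMw wE] Kw] : exists2 w, K w & forall u, K u -> dotp w w / 2 <= dotp w u.
  apply: (@convex_separation _ _ K (c * `|v|) (p%:R * be * `|v|)).
  - have [M cM] := clarke_nonempty z.
    by exists ((1%:M - D *m M) *m v), M.
  - move=> _ _ s [M1 c1 <-] [M2 c2 <-] s0 s1.
    exists (s *: M1 + (1 - s) *: M2); first exact: convex_hull_comb.
    rewrite (mulmxDr D) -!scalemxAr; move: (D *m M1) (D *m M2) => X Y.
    rewrite !scalemxAl -mulmxDl; congr (_ *m _).
    by apply/matrixP => i j; rewrite !mxE; ring.
  - by rewrite mulr_gt0.
  - move=> _ [M cM <-]; apply: nonsingular_expansion => //; [exact: loop_mx_le cM|exact: clarke_det cM].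
  - move=> _ [M cM <-]; rewrite (le_trans (mulmx_norm_le _ _))// ler_wpM2r// ler_wpM2l//.
    exact: loop_mx_le cM.
have cw : c * `|v| <= `|w|.
  rewrite -wE; apply: nonsingular_expansion => //; [exact: loop_mx_le cMw|exact: clarke_det cMw].
have w0 : 0 < `|w| by rewrite (lt_le_trans _ cw)// mulr_gt0.
have mv : dotp (D^T *m w) (g (x + v) - g x) <= dotp w v - dotp w w / 4.
  apply: (@mean_value_differentiable R p m g z x v r) => //; last first.
    by rewrite /v subrKC.
  move=> q qr dq; rewrite dotp_trmx mulmxA.
  have [M cM Mq] := Hr q qr dq.
  have k1 := Kw ((1%:M - D *m M) *m v) (ex_intro2 _ _ M cM erefl).
  rewrite mulmxBl mul1mx dotpBr in k1.
  have k2 := bilinear_error w v (ltW Mq).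
  have k3 := error_small cw.
  have k4 : dotp w (D *m (dmx g q - M) *m v) = dotp w (D *m dmx g q *m v) - dotp w (D *m M *m v).
    by rewrite -dotpBr (mulmxBr D) mulmxBl.
  rewrite k4 in k2; have k5 := le_trans (ler_norm _) (le_trans k2 k3).
  move: k1 k5; lra.
have fin : dotp w w / 4 <= dotp w (F y - F x).
  move: mv; rewrite dotp_trmx /v subrKC mulmxBr => mv.
  rewrite /closed_loop (_ : _ - _ = (y - x) - (D *m g y - D *m g x)); last first.
    by apply/colP => i; rewrite !mxE; ring.
  rewrite dotpBr; lra.
have k1 := le_trans fin (le_trans (ler_norm _) (dotp_norm_le _ _)).
have k2 := sqr_norm_le_dotp w.
have k3 : `|w| * `|w| <= `|w| * (4 * (1 + p%:R) * `|F y - F x|).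
  have k4 : 0 <= `|w| * `|F y - F x| by rewrite mulr_ge0.
  rewrite expr2 in k2; move: k1 k2 k4; lra.
rewrite ler_pM2l// in k3.
have k4 := le_trans cw k3.
rewrite mulrAC ler_pdivrMr ?mulr_gt0//.
by rewrite [leRHS]mulrC.
Qed.

Let La : R := 1 + m%:R * `|D| * (p%:R * b).

Let F_lip x y : `|F x - F y| <= La * `|x - y|.
Proof. exact: closed_loop_lip global_lipschitz _ _. Qed.

(** With [e = F z - w], separate the vectors [(1 - D *m M)^T *m e] from the origin by a
vector [u]: along [- u] the squared distance to [w] decreases at a rate of at least
[dotp u u / 2], up to an error of second order. *)
Lemma closed_loop_descent z w : F z <> w -> forall rho, 0 < rho ->
  exists2 z', `|z' - z| < rho & sqdist F w z' < sqdist F w z.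
Proof.
move=> Fzw rho rho0; pose e := F z - w.
have e0 : 0 < `|e| by rewrite normr_gt0 subr_eq0; apply/eqP.
pose N M : 'M[R]_p := 1%:M - D *m M.
pose K := [set (N M)^T *m e | M in clarke g z].
have Kexp M : clarke g z M -> c * `|e| <= `|(N M)^T *m e|.
  move=> cM; apply: nonsingular_expansion => //.
    apply/mx_normP => // i j; rewrite mxE.
    exact: le_trans (entry_le_norm _ _ _) (loop_mx_le cM).
  by rewrite det_tr; exact: clarke_det cM.
have [u [Mu cMu uE] Ku] : exists2 w, K w & forall u, K u -> dotp w w / 2 <= dotp w u.
  apply: (@convex_separation _ _ K (c * `|e|) (p%:R * be * `|e|)).
  - have [M cM] := clarke_nonempty z.
    by exists ((N M)^T *m e), M.
  - move=> _ _ s [M1 c1 <-] [M2 c2 <-] s0 s1.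
    exists (s *: M1 + (1 - s) *: M2); first exact: convex_hull_comb.
    rewrite !scalemxAl -mulmxDl; congr (_ *m _).
    rewrite /N mulmxDr -!scalemxAr.
    move: (D *m M1) (D *m M2) => X Y; apply/matrixP => i j; rewrite !mxE; ring.
  - by rewrite mulr_gt0.
  - by move=> _ [M cM <-]; exact: Kexp.
  - move=> _ [M cM <-]; rewrite (le_trans (mulmx_norm_le _ _))// ler_wpM2r// ler_wpM2l//.
    apply/mx_normP => // i j; rewrite mxE.
    exact: le_trans (entry_le_norm _ _ _) (loop_mx_le cM).
have ceu : c * `|e| <= `|u| by rewrite -uE; exact: Kexp.
have u0 : 0 < `|u| by rewrite (lt_le_trans _ ceu)// mulr_gt0.
have uu0 : 0 < dotp u u by rewrite (lt_le_trans _ (sqr_norm_le_dotp u))// exprn_gt0.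
have [r r0 Hr] := clarke_usc z dmx_le Gac0.
pose Q := p%:R * (La * `|u|) ^+ 2.
have Q0 : 0 <= Q by rewrite mulr_ge0// sqr_ge0.
have Q1 : 0 < 1 + Q by rewrite ltr_wpDr.
(* The step length: within the radii [rho] and [r], and small enough for the second
   order term to be less than the gain. *)
pose t0 := Num.min 1 (Num.min (Num.min rho r / `|u|) (dotp u u / 2 / (1 + Q))).
pose t := t0 / 2.
have t00 : 0 < t0.
  by rewrite !lt_min ltr01 !divr_gt0// lt_min rho0.
have t_gt0 : 0 < t by rewrite divr_gt0.
have tt0 : t < t0 by rewrite ltr_pdivrMr// mulr_natr mulr2n ltrDl.
move: (tt0); rewrite !lt_min => /and3P[t1 + tQ].
rewrite ltr_pdivlMr// lt_min => /andP[trho tr].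
pose v := - (t *: u).
have nv : `|v| = t * `|u| by rewrite normrN normrZ gtr0_norm.
have v0 : v != 0 by rewrite -normr_eq0 nv gt_eqF// mulr_gt0.
have mv : dotp (- (D^T *m e)) (g (z + v) - g z) <= - (t * (dotp u u / 4)) - dotp e v.
  apply: (@mean_value_differentiable R p m g z z v r) => //; last 2 first.
    by rewrite subrr normr0.
    by rewrite addrC addKr nv.
  move=> q qr dq; rewrite dotpNl dotp_trmx mulmxA.
  have [M cM Mq] := Hr q qr dq.
  have k1 := Ku ((N M)^T *m e) (ex_intro2 _ _ M cM erefl).
  rewrite dotpC dotp_trmx /N mulmxBl mul1mx dotpBr in k1.
  have k2 := bilinear_error e u (ltW Mq).
  have k3 := error_small ceu.
  have k4 : dotp e (D *m (dmx g q - M) *m u) = dotp e (D *m dmx g q *m u) - dotp e (D *m M *m u).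
    by rewrite -dotpBr (mulmxBr D) mulmxBl.
  rewrite k4 -mulrA (mulrC `|e|) mulrA in k2; have k5 := le_trans (ler_norm _) (le_trans k2 k3).
  rewrite /v mulmxN -scalemxAr !dotpNr !dotpZr opprK.
  suff k6 : dotp e (D *m dmx g q *m u) <= dotp e u - dotp u u / 4.
    have := ler_wpM2l (ltW t_gt0) k6; lra.
  move: k1 k5; lra.
pose dF := F (z + v) - F z.
have fin : dotp e dF <= - (t * (dotp u u / 4)).
  move: mv; rewrite dotpNl dotp_trmx mulmxBr => mv.
  rewrite /dF /closed_loop (_ : _ - _ = v - (D *m g (z + v) - D *m g z)); last first.
    by apply/colP => i; rewrite !mxE; ring.
  rewrite dotpBr; lra.
exists (z + v); first by rewrite addrC addKr nv.
rewrite /sqdist (_ : F (z + v) - w = e + dF); last first.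
  by rewrite /e /dF; apply/colP => i; rewrite !mxE; ring.
rewrite -/e (dotp_sqrD e dF).
have dFn : dotp dF dF <= t * t * Q.
  apply: le_trans (dotp_le_sqr_norm _) _.
  rewrite (_ : t * t * Q = p%:R * (La * `|v|) ^+ 2); last by rewrite /Q nv; ring.
  rewrite ler_wpM2l// lerXn2r ?nnegrE ?mulr_ge0 ?addr_ge0 ?mulr_ge0//.
  rewrite (le_trans (F_lip _ _))//.
  by rewrite addrC addKr.
rewrite ltr_pdivlMr// in tQ.
have := mulr_gt0 t_gt0 uu0; have := ler_wpM2l (ltW t_gt0) (ltW tQ).
have tt : 0 < t * t by rewrite mulr_gt0.
move: fin dFn; rewrite mulrDr mulr1 => k1 k2 k3 k4.
lra.
Qed.

Theorem closed_loop_expansion x y :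
  c / (4 * (1 + p%:R)) * `|x - y| <= `|F x - F y|.
Proof.
apply: (global_expansion _ F_lip closed_loop_expanding closed_loop_descent).
by rewrite divr_gt0// mulr_gt0.
Qed.

Theorem closed_loop_surjective w : exists z, F z = w.
Proof.
apply: (global_surjective _ F_lip closed_loop_expanding closed_loop_descent).
by rewrite divr_gt0// mulr_gt0.
Qed.

End feedback.

(** * Measurable solutions and primitives *)

Section countable_quantifiers.
Context d (T : measurableType d) (D : set T).
Hypothesis mD : measurable D.

Lemma measurable_ex (I : countType) (F : I -> set T) :
  (forall i, measurable (D `&` F i)) -> measurable (D `&` [set t | exists i, F i t]).
Proof.
move=> mF; rewrite (_ : _ `&` _ = \bigcup_i (D `&` F i)).
  by apply: countable_bigcupT_measurable.
by apply/seteqP; split => [t /= [Dt [i Ft]]|t [i _ [Dt Ft]]]; [exists i|split => //; exists i].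
Qed.

Lemma measurable_not (F : set T) :
  measurable (D `&` F) -> measurable (D `&` ~` F).
Proof.
move=> mF; rewrite (_ : _ `&` _ = D `\` (D `&` F)); first exact: measurableD.
by apply/seteqP; split => [t [Dt nF]|t [Dt nF]]; split => //; [case|move=> Ft; apply: nF].
Qed.

Lemma measurable_all (I : countType) (F : I -> set T) :
  (forall i, measurable (D `&` F i)) -> measurable (D `&` [set t | forall i, F i t]).
Proof.
move=> mF; rewrite (_ : mkset _ = ~` [set t | exists i, (~` F i) t]).
  by apply/measurable_not/measurable_ex => i; exact: measurable_not.
apply/seteqP; split => [t H [i nF]|t H i]; first exact: nF.
by apply: contrapT => nF; apply: H; exists i.
Qed.

Lemma measurable_fun_rays (R : realType) (h : T -> R) :
  (forall a : R, measurable (D `&` [set t | a < h t])) -> measurable_fun D h.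
Proof.
move=> H _; apply: (measurability _ (RGenOInfty.measurableE R)) => //.
move=> /= _ [_ [x ->] <-].
rewrite (_ : _ `&` _ = D `&` [set t | x < h t])//.
by apply/seteqP; split => t [Dt]; rewrite /= in_itv/= andbT.
Qed.

Lemma measurable_fun_ge (R : realType) (h : T -> R) (a : R) :
  measurable_fun D h -> measurable (D `&` [set t | a <= h t]).
Proof.
move=> mh; rewrite (_ : mkset _ = h @^-1` `[a, +oo[%classic).
  by apply: mh => //; exact: measurable_itv.
by apply/seteqP; split => t; rewrite /= in_itv/= andbT.
Qed.

Lemma measurable_fun_norm_le (R : realType) (h : T -> R) (a : R) :
  measurable_fun D h -> measurable (D `&` [set t | `|h t| <= a]).
Proof.
move=> mh; rewrite (_ : mkset _ = h @^-1` `[- a, a]%classic).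
  by apply: mh => //; exact: measurable_itv.
by apply/seteqP; split => t; rewrite /= in_itv/= ler_norml.
Qed.

End countable_quantifiers.

Section implicit_measurable.
Context (R : realType) d (T : measurableType d) (D : set T).
Hypothesis mD : measurable D.
Variables (p q : nat) (phi : T -> 'cV[R]_p -> 'cV[R]_q) (w : T -> 'cV[R]_q).
Variables (psi : T -> 'cV[R]_p -> R) (u : T -> 'cV[R]_p).
Hypothesis phi_meas : forall z i, measurable_fun D (fun t => phi t z i 0).
Hypothesis w_meas : forall i, measurable_fun D (fun t => w t i 0).
Hypothesis psi_meas : forall z, measurable_fun D (fun t => psi t z).
Hypothesis near_sol : forall t, D t -> forall e : R, 0 < e -> exists2 de : R, 0 < de &
  forall z, `|z - u t| < de -> `|phi t z - w t| <= e.
Hypothesis sol_near : forall t, D t -> forall e : R, 0 < e -> exists2 de : R, 0 < de &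
  forall z, `|phi t z - w t| <= de -> `|z - u t| < e.
Hypothesis psi_cont : forall t, D t -> forall e : R, 0 < e -> exists2 de : R, 0 < de &
  forall z, `|z - u t| < de -> `|psi t z - psi t (u t)| <= e.

(** Here [u t] is the solution of [phi t (u t) = w t]. A lower bound of [psi t (u t)]
can be tested on rational approximate solutions, of which there are countably many,
because approximate solutions are close to [u t] and conversely. *)
Lemma implicit_measurable : measurable_fun D (fun t => psi t (u t)).
Proof.
apply: (measurable_fun_rays mD) => a.
rewrite (_ : D `&` _ = D `&` [set t | exists n : nat, forall m : nat,
   exists z : 'cV[rat]_p, (forall i, `|phi t (ratv R z) i 0 - w t i 0| <= m.+1%:R^-1) /\
     a + n.+1%:R^-1 <= psi t (ratv R z)]).
  apply: measurable_ex => n; apply: (measurable_all mD) => m; apply: measurable_ex => z.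
  rewrite (_ : D `&` _ = (D `&` [set t | forall i, `|phi t (ratv R z) i 0 - w t i 0| <= m.+1%:R^-1])
     `&` (D `&` [set t | a + n.+1%:R^-1 <= psi t (ratv R z)])); last first.
    by apply/seteqP; split => [t [Dt [h1 h2]]|t [[Dt h1] [_ h2]]].
  apply: measurableI; last exact: (measurable_fun_ge mD).
  apply: (measurable_all mD) => i; apply: (measurable_fun_norm_le mD).
  exact: measurable_funB.
apply/seteqP; split => t [Dt] /=.
  move=> apsi; split => //.
  have e0 : 0 < (psi t (u t) - a) / 2 by rewrite divr_gt0// subr_gt0.
  have [n ne] := natSinv_small e0; exists n => m.
  have [d1 d10 H1] := psi_cont Dt e0.
  have [d2 d20 H2] := near_sol Dt (natSinv_gt0 R m).
  have min0 : 0 < Num.min d1 d2 by rewrite lt_min d10.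
  have [z] := ratv_dense (u t) min0; rewrite distrC lt_min => /andP[z1 z2].
  exists z; split.
    move=> i; have := le_trans (entry_le_norm _ i 0) (H2 _ z2).
    by rewrite !mxE.
  have := H1 _ z1; rewrite ler_norml => /andP[k1 _].
  move: k1 ne; move: (n.+1%:R^-1 : R) => c; lra.
move=> [n Hn]; split => //.
have n0 := natSinv_gt0 R n.
have n20 : 0 < n.+1%:R^-1 / 2 :> R by rewrite divr_gt0.
have [d1 d10 H1] := psi_cont Dt n20.
have [d2 d20 H2] := sol_near Dt d10.
have [m md] := natSinv_small d20.
have [z [z1 z2]] := Hn m.
have : `|phi t (ratv R z) - w t| <= d2.
  apply/mx_normP => [|i j]; first exact: ltW.
  by rewrite (ord1 j) !mxE (le_trans (z1 i))// ltW.
move=> /H2/H1; rewrite ler_norml => /andP[_ k1].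
move: z2 k1 n0; move: (n.+1%:R^-1 : R) => c; lra.
Qed.

End implicit_measurable.

Lemma borel_leb_measurable (R : realType) (A : set R) :
  @measurable _ (measurableTypeR R) A -> @measurable _ (lebR R) A.
Proof. by move=> mA; exact: sub_caratheodory. Qed.

Lemma measurable_fun_borel_leb (R : realType) (h : R -> R) :
  measurable_fun (setT : set (measurableTypeR R)) h ->
  measurable_fun (setT : set (lebR R)) h.
Proof. by move=> mh _ B mB; apply: borel_leb_measurable; exact: mh. Qed.

Lemma continuous_leb_measurable (R : realType) (h : R -> R) :
  continuous h -> measurable_fun (setT : set (lebR R)) h.
Proof.
by move=> ch; apply: measurable_fun_borel_leb; exact: continuous_measurable_fun.
Qed.

(** Each rational level set of [h] is Borel up to a null set; outside the union of
these countably many null sets, they determine [h]. *)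
Lemma borel_modification (R : realType) (h : R -> R) :
  measurable_fun (setT : set (lebR R)) h ->
  exists N : set R, [/\ @measurable _ (measurableTypeR R) N,
    (@lebesgue_measure R).-negligible N &
    measurable_fun (setT : set (measurableTypeR R)) (fun t => if t \in N then 0 else h t)].
Proof.
move=> mh.
have level (q : rat) : exists XM : set R * set R,
    [/\ @measurable _ (measurableTypeR R) XM.1, @measurable _ (measurableTypeR R) XM.2,
      @lebesgue_measure R XM.2 = 0%E & forall t, ~ XM.2 t -> (ratr q < h t) <-> XM.1 t].
  have mS : @measurable _ (lebR R) [set t | ratr q < h t].
    rewrite (_ : mkset _ = setT `&` h @^-1` `]ratr q, +oo[%classic).
      by apply: mh => //; exact: measurable_itv.
    by apply/seteqP; split => t; rewrite /= in_itv/= andbT // => -[].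
  have : (completed_algebra_gen (@lebesgue_measure R)) [set t | ratr q < h t].
    by rewrite -g_sigma_completed_algebra_genE completed_caratheodory_measurable.
  move=> [X mX [N [M [mM M0 NM]] XNS]]; exists (X, M); split => //= t nMt.
  have SE : (ratr q < h t) = (X `|` N) t :> Prop by rewrite XNS.
  by rewrite SE; split => [[//|/NM]|]; [|left].
have [XM HXM] := choice level.
pose N := [set t | exists q, (XM q).2 t].
have mN : @measurable _ (measurableTypeR R) N.
  rewrite -[N]setTI; apply: measurable_ex => q; rewrite setTI.
  by have [] := HXM q.
have Nq q t : ~ N t -> ~ (XM q).2 t by move=> nN Mt; apply: nN; exists q.
exists N; split => //.
  apply: negligible_bigcup_countType => q.
  by have [? ? ? ?] := HXM q; exists (XM q).2; split.
apply: (measurable_fun_rays measurableT) => a; rewrite setTI.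
pose Y (q : rat) : set R := if (a < ratr q) then (XM q).1 else set0.
rewrite (_ : mkset _ = ((if a < 0 then N else set0) `|` ((~` N) `&` [set t | exists q, Y q t]))).
  apply: measurableU; first by case: ifP.
  apply: measurable_ex => q; apply: measurableI; first exact: measurableC.
  by rewrite /Y; case: ifP => // _; have [] := HXM q.
apply/seteqP; split => t /=.
  case: ifPn => tN; first by move=> a0; left; rewrite a0; rewrite inE in tN.
  move=> ah; right; have nN : ~ N t by move/negP: tN; rewrite inE.
  split => //; have [q] := rat_in_itvoo ah; rewrite in_itv/= => /andP[aq qh].
  exists q; rewrite /Y aq; have [_ _ _ /(_ t (Nq q t nN))[H _]] := HXM q.
  exact: H.
move=> [|[nN [q]]].
  by case: ifP => // a0 Nt; rewrite mem_set.
rewrite /Y; case: ifP => // aq Xt; rewrite memNset//.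
apply: lt_trans aq _; have [_ _ _ /(_ t (Nq q t nN))[_]] := HXM q.
exact.
Qed.

(** [Phi] is the indefinite integral of a Borel function that equals [h] almost
everywhere. Only its Lipschitz bounds and its derivative are used later, so that no
integral appears in the treatment of the differential equation. *)
Lemma exists_primitive (R : realType) (h : R -> R) (a : R) :
  measurable_fun (setT : set (lebR R)) h ->
  (forall b, exists M, forall t, `|t| <= b -> `|h t| <= M) ->
  exists Phi : R -> R, [/\ Phi a = 0,
    forall b, exists M, lip_on a b M Phi &
    {ae @lebesgue_measure R, forall t, a < t -> is_derive t (1 : R) Phi (h t)}].
Proof.
move=> mh hb; have [N [mN nN mg]] := borel_modification mh.
set g := (fun t => _) in mg.
have gb b : exists M, 0 <= M /\ forall t, `|t| <= b -> `|g t| <= M.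
  have [M HM] := hb b; exists (Num.max M 0); split; first by rewrite le_max lexx orbT.
  move=> t tb; rewrite /g le_max; case: ifP => _; first by rewrite normr0 lexx orbT.
  by rewrite HM.
have mgS (A : set R) : measurable_fun (A : set (measurableTypeR R)) g.
  exact: measurable_funS mg.
have intg x y : (@lebesgue_measure R).-integrable [set` `]x, y]] (EFin \o g).
  have [M [M0 HM]] := gb (Num.max `|x| `|y|).
  apply: measurable_bounded_integrable => //.
  - suff : (@lebesgue_measure R `]x, y]%classic < +oo)%E by [].
    by rewrite lebesgue_measure_itv/=; case: ifP => _; rewrite ?ltry// -EFinD ltry.
  - exists M; split; first exact: num_real.
    move=> K MK t /=; rewrite in_itv/= => /andP[xt ty].
    rewrite (le_trans _ (ltW MK))// HM// ler_norml le_max.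
    have h1 := ler_norm (- x); have h2 := ler_norm y; rewrite normrN in h1.
    apply/andP; split; last by rewrite (le_trans ty h2) orbT.
    rewrite lerNl (le_trans _ (_ : `|x| <= _)) ?le_max ?lexx// (le_trans _ h1)//.
    by rewrite lerN2 ltW.
have locg : locally_integrable setT g.
  split => //; first exact: openT.
  move=> K _ cK; have [M [_ HM]] := compact_bounded cK.
  pose B := 1 + `|M|.
  have KB t : K t -> `|t| <= B.
    by apply: HM; rewrite /B (le_lt_trans (ler_norm M))// ltrDr.
  have intK : (@lebesgue_measure R).-integrable K (EFin \o g).
    apply: integrableS (intg (- B - 1) B) => //; first exact: compact_measurable.
    move=> t /KB; rewrite ler_norml /= in_itv/= => /andP[h1 ->]; rewrite andbT.
    by rewrite (lt_le_trans _ h1)// ltrBlDr ltrDl.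
  by have /integrableP[] := intK.
pose Phi x := (\int[@lebesgue_measure R]_(t in `]a, x]) g t)%R.
exists Phi; split.
- by rewrite /Phi set_itv_ge ?bnd_simp ?ltxx// Rintegral_set0.
- move=> b; have [M [M0 HM]] := gb (Num.max `|a| `|b|).
  exists M => s t as_ st tb.
  have -> : Phi t - Phi s = (\int[@lebesgue_measure R]_(y in `]s, t]) g y)%R.
    by rewrite /Phi Rintegral_itvB//; rewrite bnd_simp.
  apply: le_trans (le_normr_Rintegral _ _) _ => //.
  apply: (@le_trans _ _ (\int[@lebesgue_measure R]_(y in `]s, t]) M)%R).
    apply: le_Rintegral => //.
    + exact: (integrable_norm (intg s t)).
    + apply: measurable_bounded_integrable => //.
      * suff : (@lebesgue_measure R `]s, t]%classic < +oo)%E by [].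
        by rewrite lebesgue_measure_itv/=; case: ifP => _; rewrite ?ltry// -EFinD ltry.
      * exists M; split; first exact: num_real.
        by move=> K MK y _ /=; rewrite (ger0_norm M0) ltW.
    + move=> y; rewrite /= in_itv/= => /andP[sy yt]; apply: HM.
      rewrite ler_norml le_max; apply/andP; split.
        rewrite lerNl (le_trans _ (_ : `|a| <= _)) ?le_max ?lexx//.
        rewrite -(normrN a) (le_trans _ (ler_norm (- a)))//.
        by rewrite lerN2 (le_trans as_)// ltW.
      by rewrite (le_trans yt (le_trans tb (ler_norm b))) orbT.
  rewrite Rintegral_cst// (_ : fine _ = t - s)//.
  suff mE : @lebesgue_measure R `]s, t]%classic = (t - s)%:E by exact: (congr1 fine mE).
  rewrite lebesgue_measure_itv/= lte_fin; case: ltgtP st => // -> _.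
  by rewrite subrr.
- have H := FTC1 (a := BRight a) (fun y => intg a y) locg.
  have {}H : {ae @lebesgue_measure R, forall t, a < t -> is_derive t (1 : R) Phi (g t)}.
    apply: (aeS H) => t Ht at_; have [dP <-] := Ht at_.
    by rewrite derive1E; exact: derivableP.
  have nN' : {ae @lebesgue_measure R, forall t, ~ N t}.
    by apply: negligibleS nN => t /= /contrapT.
  apply: (aeS (aeI H nN')) => t [Ht nNt] at_.
  have := Ht at_; rewrite /g memNset//.
Qed.

(** * Gronwall's lemma *)

Lemma ac_increment_abs_le (R : realType) (a b c : R) (phi dphi : R -> R) :
  a <= b -> ac a b phi ->
  {ae @lebesgue_measure R, forall t, a < t -> t < b ->
     is_derive t (1 : R) phi (dphi t) /\ `|dphi t| <= c} ->
  `|phi b - phi a| <= c * (b - a).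
Proof.
move=> ab acf aed; rewrite ler_norml lerNl; apply/andP; split.
  pose psi t := 0 - phi t.
  have ac0 : ac a b (fun=> 0) by apply: (@lip_on_ac _ _ _ 0) => s t _ _ _; rewrite subrr normr0 mul0r.
  have := @ac_increment_le _ a b c psi (fun t => - dphi t) ab (acB ac0 acf).
  rewrite /psi !sub0r opprK => H.
  rewrite opprB addrC; apply: H; apply: (aeS aed) => t Ht at_ tb; have [d1 d2] := Ht at_ tb.
  split; last by rewrite (le_trans (ler_norm _))// normrN.
  by have -> : (fun t => 0 - phi t) = - phi by [apply/funext => s; rewrite sub0r]; exact: is_deriveN.
apply: (ac_increment_le ab acf (dphi := dphi)); apply: (aeS aed) => t Ht at_ tb.
by have [d1 d2] := Ht at_ tb; split => //; rewrite (le_trans (ler_norm _)).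
Qed.

Lemma ac_uniform (R : realType) (a b : R) (phi : R -> R) (e : R) :
  ac a b phi -> 0 < e -> exists2 d, 0 < d &
    forall s t, a <= s -> s <= t -> t <= b -> t - s < d -> `|phi t - phi s| < e.
Proof.
move=> acf e0; have [d d0 Hd] := acf e e0; exists d => // s t as_ st tb std.
have := Hd [:: (s, t)]; rewrite !big_seq1/=; apply => //.
by move=> p; rewrite inE => /eqP->.
Qed.

Section zero_solution.
Variables (R : realType) (n : nat) (z : R -> 'cV[R]_n) (a b L : R).
Variable dz : R -> 'cV[R]_n.
Hypothesis L0 : 0 <= L.
Hypothesis z_ac : forall i, ac a b (fun t => z t i 0).
Hypothesis z_a : z a = 0.
Hypothesis z_der : {ae @lebesgue_measure R, forall t, a < t -> t < b -> forall i,
  is_derive t (1 : R) (fun s => z s i 0) (dz t i 0) /\ `|dz t i 0| <= L * `|z t|}.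

Let z_bounded : a <= b -> exists M, forall t, a <= t -> t <= b -> `|z t| <= M.
Proof.
move=> ab.
have [d d0 Hd] : exists2 d, 0 < d & forall i s t, a <= s -> s <= t -> t <= b -> t - s < d ->
    `|z t i 0 - z s i 0| < 1.
  have [|i|d d0 Hd] := @exists_common_radius R n (fun i d => forall s t, a <= s -> s <= t -> t <= b ->
     t - s < d -> `|z t i 0 - z s i 0| < 1).
  - by move=> i r r' Hr _ r'r s t h1 h2 h3 h4; apply: Hr => //; exact: lt_le_trans r'r.
  - exact: ac_uniform.
  - by exists d.
have d2 : 0 < d / 2 by rewrite divr_gt0.
apply: (gauge_induction (d := fun=> d / 2) (P := fun y => exists M, forall t, a <= t -> t <= y -> `|z t| <= M) ab) => //.
  by exists 0 => t at_ ta; rewrite (_ : t = a) ?z_a ?normr0//; apply: le_anti; rewrite at_ ta.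
move=> x t y ax xt ty yb tx yt [M HM].
exists (M + 1) => s as_ sy; have [sx|xs] := leP s x.
  by rewrite (le_trans (HM s as_ sx))// lerDl.
have Mx := HM x ax (lexx x).
apply/mx_normP => [|i j]; first by rewrite (le_trans _ (lerD Mx (lexx 1)))// addr_ge0.
have sd : s - x < d by lra.
have := Hd i x s ax (ltW xs) (le_trans sy yb) sd.
have := le_trans (entry_le_norm (z x) i 0) Mx.
rewrite (ord1 j) ler_norml ltr_norml ler_norml => /andP[k1 k2] /andP[k3 k4].
apply/andP; split; lra.
Qed.

(** Gronwall's lemma: on a step so short that [L] times its length is at most 1/2, a
bound of [z] that holds on the step may be halved, again and again, if [z] vanishes
at its left end. *)
Lemma zero_solution : forall t, a <= t -> t <= b -> z t = 0.
Proof.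
move=> t at_ tb; have ab : a <= b := le_trans at_ tb.
have [M HM] := z_bounded ab.
pose d := (4 * (1 + L))^-1.
have L1 : 0 < 1 + L by rewrite ltr_wpDr.
have d0 : 0 < d by rewrite invr_gt0 mulr_gt0.
have dL : L * (2 * d) <= 1 / 2.
  by rewrite mulrA /d ler_pdivrMr ?mulr_gt0//; lra.
suff H : forall s, a <= s -> s <= b -> z s = 0 by exact: H.
apply: (gauge_induction (d := fun=> d) (P := fun y => forall s, a <= s -> s <= y -> z s = 0) ab) => //.
  by move=> s as_ sa; rewrite (_ : s = a)//; apply: le_anti; rewrite as_ sa.
move=> x u y ax xu uy yb ux yu zx.
have yx : y - x <= 2 * d by lra.
have xy : x <= y := le_trans xu uy.
have half j : forall s, a <= s -> s <= y -> `|z s| <= `|M| / 2 ^+ j.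
  elim: j => [s as_ sy|j IH s as_ sy].
    by rewrite expr0 divr1 (le_trans _ (ler_norm M))// HM// (le_trans sy).
  have [sx|xs] := leP s x; first by rewrite zx// normr0 divr_ge0// exprn_ge0.
  have c0 : 0 <= `|M| / 2 ^+ j by rewrite divr_ge0// exprn_ge0.
  apply/mx_normP => [|i l]; first by rewrite divr_ge0// exprn_ge0.
  have := @ac_increment_abs_le R x s (L * (`|M| / 2 ^+ j)) (fun t => z t i 0) (fun t => dz t i 0) (ltW xs) _ _.
  rewrite (zx x ax (lexx x)) mxE subr0 (ord1 l) => H.
  apply: le_trans (H _ _) _.
  - exact: (ac_sub ax (le_trans sy yb) (z_ac i)).
  - apply: (aeS z_der) => v Hv xv vs.
    have av : a < v by exact: le_lt_trans ax xv.
    have vb : v < b by rewrite (lt_le_trans vs)// (le_trans sy).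
    have [h1 h2] := Hv av vb i; split => //; rewrite (le_trans h2)// ler_wpM2l//.
    by rewrite IH// ltW// (lt_le_trans vs).
  rewrite mulrAC (_ : `|M| / 2 ^+ j.+1 = 2^-1 * (`|M| / 2 ^+ j)); last first.
    by rewrite exprS invfM mulrCA.
  rewrite ler_wpM2r//.
  apply: (@le_trans _ _ (L * (2 * d))); last by lra.
  by rewrite ler_wpM2l//; lra.
move=> s as_ sy; apply/eqP; rewrite -normr_eq0 eq_le normr_ge0 andbT.
apply/ler_addgt0Pr => e e0; rewrite add0r.
have M1 : 0 < 1 + `|M| by rewrite ltr_wpDr.
have [j je] := natSinv_small (divr_gt0 e0 M1).
apply: le_trans (half j s as_ sy) _.
apply: (@le_trans _ _ ((1 + `|M|) * j.+1%:R^-1)); last first.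
  by rewrite mulrC -ler_pdivlMr// ltW.
rewrite ler_pM ?invr_ge0 ?exprn_ge0// ?lerDr// lef_pV2 ?posrE ?exprn_gt0//.
by rewrite -natrX ler_nat; exact: ltn_expl.
Qed.

End zero_solution.

(** * Picard iteration *)

Lemma pow_half_small (R : realType) (C e : R) : 0 < e -> exists j : nat, C / 2 ^+ j < e.
Proof.
move=> e0; have C1 : 0 < 1 + `|C| by rewrite ltr_wpDr.
have [j je] := natSinv_small (divr_gt0 e0 C1); exists j.
apply: (@le_lt_trans _ _ ((1 + `|C|) * j.+1%:R^-1)); last by rewrite mulrC -ltr_pdivlMr.
apply: (@le_trans _ _ ((1 + `|C|) / 2 ^+ j)).
  by rewrite ler_wpM2r ?invr_ge0 ?exprn_ge0// (le_trans (ler_norm C))// lerDr.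
rewrite ler_wpM2l ?(ltW C1)// lef_pV2 ?posrE ?exprn_gt0//.
by rewrite -natrX ler_nat; exact: ltn_expl.
Qed.

Lemma le_of_pow_half (R : realType) (x y C : R) :
  (forall j, x <= y + C / 2 ^+ j) -> x <= y.
Proof.
move=> H; apply/ler_addgt0Pr => e e0; have [j je] := pow_half_small C e0.
by rewrite (le_trans (H j))// lerD2l ltW.
Qed.

Lemma geometric_limit (R : realType) (n : nat) (x : nat -> R -> 'cV[R]_n) :
  (forall b, exists C, forall j t, t <= b -> `|x j.+1 t - x j t| <= C / 2 ^+ j) ->
  exists y : R -> 'cV[R]_n, forall b, exists C, forall j t, t <= b ->
    `|x j t - y t| <= C / 2 ^+ j.
Proof.
move=> H.
have cauchy b : exists C, forall j l t, t <= b -> `|x (j + l)%N t - x j t| <= 2 * C / 2 ^+ j.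
  have [C HC] := H b; exists C => j l t tb.
  have C0 : 0 <= C by have := HC 0 t tb; rewrite expr0 divr1; apply: le_trans.
  suff : `|x (j + l)%N t - x j t| <= 2 * C / 2 ^+ j - 2 * C / 2 ^+ (j + l).
    move=> /le_trans; apply; rewrite lerBlDr lerDl.
    by rewrite divr_ge0 ?mulr_ge0// exprn_ge0.
  elim: l => [|l IH]; first by rewrite addn0 !subrr normr0.
  rewrite addnS -(subrKA (x (j + l)%N t)) (le_trans (ler_normD _ _))//.
  rewrite (le_trans (lerD (HC _ t tb) IH))// exprS invfM.
  have -> : 2 * C * (2^-1 * (2 ^+ (j + l))^-1) = C / 2 ^+ (j + l) by field; rewrite expf_neq0.
  lra.
have lim t i : exists l, forall j, `|x j t i 0 - l| <= 2 * sval (cid (cauchy t)) / 2 ^+ j.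
  case: cid => C HC /=; apply: approx_limit => j k.
  wlog jk : j k / (j <= k)%N => [W|].
    have [jk|/ltnW kj] := leqP j k; first exact: W.
    by rewrite distrC [leRHS]addrC; exact: W.
  have := entry_le_norm (x (j + (k - j))%N t - x j t) i 0; rewrite subnKC// !mxE distrC.
  move=> /le_trans; apply; rewrite -[in leLHS](subnKC jk) (le_trans (HC j _ t (lexx t)))// lerDl.
  have := HC k 0%N t (lexx t); rewrite addn0 subrr normr0 => -> //.
have [y Hy] := choice (fun ti : R * 'I_n => lim ti.1 ti.2).
exists (fun t => \col_i y (t, i)) => b; have [C HC] := cauchy b.
exists (2 * C) => j t tb.
have C0 : 0 <= 2 * C / 2 ^+ j by have := HC j 0%N t tb; rewrite addn0 subrr normr0.
apply/mx_normP => // i l; rewrite (ord1 l) !mxE.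
apply: (@le_of_pow_half _ _ _ (2 * sval (cid (cauchy t)))) => k.
rewrite -(subrKA (x (j + k)%N t i 0)) (le_trans (ler_normD _ _))// lerD//.
  have := entry_le_norm (x (j + k)%N t - x j t) i 0; rewrite !mxE distrC => /le_trans; apply.
  exact: HC.
have := Hy (t, i) (j + k)%N => /= /le_trans; apply.
have S0 : 0 <= 2 * sval (cid (cauchy t)).
  have := Hy (t, i) 0%N => /=; rewrite expr0 divr1; apply: le_trans; exact: normr_ge0.
by rewrite ler_wpM2l// lef_pV2 ?posrE ?exprn_gt0// ler_eXn2l ?leq_addl// ltr1n.
Qed.

Lemma locally_lipschitz_continuous (R : realType) (phi : R -> R) (a : R) :
  (forall t, t <= a -> phi t = phi a) ->
  (forall b, exists M, lip_on a b M phi) -> continuous phi.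
Proof.
move=> phia philip x; apply/cvgrPdist_lt => e e0.
have [M HM] := philip (`|x| + 1).
have M1 : 0 < 1 + `|M| by rewrite ltr_wpDr.
have HM' s t : s <= t -> t <= `|x| + 1 -> `|phi t - phi s| <= `|M| * (t - s).
  move=> st tx; have [as_|sa] := leP a s.
    by rewrite (le_trans (HM s t as_ st tx))// ler_wpM2r ?subr_ge0// ler_norm.
  have [at_|ta] := leP a t; last first.
    by rewrite (phia s (ltW sa)) (phia t (ltW ta)) subrr normr0 mulr_ge0// subr_ge0.
  rewrite (phia s (ltW sa)) (le_trans (HM a t (lexx a) at_ tx))//.
  apply: (@le_trans _ _ (`|M| * (t - a))).
    by rewrite ler_wpM2r ?subr_ge0// ler_norm.
  by rewrite ler_wpM2l// lerD2l lerN2 ltW.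
have r0 : 0 < Num.min 1 (e / (1 + `|M|)) by rewrite lt_min ltr01 divr_gt0.
apply/nbhs_ballP; exists (Num.min 1 (e / (1 + `|M|))) => //= y.
rewrite /ball/= lt_min => /andP[xy1 xye].
have Me : `|M| * `|x - y| < e.
  apply: (@le_lt_trans _ _ ((1 + `|M|) * `|x - y|)); first by rewrite ler_wpM2r// lerDr.
  by rewrite mulrC -ltr_pdivlMr.
have xx : x <= `|x| + 1 by rewrite (le_trans (ler_norm x))// lerDl.
have yx : y <= `|x| + 1.
  have := ler_norm (y - x); have := ler_norm x; rewrite distrC; move: xy1; lra.
have [xy|yx'] := leP x y.
  rewrite distrC; apply: le_lt_trans (HM' x y xy yx) _.
  by move: Me; rewrite distrC (ger0_norm (_ : 0 <= y - x)) ?subr_ge0.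
apply: le_lt_trans (HM' y x (ltW yx') xx) _.
by move: Me; rewrite (ger0_norm (_ : 0 <= x - y)) ?subr_ge0// ltW.
Qed.

Lemma expR_lip (R : realType) (s t b : R) : s <= t -> t <= b ->
  `|expR t - expR s| <= expR b * (t - s).
Proof.
move=> st tb; rewrite ger0_norm ?subr_ge0 ?ler_expR//.
have := expR_ge1Dx (s - t) => H.
have tB : expR t <= expR b by rewrite ler_expR.
have sE : expR s = expR t * expR (s - t) by rewrite -expRD subrKC.
have := ler_wpM2l (expR_ge0 t) H; rewrite -sE => H1.
have : expR t * (t - s) <= expR b * (t - s) by rewrite ler_wpM2r// subr_ge0.
lra.
Qed.

Section picard.
Variables (R : realType) (n : nat) (k : R -> 'cV[R]_n -> 'cV[R]_n) (t0 : R).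

Definition curve_continuous (x : R -> 'cV[R]_n) := forall i, continuous (fun t => x t i 0).

Hypothesis k_meas : forall x, curve_continuous x ->
  forall i, measurable_fun (setT : set (lebR R)) (fun t => if t0 <= t then k t (x t) i 0 else 0).
Hypothesis k_lip : forall b, exists L K, forall t, t0 <= t -> t <= b ->
  (forall x y, `|k t x - k t y| <= L * `|x - y|) /\ `|k t 0| <= K.

Lemma curve_bounded x b : curve_continuous x -> exists M, forall t, t0 <= t -> t <= b -> `|x t| <= M.
Proof.
move=> cx; have [tb|bt] := leP t0 b; last first.
  by exists 0 => t h1 h2; have := le_lt_trans (le_trans h1 h2) bt; rewrite ltxx.
have H i : exists M, forall t, t \in `[t0, b] -> `|x t i 0| <= M.
  have cn : {within `[t0, b], continuous (fun t => `|x t i 0|)}.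
    apply: continuous_subspaceT => t; apply: (@continuous_comp _ _ _ (fun t => x t i 0) Num.norm).
      exact: cx.
    exact: norm_continuous.
  by have [c _ Hc] := EVT_max tb cn; exists `|x c i 0|.
have [M HM] := choice H.
exists (\sum_i `|M i|) => t h1 h2; apply/mx_normP => [|i j]; first exact: sumr_ge0.
rewrite (ord1 j) (bigD1 i)//= (le_trans (HM i t _)) ?in_itv/= ?h1//.
by rewrite (le_trans (ler_norm _))// lerDl sumr_ge0.
Qed.

Lemma rhs_bounded x b : curve_continuous x ->
  exists M, forall t, t0 <= t -> t <= b -> `|k t (x t)| <= M.
Proof.
move=> cx; have [L [K HLK]] := k_lip b; have [M HM] := curve_bounded b cx.
exists (`|L| * `|M| + K) => t h1 h2; have [H1 H2] := HLK t h1 h2.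
rewrite (_ : k t (x t) = (k t (x t) - k t 0) + k t 0); last by rewrite subrK.
rewrite (le_trans (ler_normD _ _))// lerD// (le_trans (H1 _ _))// subr0.
apply: (@le_trans _ _ (`|L| * `|x t|)); first by rewrite ler_wpM2r// ler_norm.
by rewrite ler_wpM2l// (le_trans (HM t h1 h2))// ler_norm.
Qed.

Definition solves (x0 : 'cV[R]_n) (x y : R -> 'cV[R]_n) :=
  [/\ forall t, t <= t0 -> y t = x0,
    curve_continuous y,
    forall b, exists M, forall i, lip_on t0 b M (fun t => y t i 0) &
    {ae @lebesgue_measure R, forall t, t0 < t -> forall i,
      is_derive t (1 : R) (fun s => y s i 0) (k t (x t) i 0)}].

Lemma exists_picard_step x0 x : curve_continuous x -> exists y, solves x0 x y.
Proof.
move=> cx.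
have prim i : exists Phi : R -> R, [/\ forall t, t <= t0 -> Phi t = 0,
    forall b, exists M, lip_on t0 b M Phi &
    {ae @lebesgue_measure R, forall t, t0 < t -> is_derive t (1 : R) Phi (k t (x t) i 0)}].
  have bd b : exists M, forall t, `|t| <= b -> `|if t0 <= t then k t (x t) i 0 else 0| <= M.
    have [M HM] := rhs_bounded b cx; exists `|M| => t tb.
    case: ifP => h; last by rewrite normr0.
    rewrite (le_trans (entry_le_norm _ _ _))// (le_trans (HM t h _)) ?ler_norm//.
    exact: le_trans (ler_norm t) tb.
  have [Phi [P0 Pl Pd]] := exists_primitive t0 (k_meas cx i) bd.
  (* To the left of [t0] the curve is continued by its initial value. *)
  exists (fun t => Phi (Num.max t0 t)); split.
  - by move=> t tt0; rewrite max_l.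
  - by move=> b; have [M HM] := Pl b; exists M => s t h1 h2 h3; rewrite !max_r ?HM// (le_trans h1).
  - apply: (aeS Pd) => t Ht tt0; have := Ht tt0; rewrite (ltW tt0).
    move=> /is_derive_epsP Hd; apply/is_derive_epsP => e e0.
    have [r r0 Hr] := Hd e e0; exists (Num.min r (t - t0)); first by rewrite lt_min r0 subr_gt0.
    move=> h; rewrite lt_min => /andP[hr ht]; rewrite !max_r ?(ltW tt0)//; first exact: Hr.
    by move: ht; rewrite ltr_norml => /andP[h1 _]; rewrite -lerBlDl ltW// -opprB.
have [Phi HPhi] := choice prim.
exists (fun t => \col_i (x0 i 0 + Phi i t)).
have lips b : exists M, forall i, lip_on t0 b M (fun t => (\col_i (x0 i 0 + Phi i t)) i 0).
  have H i : exists M, lip_on t0 b M (Phi i) by have [_ + _] := HPhi i; apply.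
  have [M HM] := choice H.
  exists (\sum_i `|M i|) => i s t h1 h2 h3; rewrite !mxE opprD addrACA subrr add0r.
  rewrite (le_trans (HM i s t h1 h2 h3))// ler_wpM2r ?subr_ge0//.
  by rewrite (bigD1 i)//= (le_trans (ler_norm _))// lerDl sumr_ge0.
have Phi0 i t : t <= t0 -> Phi i t = 0 by have [+ _ _] := HPhi i; apply.
split => //.
- by move=> t tt0; apply/colP => i; rewrite mxE Phi0// addr0.
- move=> i; apply: (@locally_lipschitz_continuous _ _ t0).
    by move=> t tt0; rewrite !mxE !Phi0.
  by move=> b; have [M HM] := lips b; exists M.
- have nbad : (@lebesgue_measure R).-negligible [set t | exists i,
      ~ (t0 < t -> is_derive t (1 : R) (Phi i) (k t (x t) i 0))].
    by apply: negligible_bigcup_countType => i; have [_ _] := HPhi i.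
  apply: negligibleS nbad => t /= nt; apply: contrapT => nex; apply: nt => tt0 i.
  have -> : (fun s => (\col_i (x0 i 0 + Phi i s)) i 0) = cst (x0 i 0) + Phi i.
    by apply/funext => s; rewrite mxE.
  rewrite -[k t (x t) i 0]add0r; apply: is_deriveD.
  by apply: contrapT => nd; apply: nex; exists i => H; apply: nd; exact: H.
Qed.

(** Consecutive Picard iterates are compared by means of the weight
[expR (2 * L * (t - t0))], for which each step halves distances on the whole of a
bounded interval; the limit is a fixed point. *)
Theorem picard_existence x0 : exists x, solves x0 x x.
Proof.
have step x : exists y, curve_continuous x -> solves x0 x y.
  have [cx|ncx] := pselect (curve_continuous x); last by exists x.
  by have [y Hy] := exists_picard_step x0 cx; exists y.
have [P HP] := choice step.
pose X := fix X j := if j is j'.+1 then P (X j') else (fun=> x0).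
have cX j : curve_continuous (X j).
  elim: j => [|j IH]; first by move=> i; exact: cst_continuous.
  by have [] := HP _ IH.
have XS j : solves x0 (X j) (X j.+1) := HP _ (cX j).
have Xt0 j t : t <= t0 -> X j t = x0.
  by case: j => [//|j] tt0; have [+ _ _ _] := XS j; apply.
have Xlip j b : exists M, forall i, lip_on t0 b M (fun t => X j t i 0).
  case: j => [|j]; last by have [_ _ + _] := XS j; apply.
  by exists 0 => i s t _ _ _; rewrite subrr normr0 mul0r.
have conv b : exists C, forall j t, t <= b -> `|X j.+1 t - X j t| <= C / 2 ^+ j.
  have [L0 [K HLK]] := k_lip b; pose L := 1 + `|L0|.
  have L_gt0 : 0 < L by rewrite ltr_wpDr.
  have HL t x y : t0 <= t -> t <= b -> `|k t x - k t y| <= L * `|x - y|.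
    move=> h1 h2; have [H _] := HLK t h1 h2; rewrite (le_trans (H x y))// ler_wpM2r//.
    by rewrite (le_trans (ler_norm _))// lerDr.
  have [M1 HM1] := curve_bounded b (cX 1%N).
  pose M := `|M1| + `|x0|; have M0 : 0 <= M by rewrite addr_ge0.
  pose E t := expR (2 * L * (t - t0)).
  have E1 t : t0 <= t -> 1 <= E t.
    by move=> h; rewrite -expR0 ler_expR !mulr_ge0 ?subr_ge0// ltW.
  have E0 t : 0 <= E t := expR_ge0 _.
  have dE t : is_derive t (1 : R) E (2 * L * E t).
    apply/is_derive_epsP => e e0.
    have L2 : 0 < 2 * L by rewrite mulr_gt0.
    have /is_derive_epsP H := is_derive_expR (2 * L * (t - t0)).
    have [r r0 Hr] := H _ (divr_gt0 e0 L2).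
    exists (r / (2 * L)); first by rewrite divr_gt0.
    move=> h; rewrite ltr_pdivlMr// => hr.
    have hr' : `|2 * L * h| < r by rewrite normrM (gtr0_norm L2) mulrC.
    have := Hr _ hr'; rewrite normrM (gtr0_norm L2) /E.
    rewrite (_ : 2 * L * (t + h - t0) = 2 * L * (t - t0) + 2 * L * h); last by ring.
    rewrite (_ : e / (2 * L) * (2 * L * `|h|) = e * `|h|); last by field; rewrite gt_eqF.
    by rewrite (_ : 2 * L * expR (2 * L * (t - t0)) * h = expR (2 * L * (t - t0)) * (2 * L * h)); last by ring.
  have lipE c : lip_on t0 b (`|c| * (expR (2 * L * (b - t0)) * (2 * L))) (fun t => c * E t).
    move=> s t h1 h2 h3; rewrite -mulrBr normrM -[leRHS]mulrA ler_wpM2l//.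
    rewrite /E -[leRHS]mulrA (_ : 2 * L * (t - s) = 2 * L * (t - t0) - 2 * L * (s - t0)); last by ring.
    by apply: expR_lip; rewrite ler_pM2l ?mulr_gt0// lerD2r.
  have est j : forall t, t0 <= t -> t <= b -> `|X j.+1 t - X j t| <= M / 2 ^+ j * E t.
    elim: j => [t h1 h2|j IH t h1 h2].
      rewrite expr0 divr1 (le_trans (ler_normB _ _))// (le_trans (lerD (HM1 t h1 h2) (lexx _)))//.
      rewrite (le_trans (lerD (ler_norm M1) (lexx _)))// -[leLHS]mulr1 ler_wpM2l// E1//.
    have c0 : 0 <= M / 2 ^+ j by rewrite divr_ge0// exprn_ge0.
    have c0' : 0 <= M / 2 ^+ j.+1 by rewrite divr_ge0// exprn_ge0.
    have cc : M / 2 ^+ j.+1 * 2 = M / 2 ^+ j.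
      by rewrite exprS invfM; field; rewrite expf_neq0.
    set c := M / 2 ^+ j.+1 in c0' cc *; set c' := M / 2 ^+ j in c0 cc IH.
    apply/mx_normP => [|i l]; first by rewrite mulr_ge0.
    rewrite (ord1 l) {l} !mxE.
    have [_ _ /(_ b)[N1 HN1] d1] := XS j; have [_ _ /(_ b)[N2 HN2] d2] := XS j.+1.
    have acE : ac t0 t (fun s => c * E s) by apply: ac_sub (lip_on_ac (lipE c)).
    have ac1 : ac t0 t (fun s => X j.+1 s i 0) by apply: ac_sub (lip_on_ac (HN1 i)).
    have ac2 : ac t0 t (fun s => X j.+2 s i 0) by apply: ac_sub (lip_on_ac (HN2 i)).
    have half (u v du dv : R -> R) : ac t0 t u -> ac t0 t v -> u t0 = v t0 ->
      {ae @lebesgue_measure R, forall s, t0 < s -> s < t ->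
         [/\ is_derive s (1 : R) u (du s), is_derive s (1 : R) v (dv s) & du s - dv s <= L * (c' * E s)]} ->
      u t - v t <= c * E t.
      move=> acu acv uv0 ae.
      have := @ac_increment_le R t0 t 0 (fun s => u s - v s - c * E s)
        (fun s => du s - dv s - c * (2 * L * E s)) h1 (acB (acB acu acv) acE) _.
      rewrite uv0 subrr sub0r mul0r opprK => H.
      have {}H : u t - v t - c * E t + c * E t0 <= 0.
        apply: H; apply: (aeS ae) => s Hs s1 s2; have [e1 e2 e3] := Hs s1 s2; split.
          have -> : (fun s => u s - v s - c * E s) = (u - v) - c *: E by apply/funext.
          by apply: is_deriveB; exact: is_deriveZ.
        move: e3; rewrite -cc; lra.
      have : 0 <= c * E t0 by rewrite mulr_ge0.
      move: H; lra.
    have bound s : t0 < s -> s < t -> `|k s (X j.+1 s) - k s (X j s)| <= L * (c' * E s).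
      move=> s1 s2; have sb : s <= b by rewrite (le_trans (ltW s2)).
      rewrite (le_trans (HL s _ _ (ltW s1) sb))// ler_wpM2l ?(ltW L_gt0)//.
      exact: IH (ltW s1) sb.
    have same : X j.+2 t0 i 0 = X j.+1 t0 i 0 by rewrite !Xt0.
    rewrite ler_norml lerNl opprB; apply/andP; split.
      apply: (half _ _ _ _ ac1 ac2 (esym same)); apply: (aeS (aeI d1 d2)) => s [H1 H2] s1 s2.
      split; [exact: H1|exact: H2|].
      have := le_trans (entry_le_norm (k s (X j.+1 s) - k s (X j s)) i 0) (bound s s1 s2).
      by rewrite !mxE distrC; apply: le_trans; exact: ler_norm.
    apply: (half _ _ _ _ ac2 ac1 same); apply: (aeS (aeI d1 d2)) => s [H1 H2] s1 s2.
    split; [exact: H2|exact: H1|].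
    have := le_trans (entry_le_norm (k s (X j.+1 s) - k s (X j s)) i 0) (bound s s1 s2).
    by rewrite !mxE; apply: le_trans; exact: ler_norm.
  exists (M * E b) => j t tb; have [h1|h1] := leP t0 t; last first.
    by rewrite !Xt0 ?(ltW h1)// subrr normr0 divr_ge0 ?mulr_ge0// exprn_ge0.
  rewrite (le_trans (est j t h1 tb))// mulrAC ler_wpM2r ?invr_ge0 ?exprn_ge0//.
  by rewrite ler_wpM2l// ler_expR ler_pM2l ?mulr_gt0// lerD2r.
have [x Hx] := geometric_limit conv.
have cx : curve_continuous x.
  move=> i t; apply/cvgrPdist_lt => e e0.
  have [C HC] := Hx (t + 1); have e3 : 0 < e / 3 by rewrite divr_gt0.
  have [j je] := pow_half_small C e3.
  have close s : s <= t + 1 -> `|X j s i 0 - x s i 0| < e / 3.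
    move=> st; have := entry_le_norm (X j s - x s) i 0; rewrite !mxE => /le_lt_trans; apply.
    exact: le_lt_trans (HC j s st) je.
  have := cX j i t => /cvgrPdist_lt/(_ _ e3) near1.
  have near2 : \forall s \near t, s < t + 1.
    by apply: lt_nbhsl; rewrite ltrDl.
  near=> s.
  have s1 : s <= t + 1 by rewrite ltW//; near: s.
  have s2 : `|X j t i 0 - X j s i 0| < e / 3 by near: s.
  have t1 : t <= t + 1 by rewrite lerDl.
  have := close s s1; have := close t t1.
  move: s2; rewrite !ltr_norml => /andP[? ?] /andP[? ?] /andP[? ?].
  by apply/andP; split; lra.
have [Y0 cY Ylip Yder] := HP x cx.
suff xP : x = P x by exists x; rewrite {2}xP; exact: HP.
apply/funext => t.
have xt0 s : s <= t0 -> x s = x0.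
  move=> st0; have [C HC] := Hx s.
  apply/eqP; rewrite -subr_eq0 -normr_eq0 eq_le normr_ge0 andbT.
  apply: (@le_of_pow_half _ _ _ C) => j; rewrite add0r.
  by have := HC j s (lexx s); rewrite Xt0// distrC.
have [tt0|tt0] := leP t t0; first by rewrite xt0// Y0.
have [C HC] := Hx t.
have [L0 [K HLK]] := k_lip t; pose L := 1 + `|L0|.
have L_gt0 : 0 < L by rewrite ltr_wpDr.
have HL s y z : t0 <= s -> s <= t -> `|k s y - k s z| <= L * `|y - z|.
  move=> h1 h2; have [H _] := HLK s h1 h2; rewrite (le_trans (H y z))// ler_wpM2r//.
  by rewrite (le_trans (ler_norm _))// lerDr.
apply/eqP; rewrite -subr_eq0 -normr_eq0 eq_le normr_ge0 andbT.
apply: (@le_of_pow_half _ _ _ (C + L * C * (t - t0))) => j; rewrite add0r.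
have C0 l : 0 <= C / 2 ^+ l by rewrite (le_trans (normr_ge0 _) (HC l t (lexx t))).
have LCE : L * C * (t - t0) / 2 ^+ j = L * (C / 2 ^+ j) * (t - t0) by ring.
have step1 : `|P x t - X j.+1 t| <= L * C * (t - t0) / 2 ^+ j.
  apply/mx_normP => [|i l].
    by rewrite LCE; apply: mulr_ge0; rewrite ?subr_ge0 ?(ltW tt0)// mulr_ge0// ltW.
  rewrite (ord1 l) !mxE.
  have [_ _ /(_ t)[N1 HN1] d1] := XS j; have [N2 HN2] := Ylip t.
  have := @ac_increment_abs_le R t0 t (L * (C / 2 ^+ j)) (fun s => P x s i 0 - X j.+1 s i 0)
    (fun s => k s (x s) i 0 - k s (X j s) i 0) (ltW tt0) (acB (lip_on_ac (HN2 i)) (lip_on_ac (HN1 i))) _.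
  rewrite (Y0 t0 (lexx t0)) (Xt0 j.+1 t0 (lexx t0)) subrr subr0 => H.
  rewrite LCE; apply: H; apply: (aeS (aeI Yder d1)) => s [H1 H2] s1 s2; split.
    have -> : (fun s => P x s i 0 - X j.+1 s i 0) = (fun s => P x s i 0) - (fun s => X j.+1 s i 0) by apply/funext.
    by apply: is_deriveB; [exact: H1|exact: H2].
  have := entry_le_norm (k s (x s) - k s (X j s)) i 0; rewrite !mxE => /le_trans; apply.
  rewrite (le_trans (HL s _ _ (ltW s1) (ltW s2)))// ler_wpM2l ?(ltW L_gt0)//.
  by rewrite distrC; exact: HC (ltW s2).
rewrite -(subrKA (X j.+1 t)) (le_trans (ler_normD _ _))// mulrDl lerD//.
  rewrite distrC (le_trans (HC j.+1 t (lexx t)))// exprS invfM mulrCA.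
  by rewrite -[leRHS]mul1r ler_wpM2r// invf_le1// ler1n.
by rewrite distrC.
Unshelve. all: by end_near. Qed.

End picard.

(** * Measurable and integrable curves *)

Lemma is_derive_mxP (R : realType) (n : nat) (x : R -> 'cV[R]_n) (t : R) (V : 'cV[R]_n) :
  is_derive t (1 : R) x V <-> forall i, is_derive t (1 : R) (fun s => x s i 0) (V i 0).
Proof.
split=> [[dx xV] i|H].
  have dxi := (derivable_mxP x t 1).1 dx.
  have -> : V i 0 = 'D_1 (fun s => x s i 0) t by rewrite -xV derive_mx// mxE.
  exact: derivableP.
have dx : derivable x t 1.
  by apply/derivable_mxP => i j; rewrite (ord1 j); have [] := H i.
split => //; rewrite derive_mx//; apply/matrixP => i j; rewrite mxE (ord1 j).
by have [_] := H i.
Qed.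

Lemma leb_ae (R : realType) (P : R -> Prop) :
  {ae leb R, forall t, P t} <-> {ae @lebesgue_measure R, forall t, P t}.
Proof. exact: leb_negligibleE. Qed.

Lemma measurable_lebR_itv (R : realType) (i : interval R) :
  @measurable _ (lebR R) [set` i].
Proof. by apply: borel_leb_measurable; exact: measurable_itv. Qed.

Lemma Rplus_itv (R : realType) : @Rplus R = [set` `[0, +oo[].
Proof. by apply/seteqP; split => t; rewrite /Rplus /= in_itv/= andbT. Qed.

Lemma measurable_Rplus (R : realType) : @measurable _ (lebR R) (@Rplus R).
Proof. by rewrite Rplus_itv; exact: measurable_lebR_itv. Qed.

Lemma cmeasurable_mulmx (R : realType) (p q : nat) (D : set R) (A : 'M[R]_(q, p)) (g : R -> 'cV[R]_p) :
  cmeasurable D g -> cmeasurable D (fun t => A *m g t).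
Proof.
move=> mg i; rewrite (_ : (fun t => _) = fun t : lebR R => \sum_j A i j * g t j 0); last first.
  by apply/funext => t; rewrite mxE.
by apply: measurable_sum => j; apply: measurable_funM => //; exact: mg.
Qed.

Lemma cmeasurableD (R : realType) (p : nat) (D : set R) (g h : R -> 'cV[R]_p) :
  cmeasurable D g -> cmeasurable D h -> cmeasurable D (fun t => g t + h t).
Proof.
move=> mg mh i; rewrite (_ : (fun t => _) = fun t : lebR R => g t i 0 + h t i 0); last first.
  by apply/funext => t; rewrite mxE.
by apply: measurable_funD; [exact: mg|exact: mh].
Qed.

Lemma cmeasurableB (R : realType) (p : nat) (D : set R) (g h : R -> 'cV[R]_p) :
  cmeasurable D g -> cmeasurable D h -> cmeasurable D (fun t => g t - h t).
Proof.
move=> mg mh i; rewrite (_ : (fun t => _) = fun t : lebR R => g t i 0 - h t i 0); last first.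
  by apply/funext => t; rewrite !mxE.
by apply: measurable_funB; [exact: mg|exact: mh].
Qed.

Lemma cmeasurableS (R : realType) (p : nat) (D E : set R) (g : R -> 'cV[R]_p) :
  @measurable _ (lebR R) D -> E `<=` D -> cmeasurable D g -> cmeasurable E g.
Proof. by move=> mD ED mg i; apply: measurable_funS (mg i). Qed.

Lemma curve_continuous_cmeasurable (R : realType) (n : nat) (D : set R) (x : R -> 'cV[R]_n) :
  curve_continuous x -> cmeasurable D x.
Proof.
by move=> cx i; apply: measurable_funS (continuous_leb_measurable (cx i)).
Qed.

Lemma bounded_cintegrable (R : realType) (k : nat) (a b M : R) (g : R -> 'cV[R]_k) :
  cmeasurable [set` `[a, b]] g -> (forall t, a <= t -> t <= b -> `|g t| <= M) ->
  cintegrable [set` `[a, b]] g.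
Proof.
move=> mg gM i.
apply: (@measurable_bounded_integrable _ (lebR R) R (leb R) (fun t => g t i 0)).
- exact: measurable_lebR_itv.
- suff : (@lebesgue_measure R [set` `[a, b]] < +oo)%E by [].
  by rewrite lebesgue_measure_itv/=; case: ifP => _; rewrite ?ltry// -EFinD ltry.
- exact: (mg i).
- exists M; split; first exact: num_real.
  move=> K MK t; rewrite /= in_itv/= => /andP[h1 h2].
  by rewrite (le_trans _ (ltW MK))// (le_trans (entry_le_norm _ _ _))// gM.
Qed.

(** [v'] vanishes on a Borel null set that contains the exceptional sets of the
essential bounds on the intervals [[0, n]], and is [v] elsewhere. *)
Lemma bounded_modification (R : realType) (k : nat) (v : R -> 'cV[R]_k) :
  Loo_loc (@Rplus R) v ->
  exists v', [/\ cmeasurable (@Rplus R) v',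
    forall b, exists M, forall t, 0 <= t -> t <= b -> `|v' t| <= M &
    {ae @lebesgue_measure R, forall t, 0 <= t -> v' t = v t}].
Proof.
move=> Lv.
have sub n : [set` `[0, n%:R : R]] `<=` @Rplus R.
  by move=> t; rewrite /= in_itv/= => /andP[].
have bnd n : exists c : R, {ae leb R, forall t, [set` `[0, n%:R : R]] t -> enorm (v t) <= c}.
  by have [_] := Lv _ _ (sub n).
have [c Hc] := choice bnd.
have nbad : (@lebesgue_measure R).-negligible
    [set t | exists n, ~ ([set` `[0, n%:R : R]] t -> enorm (v t) <= c n)].
  by apply: negligible_bigcup_countType => n; apply: (leb_ae _).1; exact: Hc.
have [B [mB B0 badB]] := nbad.
have nB : (@lebesgue_measure R).-negligible B by exists B; split.
have mBl : @measurable _ (lebR R) B by apply: borel_leb_measurable; exact: mB.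
exists (fun t => if t \in B then 0 else v t); split.
- move=> i; apply: (measurable_fun_rays (@measurable_Rplus R)) => a.
  have mv : @measurable _ (lebR R) (@Rplus R `&` [set t | a < v t i 0]).
    rewrite (_ : _ `&` _ = \bigcup_n ([set` `[0, n%:R : R]] `&` (fun t => v t i 0) @^-1` `]a, +oo[%classic)).
      apply: bigcupT_measurable => n; have [mv _] := Lv _ _ (sub n).
      by apply: mv; [exact: measurable_lebR_itv|exact: measurable_itv].
    apply/seteqP; split => [t [/= t0 av]|t [n _ [tn]]].
      exists (Num.truncn t).+1 => //; split; rewrite /= in_itv/= ?av// t0 ltW//.
      exact: truncnS_gt.
    by rewrite /= in_itv/= andbT => av; split => //; exact: sub tn.
  rewrite (_ : _ `&` _ = ((@Rplus R `&` [set t | a < v t i 0]) `\` B) `|`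
      (if a < 0 then @Rplus R `&` B else set0)).
    apply: measurableU; first exact: measurableD.
    by case: ifP => // _; apply: measurableI => //; exact: measurable_Rplus.
  apply/seteqP; split => [t [t0] /=|t [[[t0 av] nB']|]].
  + case: ifPn => tB; rewrite ?mxE => av; first by right; rewrite av; split => //; exact: set_mem.
    by left; split => //; move/negP: tB; rewrite inE.
  + by split => //=; rewrite memNset.
  + by case: ifP => // a0 [t0 Bt]; split => //=; rewrite mem_set// mxE.
- move=> b; exists `|c (Num.truncn b).+1| => t t0 tb.
  case: ifPn => tB; first by rewrite normr0.
  have : ~ B t by move/negP: tB; rewrite inE.
  move=> nBt; rewrite (le_trans (norm_le_enorm _))// (le_trans _ (ler_norm _))//.
  apply: contrapT => nle; apply: nBt; apply: badB; exists (Num.truncn b).+1 => H.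
  apply: nle; apply: H; rewrite /= in_itv/= t0 ltW// (le_lt_trans tb)//.
  exact: truncnS_gt.
- apply: negligibleS nB => t /= H; apply: contrapT => nBt; apply: H => _.
  by rewrite memNset.
Qed.

Lemma measurable_fun_tail (R : realType) (t0 : R) (h : R -> R) : 0 <= t0 ->
  measurable_fun (@Rplus R : set (lebR R)) h ->
  measurable_fun (setT : set (lebR R)) (fun t => if t0 <= t then h t else 0).
Proof.
move=> t00 mh; apply: (measurable_fun_rays (@measurableT _ (lebR R))) => a.
have ml : @measurable _ (lebR R) [set` `[t0, +oo[] by exact: measurable_lebR_itv.
have mr : @measurable _ (lebR R) [set` `]-oo, t0[] by exact: measurable_lebR_itv.
have mha : @measurable _ (lebR R) (@Rplus R `&` h @^-1` `]a, +oo[%classic).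
  by apply: mh; [exact: measurable_Rplus|exact: measurable_itv].
rewrite (_ : _ `&` _ = ([set` `[t0, +oo[] `&` (@Rplus R `&` h @^-1` `]a, +oo[%classic))
    `|` (if a < 0 then [set` `]-oo, t0[] else set0)).
  by apply: measurableU; [exact: measurableI|case: ifP].
apply/seteqP; split => [t [_] /=|t].
  case: ifP => [tt|/negbT]; last rewrite -ltNge => tt a0.
    move=> ah; left; split; first by rewrite /= in_itv/= tt.
    by split; [exact: le_trans tt|rewrite /= in_itv/= ah].
  by right; rewrite a0 /= in_itv.
move=> [[] /=|]; first by rewrite !in_itv/= !andbT => tt [_ ah]; rewrite tt.
by case: ifP => // a0; rewrite /= in_itv/= => tt; split => //=; rewrite leNgt tt.
Qed.

(** * Uniqueness of trajectories *)

(** The regularity that the nonlinearity, the inverse of the closed loop map and the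
right-hand side of the state equation have in common; it is stable under the
operations that build the last one from the others. *)
Definition unif_lip (R : realType) (p q : nat) (h : R -> 'cV[R]_p -> 'cV[R]_q) :=
  forall b, exists L K, 0 <= L /\ forall t, 0 <= t -> t <= b ->
    (forall x y, `|h t x - h t y| <= L * `|x - y|) /\ `|h t 0| <= K.

Section unif_lip.
Variable R : realType.

Lemma unif_lip_id (p : nat) : unif_lip (fun (_ : R) (x : 'cV[R]_p) => x).
Proof.
by move=> b; exists 1, 0; split => // t _ _; split => [x y|]; rewrite ?mul1r ?normr0.
Qed.

Lemma unif_lip_cst (p q : nat) (v : R -> 'cV[R]_q) :
  (forall b, exists M, forall t, 0 <= t -> t <= b -> `|v t| <= M) ->
  unif_lip (fun t (_ : 'cV[R]_p) => v t).
Proof.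
move=> vb b; have [M HM] := vb b; exists 0, M; split => // t t0 tb.
by split => [x y|]; rewrite ?subrr ?normr0 ?mul0r//; exact: HM.
Qed.

Lemma unif_lipD (p q : nat) (g h : R -> 'cV[R]_p -> 'cV[R]_q) :
  unif_lip g -> unif_lip h -> unif_lip (fun t x => g t x + h t x).
Proof.
move=> Hg Hh b; have [L [K [L0 H]]] := Hg b; have [L' [K' [L'0 H']]] := Hh b.
exists (L + L'), (K + K'); split => [|t t0 tb]; first exact: addr_ge0.
have [h1 h2] := H t t0 tb; have [h1' h2'] := H' t t0 tb; split => [x y|].
  by rewrite opprD addrACA (le_trans (ler_normD _ _))// mulrDl lerD.
by rewrite (le_trans (ler_normD _ _))// lerD.
Qed.

Lemma unif_lip_mulmx (p q r : nat) (A : 'M[R]_(r, q)) (h : R -> 'cV[R]_p -> 'cV[R]_q) :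
  unif_lip h -> unif_lip (fun t x => A *m h t x).
Proof.
move=> Hh b; have [L [K [L0 H]]] := Hh b.
have A0 : 0 <= q%:R * `|A| by rewrite mulr_ge0.
exists (q%:R * `|A| * L), (q%:R * `|A| * K); split => [|t t0 tb]; first exact: mulr_ge0.
have [h1 h2] := H t t0 tb; split => [x y|].
  by rewrite -mulmxBr (le_trans (mulmx_norm_le _ _))// -[leRHS]mulrA ler_wpM2l.
by rewrite (le_trans (mulmx_norm_le _ _))// ler_wpM2l.
Qed.

Lemma unif_lip_le (p q : nat) (h : R -> 'cV[R]_p -> 'cV[R]_q) (b : R) : unif_lip h ->
  exists L K, 0 <= L /\ forall t, 0 <= t -> t <= b -> forall x, `|h t x| <= L * `|x| + K.
Proof.
move=> Hh; have [L [K [L0 H]]] := Hh b; exists L, K; split => // t t0 tb x.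
have [h1 h2] := H t t0 tb.
rewrite (_ : h t x = (h t x - h t 0) + h t 0); last by rewrite subrK.
by rewrite (le_trans (ler_normD _ _))// lerD// -{2}(subr0 x).
Qed.

Lemma unif_lip_comp (p q r : nat) (g : R -> 'cV[R]_q -> 'cV[R]_r) (h : R -> 'cV[R]_p -> 'cV[R]_q) :
  unif_lip g -> unif_lip h -> unif_lip (fun t x => g t (h t x)).
Proof.
move=> Hg Hh b; have [L [K [L0 H]]] := Hh b; have [L' [K' [L'0 H']]] := Hg b.
have [M [N [M0 HN]]] := unif_lip_le b Hg.
exists (L' * L), (M * K + N); split => [|t t0 tb]; first exact: mulr_ge0.
have [h1 h2] := H t t0 tb; have [h1' h2'] := H' t t0 tb; split => [x y|].
  by rewrite (le_trans (h1' _ _))// -mulrA ler_wpM2l.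
by rewrite (le_trans (HN t t0 tb _))// lerD2r ler_wpM2l.
Qed.

End unif_lip.

Lemma lip_on_abs_continuous (R : realType) (n : nat) (a b M : R) (x : R -> 'cV[R]_n) :
  (forall i, lip_on a b M (fun t => x t i 0)) -> abs_continuous a b x.
Proof.
move=> xM e e0; have M1 : 0 < 1 + n%:R * `|M| by rewrite ltr_wpDr// mulr_ge0.
exists (e / (1 + n%:R * `|M|)); first by rewrite divr_gt0.
move=> N r s rs _; rewrite ltr_pdivlMr// => lt.
apply: le_lt_trans lt; rewrite mulr_suml; apply: ler_sum => j _.
have [h1 h2 h3] := rs j; have sr0 : 0 <= s j - r j by rewrite subr_ge0.
rewrite (le_trans (enorm_le_norm _))//.
apply: (@le_trans _ _ (n%:R * (`|M| * (s j - r j)))).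
  rewrite ler_wpM2l//; apply/mx_normP => [|i l]; first by rewrite mulr_ge0.
  rewrite (ord1 l) !mxE (le_trans (xM i _ _ h1 h2 h3))//.
  by rewrite ler_wpM2r// ler_norm.
by rewrite mulrA mulrC ler_wpM2l// lerDr.
Qed.

Section lure_uniqueness.
Variables (R : realType) (n m me p : nat) (S : linsys R n m me p).
Variable f : R -> 'cV[R]_p -> 'cV[R]_m.
Local Notation F t := (closed_loop (f t) (mxD S)).
Hypothesis f_meas : forall xi, cmeasurable (@Rplus R) (f ^~ xi).
Hypothesis f_lip : unif_lip f.
Hypothesis F_expanding : forall b, exists2 c, 0 < c & forall t, 0 <= t -> t <= b ->
  forall x y, c * `|x - y| <= `|F t x - F t y|.

(** The closed loop maps send the difference of two outputs to [C] times the difference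
of the states, so that by expansion outputs differ by no more than a constant times
the difference of the states. The latter then satisfies the assumption of Gronwall's
lemma. *)
Lemma pre_trajectory_unique t0 w w' : 0 <= t0 ->
  pre_trajectory S f t0 w -> pre_trajectory S f t0 w' -> inp w = inp w' ->
  (tend w <= tend w')%E -> sta w t0 = sta w' t0 -> coincide t0 (tend w) w w'.
Proof.
case: w => tau v x y; case: w' => tau' v' x' y' t00 /=.
move=> [tau0 [_ xW yL] fyL ode oute] [_ [_ xW' _] _ ode' oute'] vv' tt xx'.
rewrite -{}vv' in ode' oute' *.
have JJ t : itv_co t0 tau t -> itv_co t0 tau' t.
  by move=> [h1 h2]; split => //; exact: lt_le_trans tt.
have yE t : itv_co t0 tau t ->
    y t = mxC S *m x t + mxD S *m f t (y t) + mxDe S *m v t ->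
    y' t = mxC S *m x' t + mxD S *m f t (y' t) + mxDe S *m v t ->
    F t (y t) - F t (y' t) = mxC S *m (x t - x' t).
  move=> _ e1 e2; rewrite /closed_loop {1}e1 {1}e2 mulmxBr.
  by apply/colP => i; rewrite !mxE; ring.
have xE t : itv_co t0 tau t -> x t = x' t.
  move=> [t0t ttau]; have [c c0 Hc] := F_expanding t; have [L [K [L0 HL]]] := f_lip t.
  have Js s : t0 <= s -> s <= t -> itv_co t0 tau s.
    by move=> h1 h2; split => //; rewrite (le_lt_trans _ ttau)// lee_fin.
  have JI : [set` `[t0, t]] `<=` itv_co t0 tau.
    by move=> s; rewrite /= in_itv/= => /andP[h1 h2]; exact: Js.
  pose k : R := n%:R * `|mxA S| + m%:R * `|mxB S| * (L * (c^-1 * (n%:R * `|mxC S|))).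
  have k0 : 0 <= k.
    by rewrite addr_ge0 ?mulr_ge0// invr_ge0 ltW.
  pose V s := mxA S *m x s + mxB S *m f s (y s) + mxBe S *m v s.
  pose V' s := mxA S *m x' s + mxB S *m f s (y' s) + mxBe S *m v s.
  suff H : x t - x' t = 0 by apply/eqP; rewrite -subr_eq0 H.
  apply: (@zero_solution R n (fun s => x s - x' s) t0 t k (fun s => V s - V' s) k0) => //.
  - move=> i; rewrite (_ : (fun s => _) = fun s => x s i 0 - x' s i 0); last first.
      by apply/funext => s; rewrite !mxE.
    apply: acB; apply: abs_continuous_ac; first exact: xW.
    by apply: xW' => s /JI/JJ.
  - by rewrite xx' subrr.
  have all := aeI (aeI ((leb_ae _).1 ode) ((leb_ae _).1 ode'))
    (aeI ((leb_ae _).1 oute) ((leb_ae _).1 oute')).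
  apply: (aeS all) => s [[d1 d2] [q1 q2]] t0s st i.
  have Jst := Js s (ltW t0s) (ltW st).
  have {}d1 := (is_derive_mxP _ _ _).1 (d1 Jst).
  have {}d2 := (is_derive_mxP _ _ _).1 (d2 (JJ _ Jst)).
  split.
    rewrite (_ : (fun s => _) = (fun s => x s i 0) - (fun s => x' s i 0)); last first.
      by apply/funext => r; rewrite !mxE.
    rewrite (_ : (V s - V' s) i 0 = V s i 0 - V' s i 0); last by rewrite !mxE.
    exact: is_deriveB.
  apply: le_trans (entry_le_norm _ i 0) _.
  have s0 : 0 <= s by rewrite (le_trans t00)// ltW.
  have -> : V s - V' s = mxA S *m (x s - x' s) + mxB S *m (f s (y s) - f s (y' s)).
    by rewrite /V /V' !mulmxBr; apply/colP => j; rewrite !mxE; ring.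
  rewrite (le_trans (ler_normD _ _))// /k mulrDl lerD ?mulmx_norm_le//.
  rewrite (le_trans (mulmx_norm_le _ _))// -[leRHS]mulrA ler_wpM2l ?mulr_ge0//.
  have [h1 _] := HL s s0 (ltW st); rewrite (le_trans (h1 _ _))// -[leRHS]mulrA ler_wpM2l//.
  have := Hc s s0 (ltW st) (y s) (y' s).
  rewrite (yE s Jst (q1 Jst) (q2 (JJ _ Jst))) => h2.
  rewrite -mulrA mulrC ler_pdivlMr// mulrC (le_trans h2)//.
  exact: mulmx_norm_le.
split => //=.
apply: (leb_ae _).2; apply: (aeS (aeI ((leb_ae _).1 oute) ((leb_ae _).1 oute'))) => t [q1 q2] Jt.
have [t0t _] := Jt; have [c c0 Hc] := F_expanding t.
have := Hc t (le_trans t00 t0t) (lexx t) (y t) (y' t).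
rewrite (yE t Jt (q1 Jt) (q2 (JJ _ Jt))) xE// subrr mulmx0 normr0.
by rewrite pmulr_rle0// normr_le0 subr_eq0 => /eqP.
Qed.

End lure_uniqueness.

(** * Existence of trajectories *)

Section lure_existence.
Variables (R : realType) (n m me p : nat) (S : linsys R n m me p).
Variable f : R -> 'cV[R]_p -> 'cV[R]_m.
Local Notation F t := (closed_loop (f t) (mxD S)).
Hypothesis f_meas : forall xi, cmeasurable (@Rplus R) (f ^~ xi).
Hypothesis f_lip : unif_lip f.
Hypothesis F_expanding : forall b, exists2 c, 0 < c & forall t, 0 <= t -> t <= b ->
  forall x y, c * `|x - y| <= `|F t x - F t y|.
Hypothesis F_surjective : forall t, 0 <= t -> forall w, exists z, F t z = w.

Lemma exists_loop_inverse : exists G : R -> 'cV[R]_p -> 'cV[R]_p,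
  forall t, 0 <= t -> forall w, F t (G t w) = w.
Proof.
have H (q : R * 'cV[R]_p) : exists z, 0 <= q.1 -> F q.1 z = q.2.
  have [q0|q0] := leP 0 q.1; last by exists 0.
  by have [z Hz] := F_surjective q0 q.2; exists z.
by have [G HG] := choice H; exists (fun t w => G (t, w)) => t t0 w; exact: HG (t, w) t0.
Qed.

Section inverse.
Variable G : R -> 'cV[R]_p -> 'cV[R]_p.
Hypothesis GK : forall t, 0 <= t -> forall w, F t (G t w) = w.

Lemma loop_inverse_lip : unif_lip G.
Proof.
move=> b; have [c c0 Hc] := F_expanding b; have [L [K [L0 HL]]] := f_lip b.
exists c^-1, (c^-1 * (m%:R * `|mxD S| * K)); split => [|t t0 tb]; first by rewrite invr_ge0 ltW.
split => [w w'|].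
  have := Hc t t0 tb (G t w) (G t w'); rewrite !GK// => h.
  by rewrite mulrC ler_pdivlMr// mulrC.
have := Hc t t0 tb (G t 0) 0; rewrite GK// subr0 /closed_loop !sub0r opprK => h.
rewrite mulrC ler_pdivlMr// mulrC (le_trans h)// (le_trans (mulmx_norm_le _ _))//.
by rewrite ler_wpM2l ?mulr_ge0//; have [] := HL t t0 tb.
Qed.

Let F_lip t : 0 <= t ->
  exists2 L, 0 <= L & forall x y, `|F t x - F t y| <= L * `|x - y|.
Proof.
move=> t0; have [L [K [L0 HL]]] := f_lip t; have [h1 _] := HL t t0 (lexx t).
exists (1 + m%:R * `|mxD S| * L); last exact: closed_loop_lip.
by rewrite addr_ge0 ?mulr_ge0.
Qed.

(** [implicit_measurable] applies because approximate solutions of [F t z = w t] are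
close to [G t (w t)], by expansion. *)
Lemma loop_inverse_measurable (w : R -> 'cV[R]_p) (psi : R -> 'cV[R]_p -> R) :
  cmeasurable (@Rplus R) w ->
  (forall z, measurable_fun (@Rplus R : set (lebR R)) (fun t => psi t z)) ->
  (forall t, 0 <= t -> exists2 L, 0 <= L & forall x y, `|psi t x - psi t y| <= L * `|x - y|) ->
  measurable_fun (@Rplus R : set (lebR R)) (fun t => psi t (G t (w t))).
Proof.
move=> mw mpsi psilip.
have lip_small (V : normedModType R) (h : 'cV[R]_p -> V) u L e : 0 <= L -> 0 < e ->
    (forall x y, `|h x - h y| <= L * `|x - y|) ->
    exists2 d, 0 < d & forall z, `|z - u| < d -> `|h z - h u| <= e.
  move=> L0 e0 hL; have L1 : 0 < 1 + L by rewrite ltr_wpDr.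
  exists (e / (1 + L)) => [|z]; first by rewrite divr_gt0.
  rewrite ltr_pdivlMr// => zu; rewrite (le_trans (hL _ _))// (le_trans _ (ltW zu))//.
  by rewrite mulrC ler_wpM2l// lerDr.
have phi_meas z i : measurable_fun (@Rplus R : set (lebR R)) (fun t : lebR R => F t z i 0).
  have mz : cmeasurable (@Rplus R) (fun=> z) by move=> j; exact: measurable_cst.
  exact: (cmeasurableB mz (cmeasurable_mulmx (mxD S) (f_meas z))).
have near_sol t : @Rplus R t -> forall e : R, 0 < e -> exists2 de : R, 0 < de &
    forall z, `|z - G t (w t)| < de -> `|F t z - w t| <= e.
  move=> t0 e e0; have [L L0 HL] := F_lip t0.
  have [d d0 Hd] := lip_small _ (F t) (G t (w t)) L e L0 e0 HL.
  by exists d => // z /Hd; rewrite GK.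
have sol_near t : @Rplus R t -> forall e : R, 0 < e -> exists2 de : R, 0 < de &
    forall z, `|F t z - w t| <= de -> `|z - G t (w t)| < e.
  move=> t0 e e0; have [c c0 Hc] := F_expanding t.
  exists (c * e / 2) => [|z]; first by rewrite divr_gt0// mulr_gt0.
  have := Hc t t0 (lexx t) z (G t (w t)); rewrite GK// => h1 h2.
  have ce : 0 < c * e by rewrite mulr_gt0.
  rewrite -(ltr_pM2l c0) (le_lt_trans h1)// (le_lt_trans h2)//.
  by rewrite ltr_pdivrMr// ltr_pMr// ltr1n.
have psi_cont t : @Rplus R t -> forall e : R, 0 < e -> exists2 de : R, 0 < de &
    forall z, `|z - G t (w t)| < de -> `|psi t z - psi t (G t (w t))| <= e.
  move=> t0 e e0; have [L L0 HL] := psilip t t0.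
  have [d d0 Hd] := lip_small _ (psi t) (G t (w t)) L e L0 e0 HL.
  by exists d.
exact: (@implicit_measurable R _ (lebR R) (@Rplus R) (@measurable_Rplus R) p p
  (fun t => F t) w psi (fun t => G t (w t)) phi_meas mw mpsi near_sol sol_near psi_cont).
Qed.

End inverse.

(** Solving the output equation by [G] turns the system into the differential equation
with right-hand side [k], to which Picard's theorem applies. The input [v] is first
replaced by the locally bounded [u], which changes it on a null set only. *)
Lemma exists_trajectory v t0 (x0 : 'cV[R]_n) : Loo_loc (@Rplus R) v -> 0 <= t0 ->
  exists w, [/\ trajectories S f t0 w, inp w = v & sta w t0 = x0].
Proof.
move=> Lv t00; have [G GK] := exists_loop_inverse.
have [u [mu ub uv]] := bounded_modification Lv.
pose w (x : R -> 'cV[R]_n) t := mxC S *m x t + mxDe S *m u t.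
pose h t (x : 'cV[R]_n) := G t (mxC S *m x + mxDe S *m u t).
pose k t x := mxA S *m x + mxB S *m f t (h t x) + mxBe S *m u t.
have h_lip : unif_lip h.
  apply: (unif_lip_comp (g := G) (h := fun t x => mxC S *m x + mxDe S *m u t)).
    exact: loop_inverse_lip.
  apply: unif_lipD; apply: unif_lip_mulmx; [exact: unif_lip_id|exact: unif_lip_cst].
have fh_lip : unif_lip (fun t x => f t (h t x)) by exact: unif_lip_comp.
have k_lip : unif_lip k.
  apply: unif_lipD; first apply: unif_lipD; apply: unif_lip_mulmx => //.
    exact: unif_lip_id.
  exact: unif_lip_cst.
have w_meas x : curve_continuous x -> cmeasurable (@Rplus R) (w x).
  move=> cx; have mx := curve_continuous_cmeasurable (D := @Rplus R) cx.
  exact: (cmeasurableD (cmeasurable_mulmx (mxC S) mx) (cmeasurable_mulmx (mxDe S) mu)).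
have h_meas x : curve_continuous x -> cmeasurable (@Rplus R) (fun t => h t (x t)).
  move=> cx i; apply: (loop_inverse_measurable GK (psi := fun t z => z i 0) (w_meas x cx)).
    by move=> z; exact: measurable_cst.
  move=> t _; exists 1 => // y z; rewrite mul1r.
  by have := entry_le_norm (y - z) i 0; rewrite !mxE.
have fh_meas x : curve_continuous x -> cmeasurable (@Rplus R) (fun t => f t (h t (x t))).
  move=> cx i; apply: (loop_inverse_measurable GK (psi := fun t z => f t z i 0) (w_meas x cx)).
    by move=> z; exact: f_meas.
  move=> t tge0; have [L [K [L0 HL]]] := f_lip t; exists L => // y z.
  have [h1 _] := HL t tge0 (lexx t).
  by have := le_trans (entry_le_norm (f t y - f t z) i 0) (h1 y z); rewrite !mxE.
have k_meas x : curve_continuous x -> cmeasurable (@Rplus R) (fun t => k t (x t)).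
  move=> cx; have mx := curve_continuous_cmeasurable (D := @Rplus R) cx.
  exact: (cmeasurableD (cmeasurableD (cmeasurable_mulmx (mxA S) mx)
    (cmeasurable_mulmx (mxB S) (fh_meas x cx))) (cmeasurable_mulmx (mxBe S) mu)).
have [x [x_t0 cx xlip xder]] : exists x, solves k t0 x0 x x.
  apply: picard_existence.
    by move=> x cx i; exact: (measurable_fun_tail t00 (k_meas x cx i)).
  move=> b; have [L [K [_ HL]]] := k_lip b; exists L, K => t t0t.
  exact: HL (le_trans t00 t0t).
have bnd (q : nat) (g : R -> 'cV[R]_n -> 'cV[R]_q) b : unif_lip g ->
    exists M, forall t, t0 <= t -> t <= b -> `|g t (x t)| <= M.
  move=> /(@unif_lip_le _ _ _ _ b)[L [K [L0 H]]].
  have [M HM] := curve_bounded t0 b cx; exists (L * M + K) => t t0t tb.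
  by rewrite (le_trans (H t (le_trans t00 t0t) tb _))// lerD2r ler_wpM2l// HM.
have J0 : itv_co t0 +oo%E `<=` @Rplus R.
  by move=> t [t0t _]; exact: le_trans t0t.
have integ (q : nat) (g : R -> 'cV[R]_n -> 'cV[R]_q) : unif_lip g ->
    cmeasurable (@Rplus R) (fun t => g t (x t)) -> L1_loc (itv_co t0 +oo%E) (fun t => g t (x t)).
  move=> glip gm a b abJ; have [M HM] := bnd _ _ b glip.
  apply: (@bounded_cintegrable _ _ _ _ M).
    exact: (cmeasurableS (@measurable_Rplus R) (subset_trans abJ J0) gm).
  move=> t at_ tb; have [|t0t _] := abJ t; first by rewrite /= in_itv/= at_ tb.
  exact: HM.
exists (Triple +oo%E v x (fun t => h t (x t))); split => //; last exact: x_t0.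
split => //; split.
- exact: ltry.
- split; [exact: Lv| |exact: (integ p h h_lip (h_meas x cx))].
  move=> a b abJ; have [M HM] := xlip b; apply: (@lip_on_abs_continuous _ _ _ _ M) => i r s ar rs sb.
  have [|t0r _] := abJ r; first by rewrite /= in_itv/= ar (le_trans rs).
  exact: HM.
- exact: (integ m (fun t z => f t (h t z)) fh_lip (fh_meas x cx)).
- apply: (leb_ae _).2.
  have nt0 : {ae @lebesgue_measure R, forall t, t <> t0}.
    by apply: negligibleS (negligible_set1 t0) => t /= H; apply: contrapT => ?; exact: H.
  apply: (aeS (aeI nt0 (aeI uv xder))) => t [tt0 [uvt H]] [t0t _].
  rewrite -uvt; last exact: le_trans t0t.
  apply/is_derive_mxP; apply: H; rewrite lt_neqAle t0t andbT eq_sym; exact/eqP.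
- apply: (leb_ae _).2; apply: (aeS uv) => t uvt [t0t _].
  have tge0 := le_trans t00 t0t; rewrite -uvt//.
  have := GK t tge0 (mxC S *m x t + mxDe S *m u t).
  rewrite -/(h t (x t)) /closed_loop => /eqP; rewrite subr_eq => /eqP {1}->.
  by rewrite addrAC.
Qed.

End lure_existence.

(** * The closed loop maps on bounded time intervals *)

Section loop_bounds.
Variables (R : realType) (p m : nat) (D : 'M[R]_(p, m)).
Variable f : R -> 'cV[R]_p -> 'cV[R]_m.
Hypothesis p_gt0 : (0 < p)%N.
Hypothesis f_lip : loc_lipschitz f.
Hypothesis f_clarke : forall T : set R, compact T -> T `<=` @Rplus R ->
  exists (xi0 : 'cV[R]_p) (b delta : R),
    [/\ 0 < b, 0 < delta,
        exists c : R, forall t, T t -> enorm (f t xi0) <= c,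
        forall M, clarke_bigcup f T M -> opnorm M <= b &
        forall M, clarke_bigcup f T M -> delta <= `|\det (1%:M - D *m M)| ].

Let lipschitz_at t : 0 <= t -> lipschitz_on_balls (f t).
Proof.
move=> t0 rho; have [lam [lam0 _] H] := f_lip (@compact_matrix_ball R p 1 rho).
exists (lam t * p%:R) => x y xr yr.
rewrite (le_trans (norm_le_enorm _))// (le_trans (H x y xr yr t t0))//.
by rewrite -mulrA ler_wpM2l ?lam0// enorm_le_norm.
Qed.

Let clarke_bounds c : exists (xi0 : 'cV[R]_p) (b de K : R),
  [/\ 0 < b, 0 < de & forall t, 0 <= t -> t <= c -> [/\ `|f t xi0| <= K,
    forall z M, clarke (f t) z M -> `|M| <= b &
    forall z M, clarke (f t) z M -> de <= `|\det (1%:M - D *m M)|]].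
Proof.
have sub : [set` `[0, c]] `<=` @Rplus R by move=> t; rewrite /= in_itv/= => /andP[].
have [xi0 [b [de [b0 de0 [K HK] Hb Hde]]]] := f_clarke (@segment_compact R 0 c) sub.
exists xi0, b, de, K; split => // t t0 tc.
have tT : [set` `[0, c]] t by rewrite /= in_itv/= t0 tc.
have inU z M : clarke (f t) z M -> clarke_bigcup f [set` `[0, c]] M.
  by move=> zM; exists (t, z).
split => [|z M /inU/Hb Mb|z M /inU/Hde//].
  exact: le_trans (norm_le_enorm _) (HK t tT).
by apply: norm_le_opnorm => //; exact: ltW.
Qed.

Lemma nonlinearity_unif_lip : unif_lip f.
Proof.
move=> c; have [xi0 [b [de [K [b0 de0 H]]]]] := clarke_bounds c.
have pb : 0 <= p%:R * b by rewrite mulr_ge0// ltW.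
exists (p%:R * b), (p%:R * b * `|xi0| + K); split => // t t0 tc.
have [Ht Mb Md] := H t t0 tc.
have lip := global_lipschitz (ltW b0) (lipschitz_at t0) Mb.
split => [x y|]; first exact: lip.
rewrite (_ : f t 0 = (f t 0 - f t xi0) + f t xi0); last by rewrite subrK.
rewrite (le_trans (ler_normD _ _))// lerD// (le_trans (lip _ _))//.
by rewrite sub0r normrN.
Qed.

Lemma closed_loop_unif_expanding c : exists2 k, 0 < k & forall t, 0 <= t -> t <= c ->
  forall x y, k * `|x - y| <= `|closed_loop (f t) D x - closed_loop (f t) D y|.
Proof.
have [xi0 [b [de [K [b0 de0 H]]]]] := clarke_bounds c.
exists (expansion_const p (1 + m%:R * `|D| * b) de / (4 * (1 + p%:R))) => [|t t0 tc x y].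
  have be0 : 0 <= 1 + m%:R * `|D| * b by rewrite addr_ge0// mulr_ge0 ?mulr_ge0// ltW.
  by apply: divr_gt0; [exact: expansion_const_gt0|rewrite mulr_gt0// ltr_pwDl].
have [Ht Mb Md] := H t t0 tc.
exact: (closed_loop_expansion p_gt0 (ltW b0) de0 (lipschitz_at t0) Mb Md).
Qed.

Lemma closed_loop_onto t : 0 <= t -> forall w, exists z, closed_loop (f t) D z = w.
Proof.
move=> t0 w; have [xi0 [b [de [K [b0 de0 H]]]]] := clarke_bounds t.
have [Ht Mb Md] := H t t0 (lexx t).
exact: (closed_loop_surjective p_gt0 (ltW b0) de0 (lipschitz_at t0) Mb Md).
Qed.

End loop_bounds.

Theorem corollary4p8 (R : realType) (n m me p : nat)
    (n_gt0 : (0 < n)%N) (m_gt0 : (0 < m)%N)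
    (me_gt0 : (0 < me)%N) (p_gt0 : (0 < p)%N)
    (S : linsys R n m me p) (f : R -> 'cV[R]_p -> 'cV[R]_m)
    (f_carath : caratheodory_fun f)
    (f_lip : loc_lipschitz f)
    (f_clarke : forall T : set R, compact T -> T `<=` @Rplus R ->
       exists (xi0 : 'cV[R]_p) (b delta : R),
         [/\ 0 < b, 0 < delta,
             exists c : R, forall t, T t -> enorm (f t xi0) <= c,
             forall M, clarke_bigcup f T M -> opnorm M <= b &
             forall M, clarke_bigcup f T M ->
               delta <= `|\det (1%:M - mxD S *m M)| ]) :
  [/\ uniqueness_property S f,
      forall t0 : R, 0 <= t0 ->
        max_pre_trajectories S f t0 = trajectories S f t0 &
      forall v : R -> 'cV[R]_me, Loo_loc (@Rplus R) v ->
      forall (t0 : R) (x0 : 'cV[R]_n), 0 <= t0 ->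
        exists w, [/\ trajectories S f t0 w, inp w = v, sta w t0 = x0 &
          forall w', trajectories S f t0 w' -> inp w' = v -> sta w' t0 = x0 ->
            coincide t0 +oo%E w w']].

Proof.
have flip := nonlinearity_unif_lip f_lip f_clarke.
have Fexp := closed_loop_unif_expanding p_gt0 f_lip f_clarke.
have Fonto := closed_loop_onto p_gt0 f_lip f_clarke.
have uniq t0 w w' := @pre_trajectory_unique R n m me p S f flip Fexp t0 w w'.
have exist v t0 (x0 : 'cV[R]_n) :=
  @exists_trajectory R n m me p S f f_carath.2 flip Fexp Fonto v t0 x0.
split.
- by move=> v _ t0 t00 w w' Hw Hw' wv wv'; apply: uniq => //; rewrite wv wv'.
- move=> t0 t00; apply/seteqP; split => w [Hw] /= Hmax; last first.
    split => // -[w' [_ _]]; by rewrite Hmax ltNge leey.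
  (* A pre-trajectory that ends early is extended by the trajectory on the half-line
     with the same initial state. *)
  split => //; apply: contrapT => fin_tau; apply: Hmax.
  have Lv : Loo_loc (@Rplus R) (inp w) by case: w Hw {fin_tau} => tau v x y [_ []].
  have [w' [[Hw' tau'] vw' xw']] := exist _ t0 (sta w t0) Lv t00.
  exists w'; split => //.
    by rewrite tau' ltNge leye_eq; apply/eqP.
  have [|] := uniq t0 w w' t00 Hw Hw' (esym vw') _ (esym xw').
    by rewrite tau' leey.
  move=> xE yE; split => [t Jt|]; first by rewrite xE.
  apply: (leb_ae _).2; apply: (aeS ((leb_ae _).1 yE)) => t H Jt.
  by rewrite H.
- move=> v Lv t0 x0 t00; have [w [[Hw wtau] wv wx]] := exist v t0 x0 Lv t00.
  exists w; split => // w' [Hw' w'tau] w'v w'x; rewrite -wtau.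
  by apply: uniq => //; rewrite ?wv ?wx ?wtau ?w'tau.
Qed.
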